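(* Let $k$ be a field and suppose that $Q$ is an infinite Dynkin quiver of type $\mathbb A_\infty$. (1) If $Q$ has no left infinite path, then $\Gamma_{\mathrm{rep}^+(Q)}$ consists of the preprojective component and a preinjective component of shape $\mathbb N^-\mathbb A_\infty$. (2) If $Q$ is a left infinite path, then $\Gamma_{\mathrm{rep}^+(Q)}$ consists of the preprojective component of shape $\mathbb N\mathbb A_\infty$. (3) If $Q$ is not a left infinite path but has left infinite paths, then $\Gamma_{\mathrm{rep}^+(Q)}$ consists of the preprojective component of shape $\mathbb N\mathbb A_\infty$ and a finite preinjective component.
   Context: $Q$ is of type $\mathbb A_\infty$ if its underlying graph is $\circ-\circ-\circ-\cdots$, with arbitrary orientation. A left infinite path has the form $\cdots\to a_2\to a_1\to a_0$ (ending point $a_0$); ''$Q$ is a left infinite path'' means that the whole quiver is of this form. $Q^+$ is the full subquiver of $Q$ generated by the vertices which are not the ending point of any left infinite path. Write $Q(x,y)$ for the set of paths from $x$ to $y$ (including trivial paths). For a vertex $a$: $P_a(x)$ has $k$-basis $Q(a,x)$, an arrow $\alpha$ acting by $\rho\mapsto\alpha\rho$; $I_a(x)$ has $k$-basis $Q(x,a)$, where $I_a(\alpha)$ sends $\rho\alpha$ to $\rho$ and vanishes on paths not factoring through $\alpha$. $\mathrm{rep}^+(Q)$ is the category of finitely presented $k$-representations: those $M$ with an exact sequence $0\to P_1\to P_0\to M\to0$ where $P_0,P_1$ are finite direct sums of $P_a$'s. It is a hereditary abelian, Hom-finite, Krull-Schmidt $k$-category. Auslander-Reiten quiver. For a Hom-finite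 Krull-Schmidt $k$-category $\mathcal A$ and indecomposables $X,Y$ put $\mathrm{irr}(X,Y)=\mathrm{rad}(X,Y)/\mathrm{rad}^2(X,Y)$, with dimension $d'_{XY}$ over $\mathrm{End}(X)/\mathrm{rad}(X,X)$ and $d_{XY}$ over $\mathrm{End}(Y)/\mathrm{rad}(Y,Y)$. $\Gamma_{\mathcal A}$ has as vertices a complete set of representatives of isomorphism classes of indecomposables; there is an arrow $X\to Y$ with valuation $(d_{XY},d'_{XY})$ iff $d_{XY}>0$, each symmetrically valued arrow being replaced by $d_{XY}$ unvalued arrows; $\tau Z=X$ iff $\mathcal A$ has an almost split sequence $X\to Y\to Z$ (for $\mathcal A$ abelian: a short exact sequence with first map minimal left almost split and second map minimal right almost split). A connected component of $\Gamma_{\mathrm{rep}^+(Q)}$ is preprojective if it contains some $P_x$ (there is exactly one such component), and preinjective if it contains some $I_x$ with $x\in Q^+$. For a quiver $\Delta$ without oriented cycles, $\mathbb Z\Delta$ is the translation quiver with vertices $(n,x)$, $n\in\mathbb Z$, $x\in\Delta_0$, arrows $(n,x)\to(n,y)$ and $(n,y)\to(n+1,x)$ for each arrow $x\to y$ of $\Delta$, and $\tau(n,x)=(n-1,x)$; $\mathbb N\Delta$ (respectively $\mathbb N^-\Delta$) is the full translation subquiver on the $(n,x)$ with $n\ge0$ (respectively $n\le0$). ''Of shape $\mathbb N\mathbb A_\infty$, $\mathbb N^-\mathbb A_\infty$'' means isomorphic to $\mathbb N\Delta$, $\mathbb N^-\Delta$, respectively, with $\Delta$ a quiver of type $\mathbb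 A_\infty$. *)

(* Defs.v *)
From HB Require Import structures.
From mathcomp Require Import all_boot all_order all_algebra.
From mathcomp Require Import finmap.
From mathcomp Require Import boolp.
From mathcomp Require Import monalg.
From Stdlib Require List.
From Stdlib Require Import Relation_Operators.

Set Implicit Arguments.
Unset Strict Implicit.
Unset Printing Implicit Defensive.
Local Obligation Tactic := idtac.

Import GRing.Theory.
Local Open Scope ring_scope.

Record quiver := Quiver {
  vertex :> Type;
  arrow : vertex -> vertex -> Type }.
Arguments arrow {_} x y.

Definition quiver_iso (Q Q' : quiver) : Prop :=
  exists f : Q -> Q', bijective f /\
    forall x y : Q, exists h : arrow x y -> arrow (f x) (f y), bijective h.

(** Vertices 0, 1, 2, ... and one arrow between n and n+1, directed
    n -> n+1 if [o n] holds and n+1 -> n otherwise. *)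
Definition Ainf_quiver (o : nat -> bool) : quiver :=
  {| vertex := nat;
     arrow i j := (j == i.+1) && o i || (i == j.+1) && ~~ o j |}.

Definition type_Ainf (Q : quiver) : Prop :=
  exists o : nat -> bool, quiver_iso (Ainf_quiver o) Q.

(** The vertex a is the ending point a_0 of some ... -> a_2 -> a_1 -> a_0. *)
Definition ends_left_infinite_path (Q : quiver) (a : Q) : Prop :=
  exists v : nat -> Q, v 0%N = a /\ forall n, inhabited (arrow (v n.+1) (v n)).

Definition has_left_infinite_path (Q : quiver) : Prop :=
  exists a : Q, ends_left_infinite_path a.

Definition left_infinite_quiver : quiver :=
  {| vertex := nat; arrow i j := (i == j.+1 : Prop) |}.

Definition is_left_infinite_path (Q : quiver) : Prop :=
  quiver_iso left_infinite_quiver Q.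

Definition in_Qplus (Q : quiver) (x : Q) : Prop := ~ ends_left_infinite_path x.

(** [qpath a x] is Q(a, x); [pcons rho al] is the path "rho, then al", written
    al rho when paths are composed like maps. *)
Inductive qpath (Q : quiver) (a : Q) : Q -> Type :=
| pnil : qpath a a
| pcons (x y : Q) : qpath a x -> arrow x y -> qpath a y.
Arguments pnil {Q a}.
Arguments pcons {Q a x y} rho al.

(** "sigma, then rho", that is, rho sigma. *)
Fixpoint pcat (Q : quiver) (x y z : Q) (sigma : qpath x y) (rho : qpath y z) :
    qpath x z :=
  match rho in qpath _ z' return qpath x z' with
  | pnil => sigma
  | pcons _ _ rho' al => pcons (pcat sigma rho') al
  end.

Definition pprecomp (Q : quiver) (x y a : Q) (al : arrow x y) (rho : qpath y a) :
  qpath x a := pcat (pcons pnil al) rho.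

HB.instance Definition _ (Q : quiver) (a x : Q) := gen_eqMixin (qpath a x).
HB.instance Definition _ (Q : quiver) (a x : Q) := gen_choiceMixin (qpath a x).

Record kcat (k : fieldType) := KCat {
  obj :> Type;
  hom : obj -> obj -> lmodType k;
  idm : forall X, hom X X;
  cmp : forall X Y Z, hom Y Z -> hom X Y -> hom X Z;
  cmpA : forall X Y Z W (h : hom Z W) (g : hom Y Z) (f : hom X Y),
    cmp h (cmp g f) = cmp (cmp h g) f;
  cmp1m : forall X Y (f : hom X Y), cmp (idm Y) f = f;
  cmpm1 : forall X Y (f : hom X Y), cmp f (idm X) = f;
  cmp_linearl : forall X Y Z (f : hom X Y), linear (fun g : hom Y Z => cmp g f);
  cmp_linearr : forall X Y Z (g : hom Y Z), linear (fun f : hom X Y => cmp g f)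
}.
Arguments hom {_ _} X Y.
Arguments idm {_ _} X.
Arguments cmp {_ _ X Y Z} _ _.

Definition full_subcat (k : fieldType) (A : kcat k) (P : A -> Prop) : kcat k :=
  {| obj := {X : A | P X};
     hom := fun X Y => hom (sval X) (sval Y);
     idm := fun X => idm (sval X);
     cmp := fun X Y Z g f => cmp g f;
     cmpA := fun X Y Z W h g f => cmpA h g f;
     cmp1m := fun X Y f => cmp1m f;
     cmpm1 := fun X Y f => cmpm1 f;
     cmp_linearl := fun X Y Z f => @cmp_linearl k A (sval X) (sval Y) (sval Z) f;
     cmp_linearr := fun X Y Z g => @cmp_linearr k A (sval X) (sval Y) (sval Z) g |}.

Section Category.
Variables (k : fieldType) (A : kcat k).
Implicit Types X Y Z W : A.

Definition invertible X Y (f : hom X Y) : Prop :=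
  exists g : hom Y X, cmp g f = idm X /\ cmp f g = idm Y.

Definition isom X Y : Prop := exists f : hom X Y, invertible f.

Definition is_zero X : Prop := idm X = 0.

Definition is_biproduct X Y Z : Prop :=
  exists (i : hom Y X) (j : hom Z X) (p : hom X Y) (q : hom X Z),
    [/\ cmp p i = idm Y, cmp q j = idm Z, cmp p j = 0, cmp q i = 0 &
        cmp i p + cmp j q = idm X].

Definition indecomposable X : Prop :=
  ~ is_zero X /\ forall Y Z, is_biproduct X Y Z -> is_zero Y \/ is_zero Z.

(** The Jacobson radical of the category, and its square. *)
Definition rad X Y (f : hom X Y) : Prop :=
  forall g : hom Y X, invertible (idm X - cmp g f).

Definition rad2 X Y (f : hom X Y) : Prop :=
  exists (n : nat) (Z : 'I_n -> A)
         (h : forall i, hom X (Z i)) (g : forall i, hom (Z i) Y),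
    (forall i, rad (h i) /\ rad (g i)) /\ f = \sum_i cmp (g i) (h i).

(** [irr_dim X Y d]: irr(X, Y) = rad(X, Y) / rad^2(X, Y) has a basis of d
    elements over End(Y) / rad(Y, Y), that is, d_XY = d.  A basis is given by
    representatives in rad(X, Y), scalars by representatives in End(Y). *)
Definition irr_dim X Y (d : nat) : Prop :=
  exists f : 'I_d -> hom X Y,
    [/\ forall i, rad (f i),
        forall g : hom X Y, rad g ->
          exists e : 'I_d -> hom Y Y, rad2 (g - \sum_i cmp (e i) (f i)) &
        forall e : 'I_d -> hom Y Y, rad2 (\sum_i cmp (e i) (f i)) ->
          forall i, rad (e i)].

(** [irr_dim' X Y d]: the same over End(X) / rad(X, X), that is, d'_XY = d. *)
Definition irr_dim' X Y (d : nat) : Prop :=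
  exists f : 'I_d -> hom X Y,
    [/\ forall i, rad (f i),
        forall g : hom X Y, rad g ->
          exists e : 'I_d -> hom X X, rad2 (g - \sum_i cmp (f i) (e i)) &
        forall e : 'I_d -> hom X X, rad2 (\sum_i cmp (f i) (e i)) ->
          forall i, rad (e i)].

Definition is_kernel X Y Z (f : hom X Y) (g : hom Y Z) : Prop :=
  cmp g f = 0 /\
  forall W (h : hom W Y), cmp g h = 0 -> exists! u : hom W X, cmp f u = h.

Definition is_cokernel X Y Z (f : hom X Y) (g : hom Y Z) : Prop :=
  cmp g f = 0 /\
  forall W (h : hom Y W), cmp h f = 0 -> exists! u : hom Z W, cmp u g = h.

Definition short_exact X Y Z (f : hom X Y) (g : hom Y Z) : Prop :=
  is_kernel f g /\ is_cokernel f g.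

Definition is_section X Y (f : hom X Y) : Prop :=
  exists g : hom Y X, cmp g f = idm X.

Definition is_retraction X Y (f : hom X Y) : Prop :=
  exists g : hom Y X, cmp f g = idm Y.

Definition left_almost_split X Y (f : hom X Y) : Prop :=
  ~ is_section f /\
  forall W (h : hom X W), ~ is_section h -> exists u : hom Y W, cmp u f = h.

Definition left_minimal X Y (f : hom X Y) : Prop :=
  forall e : hom Y Y, cmp e f = f -> invertible e.

Definition right_almost_split Y Z (g : hom Y Z) : Prop :=
  ~ is_retraction g /\
  forall W (h : hom W Z), ~ is_retraction h -> exists u : hom W Y, cmp g u = h.

Definition right_minimal Y Z (g : hom Y Z) : Prop :=
  forall e : hom Y Y, cmp g e = g -> invertible e.

Definition almost_split X Y Z (f : hom X Y) (g : hom Y Z) : Prop :=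
  [/\ short_exact f g,
      left_minimal f /\ left_almost_split f &
      right_minimal g /\ right_almost_split g].

(** A complete set of representatives of the isomorphism classes of
    indecomposable objects; these are the vertices of the Auslander-Reiten
    quiver. *)
Record ind_reps := IndReps {
  ind_idx :> Type;
  ind_obj :> ind_idx -> A;
  ind_indec : forall i, indecomposable (ind_obj i);
  ind_inj : forall i j, isom (ind_obj i) (ind_obj j) -> i = j;
  ind_full : forall X, indecomposable X -> exists i, isom X (ind_obj i) }.

End Category.

(** The valuation of an arrow is [None] for an unvalued arrow; [tau x y] means
    that the translate of x is defined and equal to y.  (This is not a structure
    over [quiver] because its vertices live in a larger universe.) *)
Record vtquiver := VTQuiver {
  tvertex :> Type;
  tarrow : tvertex -> tvertex -> Type;
  tval : forall x y, tarrow x y -> option (nat * nat);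
  tau : tvertex -> tvertex -> Prop }.
Arguments tarrow {_} x y.
Arguments tval {_ x y} a.
Arguments tau {_} x y.

Definition vtquiver_iso (G H : vtquiver) : Prop :=
  exists f : G -> H,
    [/\ bijective f,
        forall x y : G, exists h : tarrow x y -> tarrow (f x) (f y),
          bijective h /\ forall a, tval (h a) = tval a &
        forall x y : G, tau x y <-> tau (f x) (f y)].

Definition full_subvtquiver (G : vtquiver) (P : G -> Prop) : vtquiver :=
  {| tvertex := {x : G | P x};
     tarrow := fun x y => tarrow (sval x) (sval y);
     tval := fun x y a => tval a;
     tau := fun x y => tau (sval x) (sval y) |}.

Definition connected (G : vtquiver) : G -> G -> Prop :=
  clos_refl_sym_trans G (fun x y => inhabited (tarrow x y)).

Definition is_component (G : vtquiver) (C : G -> Prop) : Prop :=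
  exists x : G, forall y : G, C y <-> connected x y.

(** The left summand of [ZZ_arrow] consists of the arrows (n,x) -> (n,y), the
    right one of the arrows (n,y) -> (n+1,x), for each arrow x -> y. *)
Definition ZZ_arrow (D : quiver) (u v : int * D) : Type :=
  ((v.1 == u.1) * arrow u.2 v.2) + ((v.1 == u.1 + 1) * arrow v.2 u.2).

Definition ZZ (D : quiver) : vtquiver :=
  {| tvertex := (int * D)%type;
     tarrow := @ZZ_arrow D;
     tval := fun _ _ _ => None;
     tau := fun u v => v = (u.1 - 1, u.2) |}.

Definition NN (D : quiver) : vtquiver :=
  @full_subvtquiver (ZZ D) (fun u => 0 <= u.1).

Definition NNminus (D : quiver) : vtquiver :=
  @full_subvtquiver (ZZ D) (fun u => u.1 <= 0).

Definition shape_NAinf (G : vtquiver) : Prop :=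
  exists D : quiver, type_Ainf D /\ vtquiver_iso G (NN D).

Definition shape_NminusAinf (G : vtquiver) : Prop :=
  exists D : quiver, type_Ainf D /\ vtquiver_iso G (NNminus D).

Section AuslanderReiten.
Variables (k : fieldType) (A : kcat k) (S : ind_reps A).

Inductive AR_arrow (X Y : S) : Type :=
| AR_unvalued (d : nat) of
    irr_dim (S X) (S Y) d & irr_dim' (S X) (S Y) d & 'I_d
| AR_valued (d d' : nat) of
    irr_dim (S X) (S Y) d & irr_dim' (S X) (S Y) d' & (0 < d)%N & d != d'.

Definition AR_val (X Y : S) (a : AR_arrow X Y) : option (nat * nat) :=
  match a with
  | AR_unvalued _ _ _ _ => None
  | AR_valued d d' _ _ _ _ => Some (d, d')
  end.

Definition AR_quiver : vtquiver :=
  {| tvertex := S;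
     tarrow := AR_arrow;
     tval := AR_val;
     tau := fun Z X => exists (Y : A) (f : hom (S X) Y) (g : hom Y (S Z)),
       almost_split f g |}.

End AuslanderReiten.

Record rep (k : fieldType) (Q : quiver) := Rep {
  rspace :> Q -> lmodType k;
  rmap : forall x y, arrow x y -> {linear rspace x -> rspace y} }.
Arguments rmap {k Q} r {x y} al.

Record rhom (k : fieldType) (Q : quiver) (M N : rep k Q) := RHom {
  rapp :> forall x : Q, M x -> N x;
  rapp_linear : forall x, linear (@rapp x);
  rapp_natural : forall (x y : Q) (al : arrow x y) (v : M x),
    rapp (rmap M al v) = rmap N al (rapp v) }.
Arguments rapp {k Q M N} r x v.

HB.instance Definition _ (k : fieldType) (Q : quiver) (M N : rep k Q) :=
  gen_eqMixin (rhom M N).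
HB.instance Definition _ (k : fieldType) (Q : quiver) (M N : rep k Q) :=
  gen_choiceMixin (rhom M N).
HB.instance Definition _ (k : fieldType) (Q : quiver) (M N : rep k Q)
    (f : rhom M N) (x : Q) :=
  GRing.isLinear.Build k (M x) (N x) *:%R (rapp f x)
    (@rapp_linear k Q M N f x).

Section RepHom.
Variables (k : fieldType) (Q : quiver).

Lemma rhomP (M N : rep k Q) (f g : rhom M N) :
  (forall x v, f x v = g x v) -> f = g.
Proof.
case: f g => [f lf nf] [g lg ng] /= fg.
have e : f = g by apply: functional_extensionality_dep => x; apply/funext/fg.
by case: _ / e lg ng => lg ng; congr RHom; exact: Prop_irrelevance.
Qed.

Section Operations.
Variables M N : rep k Q.
Implicit Types f g h : rhom M N.

Program Definition rzero : rhom M N := @RHom k Q M N (fun x v => 0) _ _.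
Next Obligation. by move=> x a u v /=; rewrite scaler0 addr0. Qed.
Next Obligation. by move=> x y al v /=; rewrite linear0. Qed.

Program Definition ropp f : rhom M N := @RHom k Q M N (fun x v => - f x v) _ _.
Next Obligation. by move=> f x a u v /=; rewrite linearP opprD scalerN. Qed.
Next Obligation. by move=> f x y al v /=; rewrite rapp_natural linearN. Qed.

Program Definition radd f g : rhom M N :=
  @RHom k Q M N (fun x v => f x v + g x v) _ _.
Next Obligation.
by move=> f g x a u v /=; rewrite !linearP scalerDr addrACA.
Qed.
Next Obligation. by move=> f g x y al v /=; rewrite !rapp_natural linearD. Qed.

Program Definition rscale (a : k) f : rhom M N :=
  @RHom k Q M N (fun x v => a *: f x v) _ _.
Next Obligation.
move=> a f x b u v /=.
by rewrite linearP scalerDr !scalerA [a * b]mulrC.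
Qed.
Next Obligation. by move=> a f x y al v /=; rewrite rapp_natural linearZ. Qed.

Lemma raddA : associative radd.
Proof. by move=> f g h; apply: rhomP => x v /=; rewrite addrA. Qed.
Lemma raddC : commutative radd.
Proof. by move=> f g; apply: rhomP => x v /=; rewrite addrC. Qed.
Lemma radd0 : left_id rzero radd.
Proof. by move=> f; apply: rhomP => x v /=; rewrite add0r. Qed.
Lemma raddN : left_inverse rzero ropp radd.
Proof. by move=> f; apply: rhomP => x v /=; rewrite addNr. Qed.

End Operations.

HB.instance Definition _ (M N : rep k Q) :=
  GRing.isZmodule.Build (rhom M N)
    (@raddA M N) (@raddC M N) (@radd0 M N) (@raddN M N).

Lemma rscaleA (M N : rep k Q) a b (f : rhom M N) :
  rscale a (rscale b f) = rscale (a * b) f.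
Proof. by apply: rhomP => x v /=; rewrite scalerA. Qed.
Lemma rscale1 (M N : rep k Q) : left_id 1 (@rscale M N).
Proof. by move=> f; apply: rhomP => x v /=; rewrite scale1r. Qed.
Lemma rscaleDr (M N : rep k Q) : right_distributive (@rscale M N) +%R.
Proof. by move=> a f g; apply: rhomP => x v /=; rewrite scalerDr. Qed.
Lemma rscaleDl (M N : rep k Q) (f : rhom M N) :
  {morph (@rscale M N)^~ f : a b / a + b}.
Proof. by move=> a b; apply: rhomP => x v /=; rewrite scalerDl. Qed.

HB.instance Definition _ (M N : rep k Q) :=
  GRing.Zmodule_isLmodule.Build k (rhom M N)
    (@rscaleA M N) (@rscale1 M N) (@rscaleDr M N) (@rscaleDl M N).

Program Definition rid (M : rep k Q) : rhom M M :=
  @RHom k Q M M (fun x v => v) _ _.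
Next Obligation. by []. Qed.
Next Obligation. by []. Qed.

Program Definition rcomp (M N L : rep k Q) (g : rhom N L) (f : rhom M N) :
    rhom M L := @RHom k Q M L (fun x v => g x (f x v)) _ _.
Next Obligation. by move=> M N L g f x a u v /=; rewrite !linearP. Qed.
Next Obligation. by move=> M N L g f x y al v /=; rewrite !rapp_natural. Qed.

End RepHom.

Program Definition Rep_cat (k : fieldType) (Q : quiver) : kcat k :=
  {| obj := rep k Q;
     hom := fun M N => rhom M N;
     idm := @rid k Q;
     cmp := @rcomp k Q |}.
Next Obligation. by move=> *; apply: rhomP. Qed.
Next Obligation. by move=> *; apply: rhomP. Qed.
Next Obligation. by move=> *; apply: rhomP. Qed.
Next Obligation. by move=> k Q X Y Z f a g h; apply: rhomP. Qed.
Next Obligation.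
by move=> k Q X Y Z g a f h; apply: rhomP => x v /=; rewrite linearP.
Qed.

Section FinitelyPresented.
Variables (k : fieldType) (Q : quiver).

(** The linear map {malg k[K]} -> V sending each basis element x to phi x. *)
Section LinearExtension.
Variables (K : choiceType) (V : lmodType k) (phi : K -> V).

Definition lin_ext (g : {malg k[K]}) : V := \sum_(x <- msupp g) g@_x *: phi x.

Lemma lin_ext_is_linear : linear lin_ext.
Proof.
have wide (g : {malg k[K]}) (d : {fset K}) : (msupp g `<=` d)%fset ->
    lin_ext g = \sum_(x <- d) g@_x *: phi x.
  move=> gd; rewrite /lin_ext (big_fset_incl _ gd) // => x _ xg.
  by rewrite mcoeff_outdom ?scale0r.
move=> a g h; pose d := (msupp g `|` msupp h `|` msupp (a *: g + h))%fset.
rewrite (wide g d) ?(wide h d) ?(wide _ d) ?scaler_sumr -?big_split /=.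
- by apply: eq_bigr => x _; rewrite mcoeffD mcoeffZ scalerDl scalerA.
- by rewrite /d fsubsetUr.
- by rewrite /d -fsetUA fsetUCA fsubsetUl.
- by rewrite /d -fsetUA fsubsetUl.
Qed.

HB.instance Definition _ := GRing.isLinear.Build k {malg k[K]} V *:%R lin_ext
  lin_ext_is_linear.

End LinearExtension.

Definition P_ (a : Q) : rep k Q :=
  @Rep k Q (fun x => {malg k[qpath a x]})
    (fun x y al => lin_ext (fun rho : qpath a x =>
       << pcons rho al >> : {malg k[qpath a y]})).

(** The action of al : x -> y on the basis of I_a(x): a path of the form
    "al, then rho" is sent to rho, and any other path to 0. *)
Definition I_basis_map (a x y : Q) (al : arrow x y) (sigma : qpath x a) :
    {malg k[qpath y a]} :=
  match pselect (exists rho : qpath y a, sigma = pprecomp al rho) with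
  | left e => << sval (cid e) >>
  | right _ => 0
  end.

Definition I_ (a : Q) : rep k Q :=
  @Rep k Q (fun x => {malg k[qpath x a]})
    (fun x y al => lin_ext (I_basis_map al)).

Definition rep0 : rep k Q :=
  @Rep k Q (fun x => 'rV[k]_0) (fun x y al => idfun).

Section DirectSum.
Variables M N : rep k Q.

Definition dsum_map (x y : Q) (al : arrow x y) (v : M x * N x) : M y * N y :=
  (rmap M al v.1, rmap N al v.2).

Lemma dsum_map_is_linear x y (al : arrow x y) : linear (dsum_map al).
Proof. by move=> a u v; rewrite /dsum_map /= !linearP. Qed.

HB.instance Definition _ x y (al : arrow x y) :=
  GRing.isLinear.Build k (M x * N x)%type (M y * N y)%type *:%R (dsum_map al)
    (@dsum_map_is_linear x y al).

Definition dsum : rep k Q :=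
  @Rep k Q (fun x => (M x * N x)%type) (fun x y al => dsum_map al).

End DirectSum.

Definition P_sum (s : seq Q) : rep k Q := foldr (fun a M => dsum (P_ a) M) rep0 s.

Definition rep_short_exact (M N L : rep k Q) (f : rhom M N) (g : rhom N L) :
  Prop := forall x : Q,
    [/\ injective (f x),
        forall v : N x, g x v = 0 <-> exists u : M x, f x u = v &
        forall w : L x, exists v : N x, g x v = w].

Definition finitely_presented (M : rep k Q) : Prop :=
  exists (s1 s0 : seq Q)
         (f : rhom (P_sum s1) (P_sum s0)) (g : rhom (P_sum s0) M),
    rep_short_exact f g.

(** rep^+(Q) *)
Definition repp : kcat k :=
  @full_subcat k (Rep_cat k Q) finitely_presented.

Variable S : ind_reps repp.

Definition vertex_iso (i : AR_quiver S) (M : rep k Q) : Prop :=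
  @isom k (Rep_cat k Q) (sval (S i)) M.

Definition is_preprojective (C : AR_quiver S -> Prop) : Prop :=
  is_component C /\ exists i (x : Q), C i /\ vertex_iso i (P_ x).

Definition is_preinjective (C : AR_quiver S -> Prop) : Prop :=
  is_component C /\
  exists i (x : Q), [/\ C i, in_Qplus x & vertex_iso i (I_ x)].

Definition the_preprojective (C : AR_quiver S -> Prop) : Prop :=
  is_preprojective C /\
  forall C', is_preprojective C' -> forall i, C' i <-> C i.

End FinitelyPresented.

Definition consists_of2 (G : vtquiver) (C D : G -> Prop) : Prop :=
  (forall x, C x \/ D x) /\ (forall x, ~ (C x /\ D x)).

Definition finitely_many (T : Type) (C : T -> Prop) : Prop :=
  exists s : seq T, forall x, C x -> List.In x s.

(** Hence a quantification over [ind_reps A] is never vacuous. *)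
Lemma ind_reps_exist (k : fieldType) (A : kcat k) : inhabited (ind_reps A).
Proof.
have isom_refl (X : A) : isom X X.
  by exists (idm X); exists (idm X); rewrite cmp1m.
have isom_sym (X Y : A) : isom X Y -> isom Y X.
  by move=> [f [g [gf fg]]]; exists g; exists f.
have isom_trans (X Y Z : A) : isom X Y -> isom Y Z -> isom X Z.
  move=> [f [f' [f'f ff']]] [g [g' [g'g gg']]].
  exists (cmp g f); exists (cmp f' g'); split.
    by rewrite -cmpA [cmp g' (cmp g f)]cmpA g'g cmp1m.
  by rewrite -cmpA [cmp f (cmp f' g')]cmpA ff' cmp1m.
pose c (P : A -> Prop) (p : exists X, P X) := sval (cid p).
have c_eq (P P' : A -> Prop) p p' : P = P' -> c P p = c P' p'.
  by move=> e; case: _ / e in p' *; rewrite (Prop_irrelevance p p').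
pose r X := c (isom X) (ex_intro _ X (isom_refl X)).
have rP X : isom X (r X) by rewrite /r /c; case: cid.
have r_eq X Y : isom X Y -> r X = r Y.
  move=> XY; apply: c_eq; apply: funext => Z; apply: propext.
  by split; [exact/isom_trans/isom_sym | exact: isom_trans].
have indec_isom (X Y : A) : isom X Y -> indecomposable X -> indecomposable Y.
  move=> [f [g [gf fg]]] [X0 XP].
  have zr (U V W : A) (h : hom V W) : cmp h (0 : hom U V) = 0.
    have := @cmp_linearr k A U _ _ h 1 0 0; rewrite !scale1r !addr0 => e.
    by apply/(addrI (cmp h 0)); rewrite addr0 -e.
  have zl (U V W : A) (h : hom U V) : cmp (0 : hom V W) h = 0.
    have := @cmp_linearl k A _ _ W h 1 0 0; rewrite !scale1r !addr0 => e.
    by apply/(addrI (cmp 0 h)); rewrite addr0 -e.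
  split=> [Y0|U V [i [j [p [q [pi qj pj qi ij]]]]]].
    by apply: X0; rewrite /is_zero -gf -[f]cmp1m Y0 zl zr.
  apply: (XP U V); exists (cmp g i), (cmp g j), (cmp p f), (cmp q f).
  have fgK W Z (a : hom W Y) (b : hom Y Z) : cmp (cmp b f) (cmp g a) = cmp b a.
    by rewrite -cmpA [cmp f (cmp g a)]cmpA fg cmp1m.
  split; rewrite ?fgK //.
  rewrite [cmp (cmp g i) _]cmpA -[cmp (cmp g i) p]cmpA.
  rewrite [cmp (cmp g j) _]cmpA -[cmp (cmp g j) q]cmpA.
  have add_l (a b : hom X Y) : cmp g a + cmp g b = cmp g (a + b).
    by have := @cmp_linearr k A _ _ _ g 1 a b; rewrite !scale1r.
  have add_r (a b : hom Y Y) : cmp a f + cmp b f = cmp (a + b) f.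
    by have := @cmp_linearl k A _ _ _ f 1 a b; rewrite !scale1r.
  by rewrite -!cmpA add_l 2!cmpA -?cmpA [cmp i _]cmpA [cmp j _]cmpA add_r ij cmp1m.
have rr X : r (r X) = r X by apply: r_eq; apply: isom_sym.
split; apply: (@IndReps k A {X : A | indecomposable X /\ r X = X} sval).
- by case=> X [].
- move=> [X [iX eX]] [Y [iY eY]] /= /r_eq XY.
  by apply: eq_exist; rewrite -eX -eY.
- move=> X iX.
  by exists (exist _ (r X) (conj (indec_isom _ _ (rP X) iX) (rr X))).
Qed.

(* Main.v *)
From HB Require Import structures.
From mathcomp Require Import all_boot all_order all_algebra.
From mathcomp Require Import finmap boolp monalg.
From mathcomp Require Import zify.
From Stdlib Require List.
From Stdlib Require Import Relation_Operators.
Require Import Defs.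

Set Implicit Arguments.
Unset Strict Implicit.
Unset Printing Implicit Defensive.
Local Obligation Tactic := idtac.
Import GRing.Theory.
Local Open Scope ring_scope.

(** Number the vertices of Q by 0, 1, 2, ... and let [o n] mean that the edge
    between n and n+1 points to n+1.  A finitely presented representation is a
    finite direct sum of modules supported on intervals [i, j], where j may be
    infinite if all arrows far away point to the right.  The nonzero morphisms
    between two interval modules form a line, and they exist iff the supports
    meet and the endpoints increase for two total orders: the left endpoints are
    ordered like a set of consecutive integers, the right ones as
      {j | arrow j+1 -> j} increasing  <  oo  <  {j | arrow j -> j+1} decreasing.
    Hence the irreducible maps move one endpoint to its successor, and the almost
    split sequences are the squares
      0 -> [i, j] -> [i+, j] (+) [i, j+] -> [i+, j+] -> 0.
    The second order falls apart into a lower and an upper part, which cannot be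
    linked by irreducible maps: the lower part gives the preprojective
    component, the upper one the preinjective component.  The difference of the
    ranks of the endpoints is constant on tau-orbits, and it identifies a
    component whose part is infinite with NN D or NN^- D, where D is the opposite
    quiver of Q. *)

(** * Categories with thin bases *)

(** No cover joins the two parts of the right order for a reason at infinity. If all far arrows
    point right, oo is the top of a finite lower part, while the upper part descends without a least
    element; otherwise oo is absent and the lower part ascends without a greatest element. The
    categorical half needs only scalar Hom spaces, their composition rule and a factorisation of
    each identity through intervals. Stated for an abstract [thin_basis], it applies to the opposite
    category as well and to any choice of representatives. The hard input is this factorisation: a
    finitely presented M may be infinite-dimensional, so its dimension cannot drive an induction.
    But far out M is constant or zero, which bounds the vertices that matter, and the ranks of an
    idempotent at those vertices drop when an interval is split off its image. Where tau is
    undefined is never examined directly: every vertex of an N^- part has a translate and every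
    vertex of an N part an inverse translate, and uniqueness of almost split sequences does the
    rest. *)

Section Kcat.
Variables (k : fieldType) (A : kcat k).
Implicit Types X Y Z W : A.

Lemma cmpDl X Y Z (g g' : hom Y Z) (f : hom X Y) :
  cmp (g + g') f = cmp g f + cmp g' f.
Proof. by have := @cmp_linearl k A _ _ _ f 1 g g'; rewrite !scale1r. Qed.

Lemma cmpDr X Y Z (g : hom Y Z) (f f' : hom X Y) :
  cmp g (f + f') = cmp g f + cmp g f'.
Proof. by have := @cmp_linearr k A _ _ _ g 1 f f'; rewrite !scale1r. Qed.

Lemma cmp0l X Y Z (f : hom X Y) : cmp (0 : hom Y Z) f = 0.
Proof. by apply/(addrI (cmp 0 f)); rewrite addr0 -cmpDl addr0. Qed.

Lemma cmp0r X Y Z (g : hom Y Z) : cmp g (0 : hom X Y) = 0.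
Proof. by apply/(addrI (cmp g 0)); rewrite addr0 -cmpDr addr0. Qed.

Lemma cmpZl X Y Z a (g : hom Y Z) (f : hom X Y) : cmp (a *: g) f = a *: cmp g f.
Proof. by have := @cmp_linearl k A _ _ _ f a g 0; rewrite !addr0 cmp0l addr0. Qed.

Lemma cmpZr X Y Z a (g : hom Y Z) (f : hom X Y) : cmp g (a *: f) = a *: cmp g f.
Proof. by have := @cmp_linearr k A _ _ _ g a f 0; rewrite !addr0 cmp0r addr0. Qed.

Lemma cmpNl X Y Z (g : hom Y Z) (f : hom X Y) : cmp (- g) f = - cmp g f.
Proof. by rewrite -scaleN1r cmpZl scaleN1r. Qed.

Lemma cmpNr X Y Z (g : hom Y Z) (f : hom X Y) : cmp g (- f) = - cmp g f.
Proof. by rewrite -scaleN1r cmpZr scaleN1r. Qed.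

Lemma cmp_suml X Y Z I (r : seq I) P (F : I -> hom Y Z) (f : hom X Y) :
  cmp (\sum_(i <- r | P i) F i) f = \sum_(i <- r | P i) cmp (F i) f.
Proof.
exact: (big_morph (fun g => cmp g f) (fun a b => cmpDl a b f) (cmp0l _ f)).
Qed.

Lemma cmp_sumr X Y Z I (r : seq I) P (F : I -> hom X Y) (g : hom Y Z) :
  cmp g (\sum_(i <- r | P i) F i) = \sum_(i <- r | P i) cmp g (F i).
Proof. exact: (big_morph (cmp g) (cmpDr g) (cmp0r _ g)). Qed.

Lemma invertible_id X : invertible (idm X).
Proof. by exists (idm X); rewrite cmp1m. Qed.

Lemma isom_refl X : isom X X.
Proof. by exists (idm X); exact: invertible_id. Qed.

Lemma isom_sym X Y : isom X Y -> isom Y X.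
Proof. by move=> [f [g [gf fg]]]; exists g, f. Qed.

Lemma isom_trans X Y Z : isom X Y -> isom Y Z -> isom X Z.
Proof.
move=> [f [f' [f'f ff']]] [g [g' [g'g gg']]].
exists (cmp g f), (cmp f' g'); split.
  by rewrite -cmpA [cmp g' _]cmpA g'g cmp1m.
by rewrite -cmpA [cmp f _]cmpA ff' cmp1m.
Qed.

(** If [x] inverts 1 - ab, then 1 + bxa inverts 1 - ba, as the geometric series suggests. [rad]
    tests composites at the source only, and this moves the test to the other side. *)
Lemma invertible_1sub X Y (a : hom Y X) (b : hom X Y) :
  invertible (idm X - cmp a b) -> invertible (idm Y - cmp b a).
Proof.
move=> [x [xl xr]]; exists (idm Y + cmp b (cmp x a)).
have {}xl : cmp x (cmp a b) = x - idm X.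
  by rewrite -xl cmpDr cmpm1 cmpNr opprD addrA subrr add0r opprK.
have {}xr : cmp (cmp a b) x = x - idm X.
  by rewrite -xr cmpDl cmp1m cmpNl opprD addrA subrr add0r opprK.
have eq (u v : hom Y Y) : v = u - cmp b a -> idm Y - cmp b a + (u - v) = idm Y.
  by move=> ->; rewrite opprB [u + _]addrCA subrr addr0 subrK.
split.
- have e : cmp (cmp b (cmp x a)) (cmp b a) = cmp b (cmp x a) - cmp b a.
    have -> : cmp (cmp b (cmp x a)) (cmp b a) = cmp b (cmp (cmp x (cmp a b)) a).
      by rewrite -!cmpA.
    by rewrite xl cmpDl cmpNl cmp1m cmpDr cmpNr.
  by rewrite cmpDl cmp1m cmpDr cmpm1 cmpNr; apply: eq.
- have e : cmp (cmp b a) (cmp b (cmp x a)) = cmp b (cmp x a) - cmp b a.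
    have -> : cmp (cmp b a) (cmp b (cmp x a)) = cmp b (cmp (cmp (cmp a b) x) a).
      by rewrite -!cmpA.
    by rewrite xr cmpDl cmpNl cmp1m cmpDr cmpNr.
  by rewrite cmpDr cmpm1 cmpDl cmp1m cmpNl; apply: eq.
Qed.

Lemma rad_cmpl X Y Z (u : hom Y Z) (f : hom X Y) : rad f -> rad (cmp u f).
Proof. by move=> rf g; rewrite cmpA; exact: rf. Qed.

Lemma rad_cmpr X Y Z (u : hom X Y) (f : hom Y Z) : rad f -> rad (cmp f u).
Proof.
move=> rf g; rewrite cmpA; apply: invertible_1sub; rewrite cmpA; exact: rf.
Qed.

Lemma rad2_0 X Y : rad2 (0 : hom X Y).
Proof. by exists 0%N, (fun _ => X), (fun _ => 0), (fun _ => 0); split=> [[]|]; rewrite ?big_ord0. Qed.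

End Kcat.

(** [J p] may be a zero object; this is the case iff [H p p] fails. *)
Record thin_basis (k : fieldType) (A : kcat k) (T : eqType) (J : T -> A)
    (H : rel T) (c : forall p q, hom (J p) (J q)) : Prop := ThinBasis {
  tb_span : forall p q (f : hom (J p) (J q)), exists a, f = a *: c p q;
  tb_eq0 : forall p q, c p q = 0 <-> ~~ H p q;
  tb_comp : forall p q r, H p q -> H q r -> cmp (c q r) (c p q) = c p r;
  tb_id : forall p, c p p = idm (J p);
  tb_anti : forall p q, H p q -> H q p -> p = q;
  tb_valid : forall p q, H p q -> H p p /\ H q q;
  tb_dec : forall W, exists s : seq {p : T & (hom (J p) W * hom W (J p))%type},
    idm W = \sum_(x <- s) cmp (tagged x).1 (tagged x).2 }.

Lemma dep_choice X (Y : X -> Type) (P : forall x, Y x -> Prop) :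
  (forall x, exists y, P x y) -> {f : forall x, Y x & forall x, P x (f x)}.
Proof. by move=> /(_ _)/cid-/all_tag. Qed.

Section ThinBasis.
Variables (k : fieldType) (A : kcat k) (T : eqType) (J : T -> A) (H : rel T).
Variable c : forall p q, hom (J p) (J q).
Hypothesis tb : thin_basis H c.

(** [H] is not assumed transitive, since a composite of nonzero maps may vanish. Under [H p q],
    however, the composite through any [r] with [H p r] and [H r q] is the nonzero map [c p q]. *)
Definition irreducible_rel p q : Prop :=
  [/\ H p q, p != q & forall r, H p r -> H r q -> r = p \/ r = q].

Lemma tb_hom0 p q : ~~ H p q -> forall f : hom (J p) (J q), f = 0.
Proof.
by move=> /(tb_eq0 tb) e f; have [a ->] := tb_span tb f; rewrite e scaler0.
Qed.

Lemma tb_neq0 p q : H p q -> c p q <> 0.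
Proof. by move=> h /(tb_eq0 tb); rewrite h. Qed.

Lemma tb_scale0 p q a : H p q -> a *: c p q = 0 -> a = 0.
Proof. by move=> h /eqP; rewrite scaler_eq0 => /orP[/eqP //|/eqP /(tb_neq0 h)]. Qed.

(** Antisymmetry of [H] kills every composite from [J p] to itself through a different [J q], and a
    nonzero endomorphism is an invertible scalar. *)
Lemma rad_tb p q (f : hom (J p) (J q)) : H q q -> rad f <-> p != q \/ f = 0.
Proof.
move=> vq; split=> [rf|[pq g|->]]; last first.
- by move=> g; rewrite cmp0r subr0; exact: invertible_id.
- suff -> : cmp g f = 0 by rewrite subr0; exact: invertible_id.
  have [a ->] := tb_span tb f; have [b ->] := tb_span tb g.
  case hpq : (H p q); last by rewrite (iffRL (tb_eq0 tb p q)) ?hpq // !scaler0 cmp0r.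
  case hqp : (H q p); last by rewrite (iffRL (tb_eq0 tb q p)) ?hqp // !scaler0 cmp0l.
  by move: pq; rewrite (tb_anti tb hpq hqp) eqxx.
- have [e|] := eqVneq p q; [right | by left].
  case: _ / e in vq f rf *.
  have [a ef] := tb_span tb f; rewrite ef; have [-> | a0] := eqVneq a 0; first by rewrite scale0r.
  have [h [hl _]] := rf (a^-1 *: idm (J p)).
  move: hl; rewrite ef cmpZl cmp1m scalerA mulVf // scale1r (tb_id tb) subrr cmp0r.
  by rewrite -(tb_id tb) => /esym /(tb_neq0 vq).
Qed.

Lemma rad_rad2_tb p q (f : hom (J p) (J q)) : H p p -> H q q ->
  ~ irreducible_rel p q -> rad f -> rad2 f.
Proof.
move=> vp vq nirr rf.
case hpq : (H p q); last by rewrite (tb_hom0 (negbT hpq) f); exact: rad2_0.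
have [epq|npq] := eqVneq p q.
  case: _ / epq in nirr f rf hpq vq *.
  by have [|->] := (iffLR (rad_tb _ vp)) rf; rewrite ?eqxx //; exact: rad2_0.
have : exists r, [/\ H p r, H r q, r != p & r != q].
  apply: contrapT => nr; apply: nirr; split=> // r pr rq.
  have [->|rp] := eqVneq r p; first by left.
  have [->|rq'] := eqVneq r q; first by right.
  by case: nr; exists r.
move=> [r [pr rq rp rq']]; have [a ->] := tb_span tb f.
exists 1%N, (fun _ => J r), (fun _ => c p r), (fun _ => a *: c r q); split.
  move=> _; split; apply/rad_tb; rewrite ?vq //; first by have [] := tb_valid tb pr.
    by left; rewrite eq_sym.
  by left.
by rewrite big_ord1 cmpZl (tb_comp tb).
Qed.

(** Expanding the identities of the middle objects by [tb_dec] leaves composites through some [J t].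
    Irreducibility forces [t] to be [p] or [q], and then one factor is a radical endomorphism, which
    is zero. *)
Lemma rad2_irreducible p q (f : hom (J p) (J q)) :
  irreducible_rel p q -> rad2 f -> f = 0.
Proof.
move=> [hpq npq irr] [n [Z [h [g [r ->]]]]]; rewrite big1 // => i _.
have [rh rg] := r i; have [s es] := tb_dec tb (Z i).
rewrite -[g i]cmpm1 es cmp_sumr cmp_suml big1_seq // => -[t [u v]] _ /=.
have vq := (tb_valid tb hpq).2.
rewrite cmpA -cmpA.
have ru := rad_cmpr u rg; have rv := rad_cmpl v rh.
case hpt : (H p t); last by rewrite (tb_hom0 (negbT hpt) (cmp v _)) cmp0r.
case htq : (H t q); last by rewrite (tb_hom0 (negbT htq) (cmp _ u)) cmp0l.
have vt := (tb_valid tb hpt).2.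
have := irr _ hpt htq => -[e|e].
  subst t; have [|->] := (iffLR (rad_tb _ vt)) rv; first by rewrite eqxx.
  by rewrite cmp0r.
subst t; have [|->] := (iffLR (rad_tb _ vt)) ru; first by rewrite eqxx.
by rewrite cmp0l.
Qed.

(** As endomorphisms of [J p] are scalars, [irr_dim] and [irr_dim'] agree. *)
Definition irr_scalar p q (d : nat) : Prop :=
  exists f : 'I_d -> hom (J p) (J q),
    [/\ forall i, rad (f i),
        forall g : hom (J p) (J q), rad g ->
          exists a : 'I_d -> k, rad2 (g - \sum_i a i *: f i) &
        forall a : 'I_d -> k, rad2 (\sum_i a i *: f i) -> forall i, a i = 0].

Lemma rad_scale p a : H p p -> rad (a *: idm (J p)) <-> a = 0.
Proof.
move=> vp; rewrite rad_tb // eqxx -(tb_id tb); split=> [[//|]|->].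
  exact: tb_scale0.
by right; rewrite scale0r.
Qed.

Lemma irr_dim_scalar p q d : H q q -> irr_dim (J p) (J q) d <-> irr_scalar p q d.
Proof.
move=> vq.
have sc (e : 'I_d -> hom (J q) (J q)) : {a : 'I_d -> k & forall i, e i = a i *: idm (J q)}.
  by apply: (@choice _ _ (fun i a => e i = a *: _)) => i; rewrite -(tb_id tb); exact: (tb_span tb).
have eqs (a : 'I_d -> k) (f : 'I_d -> hom (J p) (J q)) :
  \sum_i cmp (a i *: idm (J q)) (f i) = \sum_i a i *: f i.
  by apply: eq_bigr => i _; rewrite cmpZl cmp1m.
split=> -[f [rf sf lf]]; exists f; split=> //.
- move=> g /sf [e]; have [a /funext ->] := sc e.
  by rewrite eqs; exists a.
- by move=> a; rewrite -eqs => /lf r i; apply/(rad_scale _ vq)/r.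
- by move=> g /sf [a]; rewrite -eqs; exists (fun i => a i *: idm _).
- move=> e; have [a /funext ->] := sc e.
  by rewrite eqs => /lf a0 i; apply/rad_scale.
Qed.

Lemma irr_dim'_scalar p q d : H p p -> irr_dim' (J p) (J q) d <-> irr_scalar p q d.
Proof.
move=> vp.
have sc (e : 'I_d -> hom (J p) (J p)) : {a : 'I_d -> k & forall i, e i = a i *: idm (J p)}.
  by apply: (@choice _ _ (fun i a => e i = a *: _)) => i; rewrite -(tb_id tb); exact: (tb_span tb).
have eqs (a : 'I_d -> k) (f : 'I_d -> hom (J p) (J q)) :
  \sum_i cmp (f i) (a i *: idm (J p)) = \sum_i a i *: f i.
  by apply: eq_bigr => i _; rewrite cmpZr cmpm1.
split=> -[f [rf sf lf]]; exists f; split=> //.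
- move=> g /sf [e]; have [a /funext ->] := sc e.
  by rewrite eqs; exists a.
- by move=> a; rewrite -eqs => /lf r i; apply/(rad_scale _ vp)/r.
- by move=> g /sf [a]; rewrite -eqs; exists (fun i => a i *: idm _).
- move=> e; have [a /funext ->] := sc e.
  by rewrite eqs => /lf a0 i; apply/rad_scale.
Qed.

Lemma irr_scalarE p q d : H p p -> H q q ->
  irr_scalar p q d <-> d = `[< irreducible_rel p q >].
Proof.
move=> vp vq; case: (asboolP (irreducible_rel p q)) => irr /=; last first.
  split=> [[f [rf sf lf]]|->].
    case: d f rf sf lf => // d f rf sf lf.
    have /lf/(_ ord0)/eqP : rad2 (\sum_i 1 *: f i).
      apply: rad_rad2_tb => //; apply/rad_tb => //.
      have [e|] := eqVneq p q; [right | by left].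
      rewrite big1 // => i _; have /rad_tb[//|/eqP|->] := rf i; last by rewrite scaler0.
      by move=> ne; case: (ne e).
    by rewrite oner_eq0.
  exists (fun _ => 0); split=> [[]|g rg|a _ []] //.
  exists (fun _ => 0); rewrite big_ord0 subr0; exact: rad_rad2_tb.
have [hpq npq _] := irr.
have rc (f : hom (J p) (J q)) : rad f by apply/rad_tb => //; left.
split=> [[f [rf sf lf]]|->].
  have [a fa] : {a : 'I_d -> k & forall i, f i = a i *: c p q}.
    by apply: (@choice _ _ (fun i a => f i = a *: _)) => i; exact: (tb_span tb).
  have f0 i : a i <> 0.
    move=> ai; have /(_ _ i) e := @lf (fun j => (j == i)%:R).
    rewrite eqxx in e; have /eqP : (1 : k) = 0; last by rewrite oner_eq0.
    apply: e; rewrite (bigD1 i) //= fa ai scale0r scaler0 big1 ?addr0; first exact: rad2_0.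
    by move=> j /negPf ->; rewrite scale0r.
  case: d f a rf sf lf fa f0 => [|[//|d]] f a rf sf lf fa f0.
    have [e] := sf (c p q) (rc _); rewrite big_ord0 subr0.
    by move=> /(rad2_irreducible irr) /(tb_neq0 hpq).
  have ne : lift ord0 ord0 != ord0 :> 'I_d.+2 by [].
  (* Two basis elements are multiples of the same [c p q], so crossing their coefficients gives a
     nontrivial relation. *)
  pose i1 : 'I_d.+2 := lift ord0 ord0.
  have /(_ _ ord0) /= e :=
    @lf (fun j => if j == ord0 then a i1 else if j == i1 then - a ord0 else 0).
  case: (f0 i1); apply: e.
  rewrite (bigD1 ord0) //= (bigD1 i1) //= big1 ?addr0 => [|j /andP[/negPf -> /negPf ->]].
    by rewrite !fa !scalerA -scalerDl mulNr mulrC subrr scale0r; exact: rad2_0.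
  by rewrite scale0r.
exists (fun _ => c p q); split=> // [g _|a /=].
  have [a ->] := tb_span tb g.
  by exists (fun _ => a); rewrite big_ord1 subrr; exact: rad2_0.
by rewrite big_ord1 => /(rad2_irreducible irr) /(tb_scale0 hpq) a0 i; rewrite ord1.
Qed.

Lemma tb_isom p q : H p p -> isom (J p) (J q) -> p = q.
Proof.
move=> vp [f [g [gf fg]]].
have [a ef] := tb_span tb f; have [b eg] := tb_span tb g.
have id0 : idm (J p) <> 0 by rewrite -(tb_id tb); exact: tb_neq0.
apply: (tb_anti tb); apply/negPn/negP => /(iffRL (tb_eq0 tb _ _)) e; case: id0.
  by rewrite -gf ef e scaler0 cmp0r.
by rewrite -gf eg e scaler0 cmp0l.
Qed.

Lemma tb_indecomposable p : H p p -> indecomposable (J p).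
Proof.
move=> vp; split=> [|Y Z [i [j [p' [q [pi qj pj qi ij]]]]]].
  by rewrite /is_zero -(tb_id tb); exact: tb_neq0.
have [a] := tb_span tb (cmp i p'); rewrite (tb_id tb) => ea.
have [a0|a0] := eqVneq a 0; [left|right].
  by rewrite /is_zero -[idm Y]cmp1m -pi cmpA -[cmp (cmp p' i) p']cmpA ea a0 scale0r cmp0r cmp0l.
suff q0 : q = 0 by rewrite /is_zero -qj q0 cmp0l.
have /eqP : a *: q = 0 by rewrite -[q]cmpm1 -cmpZr -ea cmpA qi cmp0l.
by rewrite scaler_eq0 (negPf a0) => /eqP.
Qed.

(** The combinatorial content of: [0 -> J p -> J a (+) J b -> J q] is left exact
    and its last map is minimal right almost split.  One of [J a] and [J b] may
    be zero; the other half of an almost split sequence is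
    the same statement in the opposite category. *)
Definition half_square p a b q : Prop :=
  [/\ H q q, (H a a -> H p a /\ H a q) /\ (H b b -> H p b /\ H b q),
      [/\ ~~ H a b, ~~ H b a, a != q & b != q],
      H a a && H b b || ~~ H p q &
      forall w, [/\ H w p -> H w a || H w b,
                   H w a -> H w b -> H w p && H w q,
                   H w a -> ~~ H w b -> H w p || H w q,
                   H w b -> ~~ H w a -> H w p || H w q &
                   H w q -> w != q -> H w a || H w b]].

(** Only x y = -1 is fixed, because the same two maps are read with (x, y) = (1, -1) in the category
    and with (-1, 1) in its opposite. As every identity factors through the [J w], kernel and
    lifting properties are tested on maps out of these. *)
Lemma half_square_split p a b q (x y : k) (Y : A)
    (i : hom (J a) Y) (j : hom (J b) Y) (r : hom Y (J a)) (s : hom Y (J b)) :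
  half_square p a b q -> x * y = -1 ->
  [/\ cmp r i = idm _, cmp s j = idm _, cmp r j = 0, cmp s i = 0 &
      cmp i r + cmp j s = idm Y] ->
  let f := cmp i (c p a) + x *: cmp j (c p b) in
  let g := cmp (c a q) r + y *: cmp (c b q) s in
  [/\ is_kernel f g, right_minimal g & right_almost_split g].
Proof.
move=> [vq [va vb] [nab nba naq nbq] vpq hw] xy [ri sj rj si ij] f g.
have wd w : [/\ H w p -> H w a || H w b, H w a -> H w b -> H w p && H w q,
  H w a -> ~~ H w b -> H w p || H w q, H w b -> ~~ H w a -> H w p || H w q &
  H w q -> w != q -> H w a || H w b] := hw w.
have vl w t : H w t -> H t t by move=> /(tb_valid tb) [].
have rf : cmp r f = c p a by rewrite cmpDr cmpZr !cmpA ri rj cmp0l scaler0 cmp1m addr0.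
have sf : cmp s f = x *: c p b by rewrite cmpDr cmpZr !cmpA sj si cmp0l add0r cmp1m.
have gi : cmp g i = c a q by rewrite cmpDl cmpZl -!cmpA ri si cmp0r scaler0 cmpm1 addr0.
have gj : cmp g j = y *: c b q by rewrite cmpDl cmpZl -!cmpA sj rj cmp0r add0r cmpm1.
have extY W (h h' : hom W Y) : cmp r h = cmp r h' -> cmp s h = cmp s h' -> h = h'.
  by move=> er es; rewrite -[h]cmp1m -[h']cmp1m -ij !cmpDl -!cmpA er es.
have gE W (h : hom W Y) : cmp g h = cmp (c a q) (cmp r h) + y *: cmp (c b q) (cmp s h).
  by rewrite cmpDl cmpZl -!cmpA.
have ca w t u : H w t -> H t u -> cmp (c t u) (c w t) = c w u by exact: tb_comp.
have zz w t (u v : hom (J w) (J t)) : H w t = false -> u = v.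
  by move=> /negbT/tb_hom0 n; rewrite (n u) (n v).
have c0 w t : H w t = false -> c w t = 0 by move=> e; apply/(tb_eq0 tb); rewrite e.
have gf : cmp g f = 0.
  rewrite gE rf sf cmpZr scalerA [y * x]mulrC xy scaleN1r.
  have e t : (H t t -> H p t /\ H t q) ->
      cmp (c t q) (c p t) = if H t t then c p q else 0.
    move=> vt; case: ifP => htt; first by have [h1 h2] := vt htt; rewrite ca.
    by rewrite (c0 p t) ?cmp0r //; apply: contraFF htt => /vl.
  rewrite !e //; case/orP: vpq => [/andP[-> ->]|/negPf/c0 ->]; first by rewrite subrr.
  by rewrite !if_same subrr.
have mono w (u : hom (J w) (J p)) : cmp f u = 0 -> u = 0.
  have [al ->] := tb_span tb u; case hwp : (H w p); last by rewrite c0 ?scaler0.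
  have [/(_ hwp) hab _ _ _ _] := wd w; rewrite cmpZr => fu.
  suff -> : al = 0 by rewrite scale0r.
  have ru : al *: cmp (c p a) (c w p) = 0 by rewrite -rf -cmpA -cmpZr fu cmp0r.
  have su : al *: cmp (c p b) (c w p) = 0.
    have : x *: (al *: cmp (c p b) (c w p)) = 0.
      by rewrite scalerA mulrC -scalerA -cmpZl -sf -cmpA -cmpZr fu cmp0r.
    move=> /eqP; rewrite scaler_eq0 => /orP[|/eqP//] /eqP x0.
    by move: xy => /eqP; rewrite x0 mul0r eq_sym oppr_eq0 oner_eq0.
  case/orP: hab => h; have vv := vl _ _ h.
    by have [pa _] := va vv; move: ru; rewrite ca //; exact: tb_scale0.
  by have [pb _] := vb vv; move: su; rewrite ca //; exact: tb_scale0.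
have exact w (h : hom (J w) Y) : cmp g h = 0 -> exists u, cmp f u = h.
  have [al ra] := tb_span tb (cmp r h); have [be sb] := tb_span tb (cmp s h).
  rewrite gE ra sb !cmpZr scalerA; have [_ K3 K1 K2 _] := wd w.
  case hwa : (H w a) K3 K1 K2; case hwb : (H w b) => //= K3 K1 K2.
  - have [_ aq] := va (vl _ _ hwa); have [_ bq] := vb (vl _ _ hwb).
    have [pa _] := va (vl _ _ hwa); have [pb _] := vb (vl _ _ hwb).
    rewrite !ca // -scalerDl; have /andP[wp wq] := K3 isT isT.
    move=> /(tb_scale0 wq) e; exists (al *: c w p); apply: extY.
      by rewrite cmpA rf cmpZr ca ?ra.
    rewrite cmpA sf cmpZr cmpZl ca // scalerA sb; congr (_ *: _).
    by move/eqP: e; rewrite addr_eq0 => /eqP ->; rewrite mulNr mulrAC -mulrA mulrA [y * x]mulrC xy mulN1r opprK.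
  - have [pa aq] := va (vl _ _ hwa); rewrite (c0 _ _ hwb) cmp0r scaler0 addr0 ca //.
    have /orP[wp _|wq] := K1 isT isT.
      exists (al *: c w p); apply: extY; first by rewrite cmpA rf cmpZr ca ?ra.
      exact: zz hwb.
    move=> /(tb_scale0 wq) e; exists 0; apply: extY; rewrite !cmp0r.
      by rewrite ra e scale0r.
    exact: zz hwb.
  - have [pb bq] := vb (vl _ _ hwb); rewrite (c0 _ _ hwa) cmp0r scaler0 add0r ca //.
    have /orP[wp _|wq] := K2 isT isT.
      exists ((- y * be) *: c w p); apply: extY.
        exact: zz hwa.
      rewrite cmpA sf cmpZr cmpZl ca // scalerA sb; congr (_ *: _).
      by rewrite mulNr mulNr mulrAC [y * x]mulrC xy mulN1r opprK.
    move=> /(tb_scale0 wq) /eqP; rewrite mulf_eq0 => /orP[/eqP y0|/eqP e].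
      by move: xy => /eqP; rewrite y0 mulr0 eq_sym oppr_eq0 oner_eq0.
    exists 0; apply: extY; rewrite !cmp0r.
      exact: zz hwa.
    by rewrite sb e scale0r.
  - by move=> _; exists 0; apply: extY; [exact: zz hwa | exact: zz hwb].
split.
- split=> // W h gh; have [l el] := tb_dec tb W.
  have : {u : forall x : {p : T & (hom (J p) W * hom W (J p))%type}, hom (J (tag x)) (J p)
         & forall x, cmp f (u x) = cmp h (tagged x).1}.
    apply: (@dep_choice _ _ (fun x u => cmp f u = cmp h (tagged x).1)) => z.
    by apply: exact; rewrite cmpA gh cmp0l.
  move=> [u fu]; exists (\sum_(z <- l) cmp (u z) (tagged z).2); split.
    rewrite cmp_sumr -[h]cmpm1 el cmp_sumr; apply: eq_bigr => z _.
    by rewrite cmpA fu cmpA.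
  move=> v fv; rewrite -[v]cmpm1 el cmp_sumr; apply: eq_bigr => z _.
  rewrite cmpA; congr cmp; apply/eqP; rewrite -subr_eq0; apply/eqP/mono.
  by rewrite cmpDr cmpNr fu cmpA fv subrr.
(* As a two by two matrix, [e] is the identity: [~~ H a b] and [~~ H b a] kill the off-diagonal
   entries, and comparing [cmp g e] with [g] on each summand fixes the diagonal ones. *)
- move=> e ge; suff -> : e = idm Y by exact: invertible_id.
  have nz w t (v : hom (J w) (J t)) : ~~ H w t -> v = 0 by move=> n; exact: tb_hom0.
  have rei : cmp r (cmp e i) = idm (J a).
    case haa : (H a a); last exact: zz haa.
    have [al E] := tb_span tb (cmp r (cmp e i)); rewrite E (tb_id tb).
    have := gE _ (cmp e i); rewrite cmpA ge gi E (nz _ _ (cmp s (cmp e i)) nab) cmp0r scaler0 addr0.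
    rewrite (tb_id tb) cmpZr cmpm1 => /eqP; rewrite -subr_eq0 -{1}[c a q]scale1r -scalerBl.
    by move=> /eqP /(tb_scale0 (va haa).2) /eqP; rewrite subr_eq0 => /eqP <-; rewrite scale1r.
  have sej : cmp s (cmp e j) = idm (J b).
    case hbb : (H b b); last exact: zz hbb.
    have [al E] := tb_span tb (cmp s (cmp e j)); rewrite E (tb_id tb).
    have := gE _ (cmp e j); rewrite cmpA ge gj E (nz _ _ (cmp r (cmp e j)) nba) cmp0r add0r.
    rewrite (tb_id tb) cmpZr cmpm1 => /eqP; rewrite -subr_eq0 scalerA -scalerBl.
    move=> /eqP /(tb_scale0 (vb hbb).2) /eqP; rewrite -{1}[y]mulr1 -mulrBr mulf_eq0.
    case/orP=> [/eqP y0|]; last by rewrite subr_eq0 => /eqP <-; rewrite scale1r.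
    by move: xy => /eqP; rewrite y0 mulr0 eq_sym oppr_eq0 oner_eq0.
  apply: extY; rewrite -[e]cmpm1 -ij !cmpDr !cmpA.
    by rewrite -[cmp (cmp r e) i]cmpA rei -[cmp (cmp r e) j]cmpA (nz _ _ (cmp r (cmp e j)) nba) ri rj.
  by rewrite -[cmp (cmp s e) j]cmpA sej -[cmp (cmp s e) i]cmpA (nz _ _ (cmp s (cmp e i)) nab) si sj.
- split=> [[u gu]|W h nh].
    have z0 t (v : hom (J q) (J t)) : (H t t -> H p t /\ H t q) -> t != q -> v = 0.
      move=> vt nt; apply: tb_hom0; apply/negP => qt; have [_ tq] := vt (vl _ _ qt).
      by move: nt; rewrite (tb_anti tb tq qt) eqxx.
    move: gu; rewrite gE (z0 _ (cmp r u) va naq) (z0 _ (cmp s u) vb nbq) !cmp0r scaler0 addr0 -(tb_id tb).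
    by move=> /esym; exact: tb_neq0.
  have [l el] := tb_dec tb W.
  have : {u : forall x : {p : T & (hom (J p) W * hom W (J p))%type}, hom (J (tag x)) Y
         & forall x, cmp g (u x) = cmp h (tagged x).1}.
    apply: (@dep_choice _ _ (fun x u => cmp g u = cmp h (tagged x).1)) => -[t [m n]] /=.
    have [al E] := tb_span tb (cmp h m); rewrite E.
    case htq : (H t q); last by exists 0; rewrite c0 // scaler0 cmp0r.
    (* At [t = q] a nonzero scalar would make [h] a retraction with right inverse [al^-1 *: m], so
       only 0 has to be lifted there; any other [t] goes through [J a] or [J b]. *)
    have [etq|ntq] := eqVneq t q.
      subst t; have [->|al0] := eqVneq al 0; first by exists 0; rewrite scale0r cmp0r.
      case: nh; exists (al^-1 *: m).
      by rewrite cmpZr E scalerA mulVf // scale1r (tb_id tb).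
    have [_ _ _ _ /(_ htq ntq) /orP[ht|ht]] := wd t.
      exists (al *: cmp i (c t a)); rewrite cmpZr cmpA gi ca //.
      exact: (va (vl _ _ ht)).2.
    have y0 : y != 0.
      by apply/eqP => y0; move: xy => /eqP; rewrite y0 mulr0 eq_sym oppr_eq0 oner_eq0.
    exists ((al * y^-1) *: cmp j (c t b)); rewrite cmpZr cmpA gj cmpZl ca ?scalerA ?mulfVK //.
    exact: (vb (vl _ _ ht)).2.
  move=> [u gu]; exists (\sum_(z <- l) cmp (u z) (tagged z).2).
  rewrite cmp_sumr -[h]cmpm1 el cmp_sumr; apply: eq_bigr => z _.
  by rewrite cmpA gu cmpA.
Qed.

End ThinBasis.

(** * The opposite category and uniqueness of almost split sequences *)

Definition op_kcat (k : fieldType) (A : kcat k) : kcat k :=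
  {| obj := A;
     hom := fun X Y => hom Y X;
     idm := fun X => idm X;
     cmp := fun X Y Z g f => cmp f g;
     cmpA := fun X Y Z W h g f => esym (cmpA f g h);
     cmp1m := fun X Y f => cmpm1 f;
     cmpm1 := fun X Y f => cmp1m f;
     cmp_linearl := fun X Y Z f => @cmp_linearr k A Z Y X f;
     cmp_linearr := fun X Y Z g => @cmp_linearl k A Z Y X g |}.

Section Duality.
Variables (k : fieldType) (A : kcat k).

Lemma right_minimal_op (Y Z : A) (g : hom Y Z) :
  right_minimal g <-> @left_minimal k (op_kcat A) Z Y g.
Proof. by split=> m e /m [h [h1 h2]]; exists h; split. Qed.

Lemma left_minimal_op (X Y : A) (f : hom X Y) :
  left_minimal f <-> @right_minimal k (op_kcat A) Y X f.
Proof. by split=> m e /m [h [h1 h2]]; exists h; split. Qed.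

Lemma almost_split_op (X Y Z : A) (f : hom X Y) (g : hom Y Z) :
  almost_split f g -> @almost_split k (op_kcat A) Z Y X g f.
Proof.
case=> [[kf cf] [mf af] [mg ag]]; split.
- split; [exact: cf|exact: kf].
- split; [exact/right_minimal_op|exact: ag].
- split; [exact/left_minimal_op|exact: af].
Qed.

(** Two minimal left almost split maps out of [X] factor through each other, minimality makes the
    comparison maps isomorphisms, and these pass to the cokernels. With the dual statement, tau is a
    partial injection on isomorphism classes. *)
Lemma tau_inj (X Y Z Y' Z' : A) (f : hom X Y) (g : hom Y Z)
    (f' : hom X Y') (g' : hom Y' Z') :
  almost_split f g -> almost_split f' g' -> isom Z Z'.
Proof.
move=> [[_ [gf cg]] [mf [nf af]] _] [[_ [gf' cg']] [mf' [nf' af']] _].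
have [u uf] := af _ _ nf'; have [v vf] := af' _ _ nf.
have [a [al ar]] : invertible (cmp v u) by apply: mf; rewrite -cmpA uf vf.
have [b [bl br]] : invertible (cmp u v) by apply: mf'; rewrite -cmpA vf uf.
pose w := cmp a v.
have wu : cmp w u = idm Y by rewrite -cmpA al.
move: w wu => w wu.
have uw : cmp u w = idm Y'.
  have -> : w = cmp v b by rewrite -[w]cmpm1 -br -!cmpA [cmp w _]cmpA wu cmp1m.
  by rewrite cmpA.
have wf : cmp w f' = f by rewrite -uf cmpA wu cmp1m.
have [z [zg _]] := cg _ (cmp g' u) (etrans (esym (cmpA _ _ _)) (etrans (congr1 (cmp g') uf) gf')).
have [z' [zg' _]] := cg' _ (cmp g w) (etrans (esym (cmpA _ _ _)) (etrans (congr1 (cmp g) wf) gf)).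
exists z, z'; split.
  have [t [_ tu]] := cg _ g gf; rewrite -(tu (idm Z)) ?cmp1m //; apply/esym/tu.
  by rewrite -cmpA zg cmpA zg' -cmpA wu cmpm1.
have [t [_ tu]] := cg' _ g' gf'; rewrite -(tu (idm Z')) ?cmp1m //; apply/esym/tu.
by rewrite -cmpA zg' cmpA zg -cmpA uw cmpm1.
Qed.

End Duality.

Lemma tau_functional (k : fieldType) (A : kcat k) (X Y Z X' Y' : A)
    (f : hom X Y) (g : hom Y Z) (f' : hom X' Y') (g' : hom Y' Z) :
  almost_split f g -> almost_split f' g' -> isom X X'.
Proof.
move=> /almost_split_op a /almost_split_op a'.
by have [u [v [vu uv]]] := tau_inj a a'; exists v, u.
Qed.

Section ThinBasisDual.
Variables (k : fieldType) (A : kcat k) (T : eqType) (J : T -> A) (H : rel T).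
Variable c : forall p q, hom (J p) (J q).
Hypothesis tb : thin_basis H c.

Lemma thin_basis_op :
  @thin_basis k (op_kcat A) T J (fun p q => H q p) (fun p q => c q p).
Proof.
have [sp e0 co id an va de] := tb.
split=> /= [p q f|p q|p q r pq qr|p|p q pq qp|p q pq|W].
- exact: sp.
- exact: e0.
- exact: co.
- exact: id.
- exact: an.
- by have [] := va _ _ pq; split.
- have [s es] := de W.
  exists [seq Tagged (fun p => (@hom k (op_kcat A) (J p) W * @hom k (op_kcat A) W (J p))%type)
             ((tagged x).2, (tagged x).1) | x <- s].
  by rewrite big_map.
Qed.

Lemma square_almost_split p a b q (Y : A) :
  is_biproduct Y (J a) (J b) ->
  half_square H p a b q -> half_square (fun p q => H q p) q a b p ->
  exists (f : hom (J p) Y) (g : hom Y (J q)), almost_split f g.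
Proof.
move=> [i [j [r [s [ri sj rj si ij]]]]] hs hs'.
have xy : 1 * -1 = -1 :> k by rewrite mul1r.
have yx : -1 * 1 = -1 :> k by rewrite mulr1.
have [kf mg ag] := half_square_split tb hs xy (And5 ri sj rj si ij).
have [cf mf af] :=
  @half_square_split k (op_kcat A) T J _ _ thin_basis_op _ _ _ _ _ _ _ r s i j hs' yx
    (And5 ri sj si rj ij).
exists (cmp i (c p a) + 1 *: cmp j (c p b)), (cmp (c a q) r + -1 *: cmp (c b q) s).
split; split; [exact: kf|exact: cf|exact/left_minimal_op/mf|exact: af|exact: mg|exact: ag].
Qed.

(** Conjugation by chosen isomorphisms; it carries the basis from the concrete intervals to the
    representatives in [ind_reps]. *)
Lemma thin_basis_transport (J' : T -> A) :
  (forall p, isom (J p) (J' p)) ->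
  exists c' : forall p q, hom (J' p) (J' q), thin_basis H c'.
Proof.
have [sp e0 co id an va de] := tb.
move=> /(@dep_choice _ _ _)[u /(@dep_choice _ _ _)[v uv]].
have vu p : cmp (v p) (u p) = idm _ by have [] := uv p.
have {}uv p : cmp (u p) (v p) = idm _ by have [] := uv p.
exists (fun p q => cmp (u q) (cmp (c p q) (v p))).
have cK p q X (f : hom X (J p)) : cmp (cmp (u q) (cmp (c p q) (v p))) (cmp (u p) f)
   = cmp (u q) (cmp (c p q) f).
  by rewrite -!cmpA [cmp (v p) _]cmpA vu cmp1m.
split=> [p q f|p q|p q r pq qr|p|||W] //.
- have [a e] := sp _ _ (cmp (v q) (cmp f (u p))); exists a.
  rewrite -cmpZr -cmpZl -e -!cmpA uv cmpm1 cmpA uv cmp1m //.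
- rewrite -e0; split=> [e|->]; last by rewrite cmp0l cmp0r.
  have : cmp (v q) (cmp (cmp (u q) (cmp (c p q) (v p))) (u p)) = 0 by rewrite e cmp0l cmp0r.
  by rewrite -!cmpA vu cmpm1 cmpA vu cmp1m.
- by rewrite cK [cmp (c q r) _]cmpA co.
- by rewrite id cmp1m uv.
- have [s es] := de W.
  exists [seq Tagged (fun p => (hom (J' p) W * hom W (J' p))%type)
             (cmp (tagged x).1 (v (tag x)), cmp (u (tag x)) (tagged x).2) | x <- s].
  rewrite big_map es; apply: eq_bigr => x _ /=.
  by rewrite -!cmpA [cmp (v _) _]cmpA vu cmp1m.
Qed.

End ThinBasisDual.

(** * Combinatorics of intervals *)

Section Combinatorics.
Variables (o : nat -> bool) (ev : bool).
Local Open Scope nat_scope.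

(** The code [(i, Some j)] stands for the interval [i, j], and [(i, None)] for
    [i, oo), or for the empty set if [ev] fails; [ev] will mean that [o n] holds
    for all large [n], the only case in which [i, oo) is finitely presented. *)
Definition code := (nat * option nat)%type.

Definition below (n : nat) (j : option nat) : bool :=
  if j is Some j then n <= j else ev.

Definition inI (p : code) (n : nat) : bool := (p.1 <= n) && below n p.2.

(** [lle i l] (resp. [rle j l]) is the condition at the left (resp. right) end for
    a nonzero map from an interval starting at [i] (ending at [j]) to one
    starting (ending) at [l]. *)
Definition lle (i l : nat) : bool :=
  (i == l) || (if i < l then ~~ o l.-1 else o i.-1).

Definition rle (j l : option nat) : bool :=
  match j, l with
  | None, None => true
  | Some j, None => ~~ o j
  | None, Some l => o l
  | Some j, Some l => (j == l) || (if j < l then ~~ o j else o l)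
  end.

(** Two intervals meet iff both contain the larger of their left ends, so one test point
    suffices. *)
Definition hom_rel (p q : code) : bool :=
  [&& lle p.1 q.1, rle p.2 q.2, inI p (maxn p.1 q.1) & inI q (maxn p.1 q.1)].

Lemma lle_refl i : lle i i. Proof. by rewrite /lle eqxx. Qed.

Lemma rle_refl j : rle j j. Proof. by case: j => //= j; rewrite eqxx. Qed.

Lemma lleP i l : lle i l <-> i = l \/ i < l /\ ~~ o l.-1 \/ l < i /\ o i.-1.
Proof. by rewrite /lle; case: ltngtP => h /=; lia. Qed.

Lemma lle_anti i l : lle i l -> lle l i -> i = l.
Proof. by move=> /lleP h1 /lleP h2; lia. Qed.

Lemma lle_total i l : lle i l || lle l i.
Proof. by rewrite /lle; case: ltngtP => //=; case: (o _). Qed.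

Lemma lle_trans i m l : lle i m -> lle m l -> lle i l.
Proof. by move=> /lleP[->//|h1] /lleP[<-|h2]; apply/lleP; lia. Qed.

Lemma rleP (j l : nat) :
  rle (Some j) (Some l) <-> j = l \/ j < l /\ ~~ o j \/ l < j /\ o l.
Proof. by rewrite /=; case: ltngtP => h /=; lia. Qed.

Lemma rle_anti j l : rle j l -> rle l j -> j = l.
Proof.
case: j l => [j|] [l|] //=; [|by case: (o j)..|by case: (o l)].
by move=> /rleP h1 /rleP h2; congr Some; lia.
Qed.

Lemma rle_total j l : rle j l || rle l j.
Proof.
case: j l => [j|] [l|] //=; [|by case: (o j)|by case: (o l)].
by case: ltngtP => //=; case: (o _).
Qed.

Lemma rle_trans j m l : rle j m -> rle m l -> rle j l.
Proof.
case: j m l => [j|] [m|] [l|].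
- by move=> /rleP[->//|h1] /rleP[<-|h2]; apply/rleP; lia.
- by move=> /rleP[->//|h1] /= h2; lia.
- by move=> /= h1 h2; apply/rleP; have [] := ltngtP j l; lia.
- by [].
- by move=> /= h1 /rleP[<-//|h2]; lia.
- by move=> /= h1 h2; lia.
- by [].
- by [].
Qed.

Lemma hom_relE i j l m :
  hom_rel (i, j) (l, m) = [&& lle i l, rle j m, below i j, below l j, below i m & below l m].
Proof.
have bm (n : option nat) : below (maxn i l) n = below i n && below l n.
  by case: n => [n|] /=; rewrite ?geq_max ?andbb.
by rewrite /hom_rel /inI /= leq_maxl leq_maxr !bm -!andbA.
Qed.

Lemma hom_rel_refl p : hom_rel p p = below p.1 p.2.
Proof. by case: p => i j; rewrite hom_relE lle_refl rle_refl /= !andbb. Qed.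

Lemma hom_rel_anti p q : hom_rel p q -> hom_rel q p -> p = q.
Proof.
move: p q => [i j] [l m]; rewrite !hom_relE => /and3P[h1 h2 _] /and3P[h3 h4 _].
by rewrite (lle_anti h1 h3) (rle_anti h2 h4).
Qed.

Lemma hom_rel_valid p q : hom_rel p q -> hom_rel p p /\ hom_rel q q.
Proof.
by move: p q => [i j] [l m]; rewrite !hom_rel_refl hom_relE => /and5P[_ _ -> _ /andP[]].
Qed.

Definition lcov (i l : nat) : Prop :=
  [/\ lle i l, i != l & forall m, lle i m -> lle m l -> m = i \/ m = l].

(** The clause [below 0 m] only discards [None] when [ev] fails, as no nonempty interval then ends
    at infinity. *)
Definition rcov (j l : option nat) : Prop :=
  [/\ rle j l, j != l & forall m, below 0 m -> rle j m -> rle m l -> m = j \/ m = l].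

(** An intermediate left end larger than both others would need [o m.-1] to be true and false at
    once. The same contradiction keeps an intermediate right end from being smaller than both
    others. *)
Lemma lle_between i m l n : lle i m -> lle m l -> below i n -> below l n -> below m n.
Proof.
case: n => [n|] //= /lleP h1 /lleP h2; lia.
Qed.

Lemma rle_between j n m x :
  rle j n -> rle n m -> below 0 n -> below x j -> below x m -> below x n.
Proof.
case: j n m => [j|] [n|] [m|] //.
- by move=> /rleP h1 /rleP h2 /= *; lia.
- by move=> /rleP h1 /= *; lia.
- by move=> /= h1 /rleP h2 *; lia.
- by move=> /= -> .
Qed.

Lemma lcov_le i l x : lcov i l -> lle x l -> x = l \/ lle x i.
Proof.
move=> [_ _ h] xl; case/orP: (lle_total x i) => [|ix]; first by right.
by have [->|->] := h _ ix xl; [right; exact: lle_refl | left].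
Qed.

Lemma lcov_ge i l x : lcov i l -> lle i x -> x = i \/ lle l x.
Proof.
move=> [_ _ h] ix; case/orP: (lle_total l x) => [|xl]; first by right.
by have [->|->] := h _ ix xl; [left | right; exact: lle_refl].
Qed.

Lemma rcov_le j m y : rcov j m -> below 0 y -> rle y m -> y = m \/ rle y j.
Proof.
move=> [_ _ h] y0 ym; case/orP: (rle_total y j) => [|jy]; first by right.
by have [->|->] := h _ y0 jy ym; [right; exact: rle_refl | left].
Qed.

Lemma rcov_ge j m y : rcov j m -> below 0 y -> rle j y -> y = j \/ rle m y.
Proof.
move=> [_ _ h] y0 jy; case/orP: (rle_total m y) => [|ym]; first by right.
by have [->|->] := h _ y0 jy ym; [left | right; exact: rle_refl].
Qed.

Lemma below0 x j : below x j -> below 0 j.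
Proof. by case: j. Qed.

(** If both ends moved, the mixed code [(l, j)], nonempty because the intervals meet, would lie
    strictly between. If one end moves, the betweenness lemmas make every intermediate interval
    nonempty, so that only covers of ends remain. *)
Lemma irr_hom_rel i j l m : irreducible_rel hom_rel (i, j) (l, m) <->
  hom_rel (i, j) (l, m) /\ (lcov i l /\ j = m \/ i = l /\ rcov j m).
Proof.
split=> [[H /eqP ne ir]|[H cov]]; last first.
  split=> //.
    by apply/eqP => -[e1 e2]; case: cov => [[[_ /eqP ne _]]|[_ [_ /eqP ne _]]].
  move=> [x y]; rewrite !hom_relE => /and5P[ix jy _ _ /andP[iy xy]] /and5P[xl ym _ _ _].
  case: cov => [[[_ _ h] e]|[e [_ _ h]]]; subst.
    have -> := rle_anti ym jy.
    by have [->|->] := h _ ix xl; [left|right].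
  have -> := lle_anti ix xl.
  by have [->|->] := h _ (below0 xy) jy ym; [left|right].
split=> //; move: (H); rewrite hom_relE => /and5P[il jm ij lj /andP[im lm]].
have [e|nil] := eqVneq i l; [right|left].
  subst l; split=> //; split=> // [|y y0 jy ym]; first by apply/eqP => e; case: ne; rewrite e.
  have iy := rle_between jy ym y0 ij im.
  have [[->]|[->]] : (i, y) = (i, j) \/ (i, y) = (i, m); [|by left|by right].
  by apply: ir; rewrite hom_relE lle_refl ?jy ?ym ?ij ?im ?iy.
have [e|njm] := eqVneq j m; last first.
  have [[e]|[e]] : (l, j) = (i, j) \/ (l, j) = (l, m).
  - by apply: ir; rewrite hom_relE ?lle_refl ?rle_refl ?il ?jm ?ij ?lj ?lm.
  - by move: nil; rewrite e eqxx.
  - by move: njm; rewrite e eqxx.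
subst m; split=> //; split=> // x ix xl.
have xj := lle_between ix xl ij lj.
have [[->]|[->]] : (x, j) = (i, j) \/ (x, j) = (l, j); [|by left|by right].
by apply: ir; rewrite hom_relE rle_refl ?ix ?xl ?ij ?lj ?xj.
Qed.

Section Square.
Variables (i l j m : nat).
Hypotheses (ci : lcov i l) (cj : rcov (Some j) (Some m)) (ij : i <= j) (lm : l <= m).

Let il : lle i l. Proof. by case: ci. Qed.
Let jm : rle (Some j) (Some m). Proof. by case: cj. Qed.
Let nil : i <> l. Proof. by case: ci => _ /eqP. Qed.
Let njm : j <> m. Proof. by case: cj => _ /eqP n _ e; apply: n; rewrite e. Qed.

(** In a total order whatever is below [l] is [l] itself or is below its predecessor [i], and
    likewise for [m] and [j]; this places each test code relative to the four corners. A middle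
    corner may be empty, but then no nonzero map joins the extreme corners. *)
Lemma square_half :
  half_square hom_rel (i, Some j) (l, Some j) (i, Some m) (l, Some m).
Proof.
split.
- by rewrite hom_rel_refl.
- by split; rewrite hom_rel_refl /= => h; rewrite !hom_relE ?lle_refl ?rle_refl ?il ?jm /= ?ij ?lm ?h.
- split; rewrite ?hom_relE.
  + by apply/negP => /andP[h _]; case: nil; exact: lle_anti h.
  + by apply/negP => /and3P[_ h _]; case: njm; have [] := rle_anti jm h.
  + by apply/eqP => -[e].
  + by apply/eqP => -[e].
- rewrite !hom_rel_refl hom_relE /=; case: (l <= j); rewrite ?andbF ?orbT //=.
  by case: (i <= m); rewrite ?andbF.
move=> [x y]; split; rewrite !hom_relE.
- move=> /and5P[xi yj xy iy /andP[xj _]].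
  rewrite (lle_trans xi il) xi yj (rle_trans yj jm) xy iy xj /=.
  move: xy iy xj; case: y yj => [y|] yj /= xy iy xj; last by lia.
  by move/rleP: jm; move/lleP: il; move/rleP: yj; lia.
- move=> /and5P[xl yj xy ly /andP[xj lj]] /and5P[xi ym _ iy /andP[xm im]].
  by rewrite xi yj xy iy xj xl ym ly xm /= ij lm.
- move=> /and5P[xl yj xy ly /andP[xj lj]] _; have [e|xi] := lcov_le ci xl.
    by subst x; rewrite xl (rle_trans yj jm) ly /= lm ?orbT.
  by rewrite xi yj xy xj (lle_between xi il xy ly) /= ij.
- move=> /and5P[xi ym xy iy /andP[xm im]] _.
  have [e|yj] := rcov_le cj (below0 xy) ym.
    by subst y; rewrite (lle_trans xi il) ym xm /= lm ?orbT.
  by rewrite xi yj xy iy (rle_between yj jm _ xy xm) //= ij.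
- move=> /and5P[xl ym xy ly /andP[xm _]] /eqP ne.
  have [e|yj] := rcov_le cj (below0 xy) ym.
    have [e'|xi] := lcov_le ci xl; first by case: ne; rewrite e e'.
    by subst y; rewrite xi ym xm (lle_between (n := Some m) xi il xm lm) /= ?orbT.
  rewrite xl yj xy ly (rle_between yj jm _ xy xm) // (rle_between yj jm _ ly) //.
Qed.

Lemma square_half_op :
  half_square (fun p q => hom_rel q p) (l, Some m) (l, Some j) (i, Some m) (i, Some j).
Proof.
split.
- by rewrite hom_rel_refl.
- by split; rewrite hom_rel_refl /= => h; rewrite !hom_relE ?lle_refl ?rle_refl ?il ?jm /= ?ij ?lm ?h.
- split; rewrite ?hom_relE.
  + by apply/negP => /and3P[_ h _]; case: njm; have [] := rle_anti jm h.
  + by apply/negP => /andP[h _]; case: nil; exact: lle_anti h.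
  + by apply/eqP => -[e]; case: nil.
  + by apply/eqP => -[e]; case: njm.
- rewrite !hom_rel_refl hom_relE /=; case: (l <= j); rewrite ?andbF ?orbT //=.
  by case: (i <= m); rewrite ?andbF.
move=> [x y]; split; rewrite !hom_relE.
- move=> /and5P[lx my _ xm /andP[ly xy]].
  rewrite (lle_trans il lx) lx my (rle_trans jm my) xy ly xm /=.
  move: xy ly xm; case: y my => [y|] my /= xy ly xm.
    by move/rleP: jm; move/lleP: il; lia.
  by move/rleP: jm; move/lleP: il; move: ij lm; lia.
- move=> /and5P[lx jy lj xj /andP[ly xy]] /and5P[ix my im xm /andP[iy _]].
  by rewrite ix jy xj iy xy lx my xm ly /= ij lm.
- move=> /and5P[lx jy lj xj /andP[ly xy]] _.
  have [e|my] := rcov_ge cj (below0 xy) jy.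
    by subst y; rewrite (lle_trans il lx) jy xj /= ij ?orbT.
  by rewrite lx my xy ly (rle_between jm my _ xj xy) //= lm ?orbT.
- move=> /and5P[ix my im xm /andP[iy xy]] _.
  have [e|lx] := lcov_ge ci ix.
    by subst x; rewrite ix (rle_trans jm my) iy /= ij ?orbT.
  by rewrite lx my xm xy (lle_between il lx iy xy) /= lm ?orbT.
- move=> /and5P[ix jy _ xj /andP[iy xy]] /eqP ne.
  have [e|my] := rcov_ge cj (below0 xy) jy.
    have [e'|lx] := lcov_ge ci ix; first by case: ne; rewrite e e'.
    by subst y; rewrite lx jy xj (lle_between (n := Some j) il lx ij xj) /= ?orbT.
  rewrite ix my iy xy (rle_between jm my _ xj xy) //.
  by rewrite (rle_between jm my _ (_ : below i (Some j)) iy) // orbT.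
Qed.

End Square.

End Combinatorics.

(** * Ranks of endpoints and coordinates in the translation quiver *)

Section Ranks.
Variable o : nat -> bool.

Fixpoint cnt (b : bool) (n : nat) : nat :=
  if n is m.+1 then (cnt b m + (o m == b))%N else 0%N.

(** The rank of a left endpoint in the order [lle], normalised by [rk 0 = 0]. *)
Definition rk (n : nat) : int :=
  if n is m.+1 then (if o m then - (cnt true m.+1)%:Z else (cnt false m.+1)%:Z)
  else 0.

Lemma cnt_leq b m n : (m <= n)%N -> (cnt b m <= cnt b n)%N.
Proof. by elim: n => [|n IH] /=; [case: m|rewrite leq_eqVlt => /orP[/eqP ->|/IH] //=; lia]. Qed.

Lemma cnt_lt b m n : (m < n)%N -> o m = b -> (cnt b m < cnt b n)%N.
Proof. by move=> /(cnt_leq b) /= h e; move: h; rewrite e eqxx; lia. Qed.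

Lemma cnt_sum b n : (cnt b n + cnt (~~ b) n = n)%N.
Proof. by elim: n => //= n IH; case: (o n); case: b IH => /=; lia. Qed.

Lemma cnt_inj b m n : o m = b -> o n = b -> cnt b m = cnt b n -> m = n.
Proof.
by move=> om on e; case: (ltngtP m n) => // h; [have := cnt_lt h om|have := cnt_lt h on]; lia.
Qed.

Lemma cnt_nth b n z : (z < cnt b n)%N -> exists m, [/\ (m < n)%N, o m = b & cnt b m = z].
Proof.
elim: n => //= n IH; case: eqP => e /=; rewrite ?addn0 ?addn1 ?ltnS => h.
  case: (ltngtP z (cnt b n)) h => // [/IH[m [? ? ?]]|-> ] _; first by exists m; split=> //; lia.
  by exists n.
by have [m [? ? ?]] := IH h; exists m; split=> //; lia.
Qed.

(** Vertex n+1 is above all smaller left ends if [o n] fails and below all of them if it holds. Each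
    new vertex is thus a new maximum or minimum, and [rk] counts the vertices of its kind so far. *)
Lemma lle_rk i l : lle o i l <-> (rk i <= rk l)%R.
Proof.
rewrite lleP; case: i l => [|i] [|l] /=.
- by split=> // _; left.
- by case: (o l); split; lia.
- by case: (o i); split; lia.
have ci b := @cnt_leq b; have cl := cnt_lt.
case: (ltngtP i l) => [h|h|->]; last by split=> // _; left.
  have := ci true _ _ h; have := ci false _ _ h; rewrite /=.
  by case oi : (o i); case ol: (o l); rewrite /= => h1 h2; split; lia.
have := ci true _ _ h; have := ci false _ _ h; rewrite /=.
by case oi : (o i); case ol: (o l); rewrite /= => h1 h2; split; lia.
Qed.

Lemma rk_inj i l : rk i = rk l -> i = l.
Proof. by move=> e; apply: (@lle_anti o); apply/lle_rk; rewrite e. Qed.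

(** [cnt] grows by unit steps, exactly at the edges of the kind it counts, so neither the positive
    nor the negative ranks skip a value. *)
Lemma rk_convex i l (z : int) : (rk i <= z)%R -> (z <= rk l)%R -> exists m, rk m = z.
Proof.
case: z => [[|n]|n] h1 h2; first by exists 0%N.
- case: l h2 => [|l] /=; first by lia.
  case ol : (o l) => h; first by lia.
  have [m [_ om em]] : exists m, [/\ (m < l.+1)%N, o m = false & cnt false m = n].
    by apply: cnt_nth; rewrite /= ol; lia.
  by exists m.+1; rewrite /= om /= em addn1.
- case: i h1 => [|i] /=; first by lia.
  case ol : (o i) => h; last by lia.
  have [m [_ om em]] : exists m, [/\ (m < i.+1)%N, o m = true & cnt true m = n].
    by apply: cnt_nth; rewrite /= ol; lia.
  by exists m.+1; rewrite /= om /= em addn1; lia.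
Qed.

Lemma lcov_rk i l : lcov o i l <-> rk l = rk i + 1.
Proof.
split=> [[/lle_rk h /eqP ne cov]|e].
  have h' : rk i != rk l by apply/eqP => /rk_inj.
  have [m em] : exists m, rk m = rk i + 1 by apply: (@rk_convex i l); lia.
  have [em'|em'] : m = i \/ m = l by apply: cov; apply/lle_rk; lia.
    by subst m; lia.
  by subst m.
split; first by apply/lle_rk; lia.
  by apply/eqP => el; move: e; rewrite el; lia.
move=> m /lle_rk h1 /lle_rk h2.
have [em|em] : rk m = rk i \/ rk m = rk l by lia.
  by left; exact: rk_inj.
by right; exact: rk_inj.
Qed.

Definition part (j : option nat) : bool := if j is Some j then o j else false.

(** The direction of [rle] on the finite ends of a part: increasing in the lower one, decreasing in
    the upper one. *)
Definition sgb (b : bool) : int := if b then -1 else 1.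

Variable ev : bool.

Section PartOfCover.
Hypothesis evT : ev -> exists N, forall n, (N <= n)%N -> o n.
Hypothesis evF : ~~ ev -> forall N, exists2 n, (N <= n)%N & ~~ o n.

Lemma rcov_part j l : below ev 0 j -> below ev 0 l -> rcov o ev j l -> part j = part l.
Proof.
move=> vj vl [jl /eqP ne cov].
case: j l vj vl jl ne cov => [j|] [l|] //= vj vl; last first.
- move=> ol ne cov; have [N hN] := evT vj.
  (* In the upper part larger ends come earlier, so a far right-pointing edge yields an end strictly
     between [None] and [Some l]. *)
  have om : o (maxn l.+1 N) by apply: hN; lia.
  have [//|[]] : Some (maxn l.+1 N) = None \/ Some (maxn l.+1 N) = Some l.
    by apply: cov => //; apply/rleP; lia.
  by lia.
- by move=> /negPf.
move=> h ne cov; case oj : (o j); case ol : (o l) => //.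
  by move: h; rewrite oj ol /=; case: ltngtP => // e; case: ne; rewrite e.
case: (boolP ev) => e.
  by have [] : None = Some j \/ None = Some l by apply: cov => //=; rewrite ?oj ?ol.
have [m hm om] := evF e (maxn j l).+1.
have [[em]|[em]] : Some m = Some j \/ Some m = Some l; try lia.
by apply: cov => //; apply/rleP; rewrite ?oj ?ol; lia.
Qed.

End PartOfCover.

Lemma rle_cnt b j l : o j = b -> o l = b ->
  rle o (Some j) (Some l) <-> (sgb b * (cnt b j)%:Z <= sgb b * (cnt b l)%:Z)%R.
Proof.
move=> oj ol; rewrite rleP oj ol.
case: (ltngtP j l) => [h|h|->]; last by split=> // _; left.
  by have := cnt_lt h oj; case: b {oj ol} => /= ?; split; lia.
by have := cnt_lt h ol; case: b {oj ol} => /= ?; split; lia.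
Qed.

Lemma rcov_cnt b j l : o j = b -> o l = b ->
  rcov o ev (Some j) (Some l) <-> ((cnt b l)%:Z = (cnt b j)%:Z + sgb b)%R.
Proof.
move=> oj ol; have cnti := cnt_inj; split.
  move=> [/(rle_cnt oj ol) h /eqP ne cov].
  have ne' : cnt b j != cnt b l by apply/eqP => /(cnti _ _ _ oj ol) e; apply: ne; rewrite e.
  have [m [om em]] : exists m, o m = b /\ ((cnt b m)%:Z = (cnt b j)%:Z + sgb b)%R.
    have [z ez] : exists z : nat, z%:Z = ((cnt b j)%:Z + sgb b)%R.
      by exists (absz ((cnt b j)%:Z + sgb b)); case: b {oj ol cov} h ne' => /=; lia.
    have : (z < cnt b (maxn j l).+1)%N.
      have h1 : (cnt b j < cnt b (maxn j l).+1)%N by apply: cnt_lt => //; lia.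
      have h2 : (cnt b l < cnt b (maxn j l).+1)%N by apply: cnt_lt => //; lia.
      by case: b {oj ol cov} h ne' ez h1 h2 => /=; lia.
    by move=> /cnt_nth[m [_ om em]]; exists m; rewrite em.
  have [[e]|[e]] : Some m = Some j \/ Some m = Some l; last by rewrite -e.
    apply: cov => //; apply/(rle_cnt (b := b)) => //; case: b {oj ol om} h ne' em => /=; lia.
  by subst m; case: b {oj ol om} em {h ne'} => /=; lia.
move=> e; split.
- by apply/(rle_cnt oj ol); case: b {oj ol} e => /=; lia.
- by apply/eqP => -[ee]; subst l; case: b {oj ol} e => /=; lia.
move=> [m|] /= _; last by rewrite oj ol; case: b {oj ol e}.
rewrite -!/(rle _ (Some _) (Some _)) => h1 h2.
(* Each part is convex for [rle], so [m] is of kind [b] too and its position is measured by the same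
   [cnt b]. *)
have om : o m = b.
  case om : (o m); case: (b) oj ol => // oj ol.
    by move/rleP: h2 => [em|]; [rewrite -em om in ol | rewrite om ol; lia].
  by move/rleP: h1 => [em|]; [rewrite em om in oj | rewrite om oj; lia].
have [em|em] : cnt b m = cnt b j \/ cnt b m = cnt b l.
- move: h1 h2 => /(rle_cnt oj om) + /(rle_cnt om ol).
  by case: b {oj ol om} e => /=; lia.
- by left; rewrite (cnti _ _ _ om oj em).
- by right; rewrite (cnti _ _ _ om ol em).
Qed.

(** For [o j = b], the module [i, j] corresponds to the vertex
    [(ncoord b i j, dcoord b i j)] of the translation quiver; [b] is false on the
    preprojective and true on the preinjective side. *)
Definition dcoord (b : bool) (i j : nat) : int := (cnt b j)%:Z - sgb b * rk i.

(** The term [cnt b d], with d the value of [dcoord], encodes the orientation of the slices: for a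
    fixed right end, passing from d to d+1 changes n exactly when [o d = b]. As d <= j, the product
    [sgb b * n] is nonnegative. *)
Definition ncoord (b : bool) (i j : nat) : int :=
  sgb b * ((cnt b j)%:Z - (cnt b (absz (dcoord b i j)))%:Z).

(** For i <= j the rank of [i] lies between [- cnt true j] and [cnt false j], and these two counts
    add up to [j]. *)
Lemma dcoord_ge0 b i j : o j = b -> (i <= j)%N -> (0 <= dcoord b i j <= j%:Z)%R.
Proof.
move=> oj ij; rewrite /dcoord; have := cnt_sum b j.
case: i ij => [|i] ij /=; first by lia.
have := cnt_leq true ij; have := cnt_leq false ij => /=.
by case: (o i); case: b oj => //=; lia.
Qed.

Lemma dcoordK b i j : o j = b -> (i <= j)%N -> (absz (dcoord b i j))%:Z = dcoord b i j.
Proof. by move=> oj ij; have := dcoord_ge0 oj ij; lia. Qed.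

Lemma ncoord_ge0 b i j : o j = b -> (i <= j)%N -> (0 <= sgb b * ncoord b i j)%R.
Proof.
move=> oj ij; rewrite /ncoord; have h := dcoord_ge0 oj ij.
have /(cnt_leq b) : (absz (dcoord b i j) <= j)%N by lia.
by case: b {oj} h => /=; lia.
Qed.

Lemma coord_inj b i j l m : o j = b -> o m = b ->
  dcoord b i j = dcoord b l m -> ncoord b i j = ncoord b l m -> i = l /\ j = m.
Proof.
move=> oj om ed en.
have es : cnt b j = cnt b m.
  by move: en; rewrite /ncoord ed; case: (b) => /=; lia.
split; last exact: cnt_inj om es.
by apply: rk_inj; move: ed; rewrite /dcoord es; case: (b) => /=; lia.
Qed.

(** Solving the formula of [ncoord] gives the count [s] of the right end, which exists as there are
    infinitely many vertices of kind [b]. The left end must then have rank [sgb b * (s - d)]: it is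
    0, or it follows an edge of kind [b] if s > d and of the other kind if s < d. *)
Lemma coord_surj b (d : nat) (n : int) : (forall N, exists2 m, (N <= m)%N & o m = b) ->
  (0 <= sgb b * n)%R ->
  exists i j, [/\ (i <= j)%N, o j = b, dcoord b i j = d%:Z & ncoord b i j = n].
Proof.
move=> inf n0.
have [s es] : exists s : nat, s%:Z = sgb b * n + (cnt b d)%:Z.
  by exists (absz (sgb b * n + (cnt b d)%:Z)); lia.
have big z : exists N, (z < cnt b N)%N.
  elim: z => [|z [N hN]].
    have [m _ om] := inf 0%N; exists m.+1; rewrite /= om eqxx; lia.
  by have [m /(cnt_leq b) h om] := inf N; exists m.+1; rewrite /= om eqxx; lia.
have [j [oj ej]] : exists j, o j = b /\ cnt b j = s.
  by have [N /cnt_nth[j [_ oj ej]]] := big s; exists j.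
have sb : sgb b * sgb b = 1 by case: (b).
have [i [ij ei]] : exists i, (i <= j)%N /\ sgb b * rk i = s%:Z - d%:Z; last first.
  have ed : dcoord b i j = d%:Z by rewrite /dcoord ei ej; lia.
  exists i, j; split=> //; rewrite /ncoord ed ej /=.
  by rewrite es addrK mulrA sb mul1r.
have dj : (d <= j)%N.
  by rewrite leqNgt; apply/negP => /cnt_lt/(_ oj); lia.
case: (ltngtP s d) => h.
- have : ((d - s).-1 < cnt (~~ b) d)%N by have := cnt_sum b d; lia.
  move=> /cnt_nth[i [id oi ei]]; exists i.+1; split; first by lia.
  by rewrite /= oi; case: b {inf n0 es big oj ej sb} oi ei => /= oi ei; rewrite ?oi /=; lia.
- have : ((s - d).-1 < cnt b j)%N by lia.
  move=> /cnt_nth[i [id oi ei]]; exists i.+1; split; first by lia.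
  by rewrite /= oi; case: b {inf n0 es big oj ej sb} oi ei => /= oi ei; rewrite ?oi /=; lia.
- by exists 0%N; split=> //=; rewrite mulr0; lia.
Qed.

Lemma coord_tau b i j l m : o j = b -> o m = b -> (i <= j)%N -> (l <= m)%N ->
  absz (dcoord b l m) = absz (dcoord b i j) -> ncoord b l m = ncoord b i j - 1 ->
  lcov o l i /\ rcov o ev (Some m) (Some j).
Proof.
move=> oj om ij lm ed en.
have {}ed : dcoord b l m = dcoord b i j by rewrite -(dcoordK oj ij) -(dcoordK om lm) ed.
move: en; rewrite /ncoord ed => en.
have es : (cnt b j)%:Z = (cnt b m)%:Z + sgb b by case: (b) en => /=; lia.
split; last by apply/(rcov_cnt om oj).
by apply/lcov_rk; move: ed; rewrite /dcoord es; case: (b) => /=; lia.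
Qed.

(** Moving either end one step up changes [dcoord] by one, in opposite directions for the two ends.
    Whether [ncoord] jumps as well depends on the edge of D that is crossed, and this matches the
    division of the arrows of [ZZ] into those within a slice and those to the next. *)
Lemma coord_arrow b i j l m : o j = b -> o m = b -> (i <= j)%N -> (l <= m)%N ->
  let u := (ncoord b i j, absz (dcoord b i j)) in
  let v := (ncoord b l m, absz (dcoord b l m)) in
  irreducible_rel (hom_rel o ev) (i, Some j) (l, Some m) <->
  inhabited (@ZZ_arrow (Ainf_quiver (fun n => ~~ o n)) u v).
Proof.
move=> oj om ij lm u v.
pose ar x y := (y == x.+1) && ~~ o x || (x == y.+1) && ~~ ~~ o y.
have -> : inhabited (@ZZ_arrow (Ainf_quiver (fun n => ~~ o n)) u v) <->
    v.1 = u.1 /\ ar u.2 v.2 \/ v.1 = u.1 + 1 /\ ar v.2 u.2.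
  split=> [[[[/eqP e a]|[/eqP e a]]]|[[/eqP e a]|[/eqP e a]]]; [by left|by right| |].
    by constructor; left.
  by constructor; right.
have -> : irreducible_rel (hom_rel o ev) (i, Some j) (l, Some m) <->
    (rk l = rk i + 1 /\ cnt b m = cnt b j) \/
    (rk l = rk i /\ (cnt b m)%:Z = (cnt b j)%:Z + sgb b).
  rewrite irr_hom_rel; split=> [[_ [[/lcov_rk e [->]]|[-> /(rcov_cnt oj om) e]]]|]; [by left|by right|].
  case=> [[/lcov_rk e /(cnt_inj om oj) ee]|[/rk_inj ee /(rcov_cnt oj om) e]]; subst.
    split; last by left.
    by rewrite hom_relE rle_refl; case: e => -> _ _ /=; rewrite ij lm.
  split; last by right.
  by rewrite hom_relE lle_refl; case: e => -> _ _ /=; rewrite ij lm.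
rewrite {}/u {}/v /=; have := dcoordK oj ij; have := dcoordK om lm.
have := ncoord_ge0 oj ij; have := ncoord_ge0 om lm; rewrite /ncoord.
move: (absz (dcoord b i j)) (absz (dcoord b l m)) => d d' n0 n0'.
rewrite /dcoord => ed' ed {n0 n0'}.
have cS x : cnt b x.+1 = (cnt b x + (o x == b))%N by [].
rewrite {}/ar.
have [e|[e|ne]] : d' = d.+1 \/ d = d'.+1 \/ (d' <> d.+1 /\ d <> d'.+1) by lia.
- subst d'; rewrite cS eqxx; have -> : (d == d.+2) = false by lia.
  by case: (o d); case: (b) ed ed' => /=; lia.
- subst d; rewrite cS eqxx; have -> : (d' == d'.+2) = false by lia.
  by case: (o d'); case: (b) ed ed' => /=; lia.
have -> : (d' == d.+1) = false by lia.
have -> : (d == d'.+1) = false by lia.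
by split; [case: (b) ed ed' => /= ed ed'; lia | case=> -[_]].
Qed.

End Ranks.

(** * Thin representations *)

Definition edge (o : nat -> bool) (m n : nat) : bool :=
  (n == m.+1) && o m || (m == n.+1) && ~~ o n.

(** [Q] is not replaced by [Ainf_quiver o]: numbering its vertices and knowing that parallel arrows
    are equal avoids transporting representations. *)
Record coords (Q : quiver) (o : nat -> bool) := Coords {
  pos : Q -> nat;
  vtx : nat -> Q;
  vtxK : cancel vtx pos;
  posK : cancel pos vtx;
  arrow_edge : forall x y : Q, arrow x y -> edge o (pos x) (pos y);
  edge_arrow : forall x y : Q, edge o (pos x) (pos y) ->
    inhabited (arrow x y);
  arrow_eq : forall (x y : Q) (a b : arrow x y), a = b }.

Lemma type_Ainf_coords (Q : quiver) (o : nat -> bool) :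
  quiver_iso (Ainf_quiver o) Q -> inhabited (coords Q o).
Proof.
move=> [f [[g fK gK] fa]].
have ex x y : exists h : @arrow (Ainf_quiver o) (g x) (g y) -> arrow x y, bijective h.
  by have := fa (g x) (g y); rewrite !gK.
have ae (x y : Q) : arrow x y -> edge o (g x) (g y).
  by move=> a; have [h [h' _ _]] := ex x y; exact: h' a.
have ea (x y : Q) : edge o (g x) (g y) -> inhabited (arrow x y).
  by move=> a; have [h _] := ex x y; constructor; exact: h a.
have au (x y : Q) (a b : arrow x y) : a = b.
  have [h [h' hK h'K]] := ex x y.
  by rewrite -[a]h'K -[b]h'K; congr h; exact: (@Prop_irrelevance (edge o (g x) (g y))).
by constructor; exact: (Coords fK gK ae ea au).
Qed.

Section RhomLinear.
Variables (k : fieldType) (Q : quiver) (M N : rep k Q) (f : rhom M N) (x : Q).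

Lemma rhomL a u v : f x (a *: u + v) = a *: f x u + f x v.
Proof. exact: linearP. Qed.
Lemma rhom0 : f x 0 = 0. Proof. exact: linear0. Qed.
Lemma rhomD u v : f x (u + v) = f x u + f x v. Proof. exact: linearD. Qed.
Lemma rhomB u v : f x (u - v) = f x u - f x v. Proof. exact: linearB. Qed.
Lemma rhomN u : f x (- u) = - f x u. Proof. exact: linearN. Qed.
Lemma rhomZ a u : f x (a *: u) = a *: f x u. Proof. exact: linearZ. Qed.

End RhomLinear.

Section ThinModules.
Variables (k : fieldType) (Q : quiver) (o : nat -> bool) (C : coords Q o).

(** The space of a thin representation at a vertex is ['rV_b], of dimension
    [b : bool]; its generator [one b] is 0 if [b] is false. *)
Definition one (b : bool) : 'rV[k]_b := const_mx 1.

Definition coef (b : bool) (u : 'rV[k]_b) : k := \sum_i u 0 i.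

Lemma coef_is_linear (b : bool) : linear (@coef b : 'rV[k]_b -> k^o).
Proof.
move=> a u v; rewrite /coef scaler_sumr -big_split /=.
by apply: eq_bigr => i _; rewrite !mxE.
Qed.

HB.instance Definition _ (b : bool) :=
  GRing.isLinear.Build k 'rV[k]_b k^o *:%R (@coef b) (@coef_is_linear b).

Lemma coefE0 (b : bool) : coef (0 : 'rV[k]_b) = 0.
Proof. exact: linear0. Qed.

Lemma coefD (b : bool) (u v : 'rV[k]_b) : coef (u + v) = coef u + coef v.
Proof. exact: linearD. Qed.

Lemma coefZ (b : bool) a (u : 'rV[k]_b) : coef (a *: u) = a * coef u.
Proof. exact: linearZ. Qed.

Lemma coef_one b : coef (one b) = b%:R.
Proof. by rewrite /coef; case: b; rewrite ?big_ord1 ?big_ord0 ?mxE. Qed.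

Lemma coefK (b : bool) (u : 'rV[k]_b) : u = coef u *: one b.
Proof.
rewrite /coef; case: b u => u; first by apply/rowP => i; rewrite big_ord1 !mxE mulr1 ord1.
by apply/rowP => -[].
Qed.

Lemma coef0 (b : bool) (u : 'rV[k]_b) : ~~ b -> u = 0.
Proof. by case: b u => // u _; apply/rowP => -[]. Qed.

Lemma rV_eq (b : bool) (u v : 'rV[k]_b) : coef u = coef v -> u = v.
Proof. by move=> e; rewrite [u]coefK e -coefK. Qed.

Definition tmap (b b' : bool) (u : 'rV[k]_b) : 'rV[k]_b' := coef u *: one b'.

Lemma tmap_is_linear b b' : linear (@tmap b b').
Proof. by move=> a u v; rewrite /tmap linearP scalerDl scalerA. Qed.

HB.instance Definition _ (b b' : bool) :=
  GRing.isLinear.Build k 'rV[k]_b 'rV[k]_b' *:%R (@tmap b b') (@tmap_is_linear b b').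

Definition Thin (b : nat -> bool) : rep k Q :=
  @Rep k Q (fun x => 'rV[k]_(b (pos C x)))
    (fun x y _ => @tmap (b (pos C x)) (b (pos C y))).

Section FromThin.
Variables (b : nat -> bool) (M : rep k Q) (v : forall x, M x).
Hypothesis v0 : forall x, ~~ b (pos C x) -> v x = 0.
Hypothesis vn : forall (x y : Q) (al : arrow x y), b (pos C x) -> rmap M al (v x) = v y.

(** Naturality is a condition only at arrows that start in the support, including those that leave
    it; elsewhere the generator is zero. [to_thin] is the dual, with functionals and arrows that end
    in the support. *)
Program Definition from_thin : rhom (Thin b) M :=
  @RHom k Q (Thin b) M (fun x u => coef u *: v x) _ _.
Next Obligation. by move=> x a u w; rewrite coefD coefZ scalerDl scalerA. Qed.
Next Obligation.
move=> x y al u /=; rewrite /tmap coefZ linearZ coef_one /=.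
(* [boolP] would fail, as [b (pos C x)] occurs in the type of [u]. *)
have [bx|nbx] := orP (orbN (b (pos C x))); last first.
  by rewrite (coef0 (u : 'rV_(b (pos C x))) nbx) coefE0 mul0r !scale0r.
rewrite vn // -scalerA; have [b_y|nby] := orP (orbN (b (pos C y))); first by rewrite b_y scale1r.
by rewrite v0 // !scaler0.
Qed.

End FromThin.

Section ToThin.
Variables (b : nat -> bool) (M : rep k Q) (l : forall x, M x -> k).
Hypothesis l_lin : forall x a u v, l (a *: u + v : M x) = a * l u + l v.
Hypothesis ln : forall (x y : Q) (al : arrow x y) (u : M x), b (pos C y) ->
  l (rmap M al u) = (b (pos C x))%:R * l u.

Program Definition to_thin : rhom M (Thin b) :=
  @RHom k Q M (Thin b) (fun x u => l u *: one (b (pos C x))) _ _.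
Next Obligation. by move=> x a u w; rewrite l_lin scalerDl scalerA. Qed.
Next Obligation.
move=> x y al u /=; rewrite /tmap coefZ coef_one.
have [b_y|nby] := orP (orbN (b (pos C y))); last by rewrite [one _]coef0 ?scaler0.
by rewrite ln // mulrC.
Qed.

End ToThin.
End ThinModules.

(** * Paths *)

Section RepIso.
Variables (k : fieldType) (Q : quiver).
Notation riso := (@isom k (Rep_cat k Q)).

Lemma bijective_rhom_inv (M N : rep k Q) (f : rhom M N) :
  (forall x, injective (f x)) -> (forall x v, exists u, f x u = v) ->
  exists f' : rhom N M, (forall x u, f' x (f x u) = u) /\ (forall x v, f x (f' x v) = v).
Proof.
move=> fi fs; have [g gK] : {g : forall x, N x -> M x & forall x v, f x (g x v) = v}.
  apply: (@dep_choice _ _ (fun x (g : N x -> M x) => forall v, f x (g v) = v)) => x.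
  by have [g gK] := choice (fs x); exists g; exact: gK.
have gl x : linear (g x).
  by move=> a u v; apply: fi; rewrite rhomL !gK.
have gn (x y : Q) (al : arrow x y) v : g y (rmap N al v) = rmap M al (g x v).
  by apply: fi; rewrite gK rapp_natural gK.
exists (RHom gl gn); split=> x v /=; last by rewrite gK.
by apply: fi; rewrite gK.
Qed.

Lemma bijective_rhom_iso (M N : rep k Q) (f : rhom M N) :
  (forall x, injective (f x)) -> (forall x v, exists u, f x u = v) -> riso M N.
Proof.
move=> fi fs; have [f' [fK f'K]] := bijective_rhom_inv fi fs.
by exists f, f'; split; apply: rhomP.
Qed.

Lemma riso_map (M N : rep k Q) : riso M N -> exists f : rhom M N,
  (forall x, injective (f x)) /\ (forall x v, exists u, f x u = v).
Proof.
move=> [f [g [gf fg]]]; exists f; split=> x.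
  move=> u v e; have := congr1 (fun h : rhom M M => h x u) gf => /= <-.
  by have := congr1 (fun h : rhom M M => h x v) gf => /= <-; rewrite e.
by move=> v; exists (g x v); exact: (congr1 (fun h : rhom N N => h x v) fg).
Qed.

End RepIso.

Section Presentations.
Variables (k : fieldType) (Q : quiver) (o : nat -> bool) (C : coords Q o).
Notation pos := (pos C).
Notation vtx := (vtx C).
Notation Thin := (@Thin k Q o C).
Notation riso := (@isom k (Rep_cat k Q)).

Definition reach (m n : nat) : bool :=
  if (m <= n)%N then [forall i : 'I_n, (m <= i)%N ==> o i]
  else [forall i : 'I_m, (n <= i)%N ==> ~~ o i].

Lemma reachP m n : reach m n <->
  (forall i, (m <= i < n)%N -> o i) /\ (forall i, (n <= i < m)%N -> ~~ o i).
Proof.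
rewrite /reach; case: ifP => mn; split.
- move=> /forallP h; split=> i hi; last by lia.
  have lt : (i < n)%N by lia.
  by have /implyP := h (Ordinal lt); apply; rewrite /=; lia.
- by move=> [h _]; apply/forallP => i; apply/implyP => hi; apply: h; rewrite hi /=.
- move=> /forallP h; split=> i hi; first by lia.
  have lt : (i < m)%N by lia.
  by have /implyP := h (Ordinal lt); apply; rewrite /=; lia.
- by move=> [_ h]; apply/forallP => i; apply/implyP => hi; apply: h; rewrite hi /=.
Qed.

Lemma reach_refl m : reach m m.
Proof. by apply/reachP; split=> i; lia. Qed.

Lemma reach_edge a m n : reach a m -> edge o m n -> reach a n.
Proof.
move=> /reachP[h1 h2] /orP[/andP[/eqP -> om]|/andP[/eqP e on]]; apply/reachP.
  split=> i hi; last by apply: h2; lia.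
  by have [e|ne] := eqVneq i m; [rewrite e|apply: h1; lia].
subst m; split=> i hi; first by apply: h1; lia.
by have [e|ne] := eqVneq i n; [rewrite e|apply: h2; lia].
Qed.

(** On a line the last step into [n] comes from the side of [a], so it is unique. The decreasing
    distance drives the construction of paths. *)
Lemma reach_pred a n : reach a n -> a <> n ->
  exists m, [/\ reach a m, edge o m n, (`|m%:Z - a%:Z| < `|n%:Z - a%:Z|)%R &
             forall m', reach a m' -> edge o m' n -> m' = m].
Proof.
move=> /reachP[h1 h2] ne.
have u m m' : edge o m n -> edge o m' n -> reach a m -> reach a m' -> m = m'.
  move=> e e' /reachP[r1 r2] /reachP[r1' r2']; move: e e'; rewrite /edge.
  move=> /orP[/andP[/eqP e om]|/andP[/eqP e on]] /orP[/andP[/eqP e' om']|/andP[/eqP e' on']]; try lia.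
    case: (leqP a m) => h.
      by have := r1' n; rewrite (negPf on'); lia.
    by have := r2 m; rewrite om; lia.
  case: (leqP a m') => h.
    by have := r1 n; rewrite (negPf on); lia.
  by have := r2' m'; rewrite om'; lia.
have [lt|gt] : (a < n)%N \/ (n < a)%N by lia.
  have e : edge o n.-1 n by rewrite /edge h1 ?andbT; lia.
  have r : reach a n.-1 by apply/reachP; split=> i hi; [apply: h1|]; lia.
  by exists n.-1; split=> // [|m' r' e']; [lia | exact: u].
have e : edge o n.+1 n by rewrite /edge h2 ?eqxx ?orbT; lia.
have r : reach a n.+1 by apply/reachP; split=> i hi; [|apply: h2]; lia.
by exists n.+1; split=> // [|m' r' e']; [lia | exact: u].
Qed.

Lemma reach_no_return a m : reach a m -> ~ edge o m a.
Proof.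
move=> /reachP[h1 h2] /orP[/andP[/eqP e om]|/andP[/eqP e oa]].
  by have := h2 m; rewrite om; lia.
by have := h1 a; rewrite (negPf oa); lia.
Qed.

Lemma qpath_reach (a x : Q) (rho : qpath a x) : reach (pos a) (pos x).
Proof.
elim: rho => [|x0 y rho IH al]; first exact: reach_refl.
exact: reach_edge IH (arrow_edge C al).
Qed.

Lemma reach_qpath (a x : Q) : reach (pos a) (pos x) -> inhabited (qpath a x).
Proof.
have [N] := ubnP (absz ((pos x)%:Z - (pos a)%:Z)); elim: N x => // N IH x lt r.
have [e|/eqP ne] := eqVneq (pos a) (pos x).
  have -> : x = a by rewrite -(posK C x) -e posK.
  by constructor; exact: pnil.
have [m [rm em hm _]] := reach_pred r ne.
have [||rho] := IH (vtx m); rewrite ?vtxK //; first by lia.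
have [al] : inhabited (arrow (vtx m) x) by apply: (edge_arrow (c := C)); rewrite vtxK.
by constructor; exact: pcons rho al.
Qed.

Lemma qpath_inv (a y : Q) (rho : qpath a y) :
  (exists e : a = y, rho = eq_rect a (qpath a) pnil y e) \/
  (exists x (rho' : qpath a x) (al : arrow x y), rho = pcons rho' al).
Proof.
case: rho => [|x z rho al]; first by left; exists erefl.
by right; exists x, rho, al.
Qed.

(** A nontrivial path cannot return to its start, the vertex before its end is forced, and parallel
    arrows are equal. *)
Lemma qpath_eq (a x : Q) (rho sigma : qpath a x) : rho = sigma.
Proof.
elim: rho sigma => [|x0 y rho IH al] sigma.
  have [[e ->]|[z [s [al _]]]] := qpath_inv sigma.
    by rewrite (Prop_irrelevance e erefl).
  by case: (reach_no_return (qpath_reach s) (arrow_edge C al)).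
have [[e _]|[z [s [be ->]]]] := qpath_inv sigma.
  by subst y; case: (reach_no_return (qpath_reach rho) (arrow_edge C al)).
have ez : z = x0.
  rewrite -(posK C z) -(posK C x0); congr vtx.
  have ry := reach_edge (qpath_reach rho) (arrow_edge C al).
  have [e|/eqP ne] := eqVneq (pos a) (pos y).
    by case: (reach_no_return (qpath_reach rho) (_ : edge o (pos x0) (pos a))); rewrite e; exact: arrow_edge.
  have [m [_ _ _ u]] := reach_pred ry ne.
  by rewrite (u _ (qpath_reach s) (arrow_edge C be)) (u _ (qpath_reach rho) (arrow_edge C al)).
by subst z; rewrite (IH s) (arrow_eq C al be).
Qed.
End Presentations.

(** * Finite presentations *)

Section DirectSums.
Variables (k : fieldType) (Q : quiver).
Implicit Types M N X : rep k Q.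

Program Definition rpair X M N (f : rhom X M) (g : rhom X N) : rhom X (dsum M N) :=
  @RHom k Q X (dsum M N) (fun x u => (f x u, g x u)) _ _.
Next Obligation. by move=> X M N f g x a u v; rewrite !rhomL. Qed.
Next Obligation. by move=> X M N f g x y al v /=; rewrite /dsum_map !rapp_natural. Qed.

Program Definition rcopair X M N (f : rhom M X) (g : rhom N X) : rhom (dsum M N) X :=
  @RHom k Q (dsum M N) X (fun x u => f x u.1 + g x u.2) _ _.
Next Obligation.
by move=> X M N f g x a u v; rewrite !rhomL scalerDr addrACA.
Qed.
Next Obligation.
by move=> X M N f g x y al v /=; rewrite !rapp_natural linearD.
Qed.

Program Definition rfst M N : rhom (dsum M N) M :=
  @RHom k Q (dsum M N) M (fun x u => u.1) _ _.
Next Obligation. by []. Qed.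
Next Obligation. by []. Qed.

Program Definition rsnd M N : rhom (dsum M N) N :=
  @RHom k Q (dsum M N) N (fun x u => u.2) _ _.
Next Obligation. by []. Qed.
Next Obligation. by []. Qed.

Lemma P_sum_cat (s t : seq Q) :
  exists e : rhom (P_sum k (s ++ t)) (dsum (P_sum k s) (P_sum k t)),
    (forall x, injective (e x)) /\ (forall x v, exists u, e x u = v).
Proof.
elim: s => [|a s [e [ei es]]] /=.
  exists (rpair 0 (rid _)); split=> [x u v [] //|x [u v]].
  by exists v; congr pair; apply/rowP => -[].
exists (rpair (rpair (rfst _ _) (rcomp (rfst _ _) (rcomp e (rsnd _ _))))
              (rcomp (rsnd _ _) (rcomp e (rsnd _ _)))); split=> x.
  move=> [u u'] [v v'] /= [-> e1 e2]; congr pair; apply: ei.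
  by rewrite [LHS]surjective_pairing [RHS]surjective_pairing e1 e2.
move=> [[u v] w]; have [z ez] := es x (v, w).
by exists (u, z); rewrite /= ez.
Qed.

(** Projectivity, tested against the vertexwise surjections that occur in [rep_short_exact]. *)
Definition lifting (P : rep k Q) : Prop :=
  forall N L (g : rhom N L) (h : rhom P L), (forall x w, exists v, g x v = w) ->
  exists h' : rhom P N, forall x v, g x (h' x v) = h x v.

Lemma lifting_dsum M N : lifting M -> lifting N -> lifting (dsum M N).
Proof.
move=> lM lN X L g h gs.
have [h1 e1] := lM _ _ g (rcomp h (rpair (rid _) 0)) gs.
have [h2 e2] := lN _ _ g (rcomp h (rpair 0 (rid _))) gs.
exists (rcopair h1 h2) => x [u v] /=; rewrite rhomD e1 e2 /= -rhomD.
by congr (h x); congr pair; rewrite /= ?addr0 ?add0r.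
Qed.

Lemma lifting_iso M N : @isom k (Rep_cat k Q) M N -> lifting M -> lifting N.
Proof.
move=> [f [f' [ff' f'f]]] lM X L g h gs.
have [h1 e1] := lM _ _ g (rcomp h f) gs.
exists (rcomp h1 f') => x v /=; rewrite e1 /=.
by have := congr1 (fun r : rhom N N => r x v) f'f => /= ->.
Qed.

(** The horseshoe lemma. *)
Lemma fp_extension M A L (i : rhom A M) (p : rhom M L) :
  (forall s, lifting (P_sum k s)) ->
  rep_short_exact i p -> finitely_presented A -> finitely_presented L ->
  finitely_presented M.
Proof.
move=> lP ip [a1 [a0 [fA [gA xA]]]] [c1 [c0 [fC [gC xC]]]].
have [gh ghE] : exists gh : rhom (P_sum k c0) M, forall x v, p x (gh x v) = gC x v.
  by apply: lP => x w; have [_ _ /(_ w)] := ip x.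
(* With this sign the triangular matrix of [fA], [th] and [fC] composes to zero with the map onto
   [M]. The correction is found first as a map into [A], natural because [i] is injective, and then
   lifted along [gA]. *)
have [th thE] : exists th : rhom (P_sum k c1) (P_sum k a0),
    forall x w, i x (gA x (th x w)) = - gh x (fC x w).
  have [y yE] : {y : forall x, P_sum k c1 x -> A x &
      forall x w, i x (y x w) = - gh x (fC x w)}.
    apply: (@dep_choice _ _ (fun x (y : P_sum k c1 x -> A x) =>
      forall w, i x (y w) = - gh x (fC x w))) => x.
    have h w : exists a, i x a = - gh x (fC x w).
      have [_ /(_ (- gh x (fC x w)))[h _] _] := ip x; apply: h.
      rewrite rhomN ghE; have [_ /(_ (fC x w))[_ h] _] := xC x.
      by rewrite h ?oppr0 //; exists w.
    by have [y yE] := choice h; exists y.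
  have ii x : injective (i x) by have [] := ip x.
  have yl x : linear (y x).
    by move=> a u v; apply: ii; rewrite rhomL !yE !rhomL scalerN opprD.
  have yn (x z : Q) (al : arrow x z) v : y z (rmap (P_sum k c1) al v) = rmap A al (y x v).
    by apply: ii; rewrite rapp_natural !yE !rapp_natural linearN.
  have [th thE] : exists th : rhom (P_sum k c1) (P_sum k a0),
      forall x v, gA x (th x v) = RHom yl yn x v.
    by apply: lP => x w; have [_ _ /(_ w)] := xA x.
  by exists th => x w; rewrite thE /= yE.
have [e1 [e1i e1s]] := P_sum_cat a1 c1.
have [e0 [e0i e0s]] := P_sum_cat a0 c0.
have [e0' [e0K e0'K]] := bijective_rhom_inv e0i e0s.
exists (a1 ++ c1), (a0 ++ c0),
  (rcomp e0' (rcomp (rpair (rcopair fA th) (rcomp fC (rsnd _ _))) e1)),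
  (rcomp (rcopair (rcomp i gA) gh) e0) => x; split=> /=.
- have e0'i : injective (e0' x) by exact: can_inj (e0'K x).
  move=> u v /e0'i [] /= e e2; apply: e1i.
  have [fCi _ _] := xC x; have {}e2 := fCi _ _ e2.
  move: e; rewrite e2 => /addIr e; have [fAi _ _] := xA x; have {}e := fAi _ _ e.
  by rewrite [LHS]surjective_pairing [RHS]surjective_pairing e e2.
- have [_ xi _] := ip x; have [_ xa _] := xA x; have [_ xc _] := xC x.
  have [ii _ _] := ip x.
  move=> v; have [[a c] ev] : exists w, w = e0 x v by exists (e0 x v).
  rewrite -ev /=; split=> [h|[w]].
    have pc : gC x c = 0.
      have pia : p x (i x (gA x a)) = 0 by apply/xi; exists (gA x a).
      by rewrite -ghE -[LHS]add0r -{1}pia -rhomD h rhom0.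
    have [w ew] := iffLR (xc c) pc.
    have ga : gA x (a - th x w) = 0.
      by apply: ii; rewrite rhomB rhomB thE ew opprK h rhom0.
    have [u eu] := iffLR (xa _) ga; have [z ez] := e1s x (u, w).
    exists z; rewrite ez /= eu subrK ew.
    by rewrite ev e0K.
  move=> ew; move: ev; rewrite -ew e0'K => -[-> ->].
  rewrite rhomD rhomD thE (iffRL (xa _)) ?rhom0 ?add0r ?addNr //.
  by exists (e1 x w).1.
- move=> m; have [_ xi _] := ip x; have [_ _ sA] := xA x; have [_ _ sC] := xC x.
  have [c ec] := sC (p x m).
  have [a ea] : exists a, i x a = m - gh x c.
    by apply/xi; rewrite rhomB ghE ec subrr.
  have [a' ea'] := sA a; have [v ev] := e0s x (a', c).
  by exists v; rewrite ev /= ea' ea subrK.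
Qed.

End DirectSums.

(** Only the scalar is rewritten; rewriting [b] itself would also touch the types of the vectors in
    ['rV_b]. *)
Lemma natr_true (R : pzSemiRingType) (b : bool) : b -> b%:R = 1 :> R.
Proof. by move=> ->. Qed.

Lemma natr_false (R : pzSemiRingType) (b : bool) : ~~ b -> b%:R = 0 :> R.
Proof. by move=> /negPf ->. Qed.

(** * Projectives as thin modules, and finite presentations of intervals *)

Section FpThin.
Variables (k : fieldType) (Q : quiver) (o : nat -> bool) (C : coords Q o).
Notation pos := (pos C).
Notation vtx := (vtx C).
Notation Thin := (@Thin k Q o C).
Notation riso := (@isom k (Rep_cat k Q)).

Lemma path_family (M : rep k Q) (a : Q) (F : forall x, qpath a x -> M x) :
  exists v : forall x, M x, (forall x rho, v x = F x rho) /\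
    (forall x, ~~ reach o (pos a) (pos x) -> v x = 0).
Proof.
have [v vP] : {v : forall x, M x & forall x, (forall rho, v x = F x rho) /\
    (~~ reach o (pos a) (pos x) -> v x = 0)}.
  apply: (@dep_choice _ _ (fun x (w : M x) => (forall rho, w = F x rho) /\
    (~~ reach o (pos a) (pos x) -> w = 0))) => x.
  case: (orP (orbN (reach o (pos a) (pos x)))) => [r|nr].
    have [rho] := reach_qpath r; exists (F x rho); split; last by rewrite r.
    by move=> sigma; rewrite (qpath_eq C rho sigma).
  by exists 0; split=> // rho; rewrite (qpath_reach C rho) in nr.
by exists v; split=> x; have [] := vP x.
Qed.

Fixpoint path_act (M : rep k Q) (a x : Q) (rho : qpath a x) (m : M a) : M x :=
  match rho with pnil => m | pcons _ _ rho' al => rmap M al (path_act rho' m) end.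

Lemma path_act_rhom (M N : rep k Q) (f : rhom M N) (a x : Q) (rho : qpath a x) (m : M a) :
  f x (path_act rho m) = path_act rho (f a m).
Proof. by elim: rho => //= y z rho IH al; rewrite rapp_natural IH. Qed.

Lemma path_act_one (a x : Q) (rho : qpath a x) :
  path_act (M := Thin (reach o (pos a))) rho (one k _) = one k _.
Proof.
elim: rho => //= y z rho ->; rewrite /tmap coef_one (qpath_reach C rho).
by rewrite scale1r.
Qed.

Lemma malg_subsingleton (K : choiceType) (x : K) (g : {malg k[K]}) :
  (forall y : K, y = x) -> g = g@_x *: << x >>.
Proof.
move=> Kx; apply/malgP => y; rewrite mcoeffZ mcoeffU (Kx y) eqxx.
by rewrite mulr1.
Qed.

Lemma P_thin (a : Q) : riso (Thin (reach o (pos a))) (P_ k a).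
Proof.
have [v [vE v0]] := @path_family (P_ k a) a (fun x rho => << rho >>).
have vn (x y : Q) (al : arrow x y) : reach o (pos a) (pos x) ->
    rmap (P_ k a) al (v x) = v y.
  move=> r; have [rho] := reach_qpath r.
  rewrite (vE x rho) (vE y (pcons rho al)) /= /lin_ext msuppU oner_eq0 big_seq_fset1.
  by rewrite mcoeffUU scale1r.
apply: (bijective_rhom_iso (f := from_thin v0 vn)) => x.
  move=> u w /= e; apply: rV_eq.
  case: (orP (orbN (reach o (pos a) (pos x)))) => [r|nr]; last by rewrite (coef0 u nr) (coef0 w nr).
  have [rho] := reach_qpath r; move: e; rewrite (vE x rho) => /(congr1 (mcoeff rho)).
  by rewrite !mcoeffZ mcoeffUU !mulr1.
move=> g /=; case: (orP (orbN (reach o (pos a) (pos x)))) => [r|nr].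
  have [rho] := reach_qpath r; exists (g@_rho *: one k _).
  rewrite coefZ coef_one r mulr1 (vE x rho); apply/esym/malg_subsingleton => s.
  exact: (qpath_eq C).
exists 0; rewrite coefE0 scale0r; apply/malgP => rho.
by rewrite (qpath_reach C rho) in nr.
Qed.

(** The Yoneda argument: a map out of the projective at [a] is determined by the image of the
    generator at [a], and a preimage of that, carried along all paths, gives the lift. *)
Lemma lifting_reach (a : Q) : lifting (Thin (reach o (pos a))).
Proof.
move=> N L g h gs; have [n en] := gs a (h a (one k _)).
have [v [vE v0]] := @path_family N a (fun x rho => path_act rho n).
have vn (x y : Q) (al : arrow x y) : reach o (pos a) (pos x) -> rmap N al (v x) = v y.
  move=> r; have [rho] := reach_qpath r.
  by rewrite (vE x rho) (vE y (pcons rho al)).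
exists (from_thin v0 vn) => x u /=; rewrite rhomZ.
case: (orP (orbN (reach o (pos a) (pos x)))) => [r|nr]; last first.
  by rewrite (coef0 (u : 'rV_(reach o (pos a) (pos x))) nr) coefE0 scale0r rhom0.
have [rho] := reach_qpath r.
rewrite (vE x rho) path_act_rhom en -path_act_rhom path_act_one -rhomZ.
by rewrite -coefK.
Qed.

Lemma lifting_P_sum (s : seq Q) : lifting (P_sum k s).
Proof.
elim: s => [|a s IH] /=.
  move=> N L g h gs; exists 0 => x v; rewrite rhom0.
  have -> : v = 0 by apply/rowP => -[].
  by rewrite rhom0.
by apply: lifting_dsum => //; exact: (lifting_iso (P_thin a) (@lifting_reach a)).
Qed.

Lemma fp_iso (M N : rep k Q) : riso M N -> finitely_presented M -> finitely_presented N.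
Proof.
move=> [e [e' [e'e ee']]] [s1 [s0 [f [g x]]]].
exists s1, s0, f, (rcomp e g) => y; have [fi fx gs] := x y; split=> //= [v|w].
- split=> [h|/fx ->]; last exact: rhom0.
  apply/fx; have := congr1 (fun r : rhom M M => r y (g y v)) e'e => /= <-.
  by rewrite h rhom0.
- have [v ev] := gs (e' y w); exists v; rewrite ev.
  by have := congr1 (fun r : rhom N N => r y w) ee'.
Qed.

Lemma fp_P (a : Q) : finitely_presented (P_ k a).
Proof.
exists [::], [:: a], 0, (rfst _ _) => x; split=> /=.
- by move=> u v _; apply/rowP => -[].
- move=> [u v] /=; split=> [->|[w [-> _]]] //.
  by exists 0; congr pair; apply/rowP => -[].
- by move=> w; exists (w, 0).
Qed.

Lemma fp_rep0 (M : rep k Q) : (forall x (v : M x), v = 0) -> finitely_presented M.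
Proof.
move=> M0; exists [::], [::], 0, 0 => x; split=> /=.
- by move=> u v _; apply/rowP => -[].
- by move=> v; split=> // _; exists 0; apply/rowP => -[].
- by move=> w; exists 0; rewrite [w]M0.
Qed.

Section ThinMap.
Variables (b b' : nat -> bool).
Hypothesis bb' : forall m n, edge o m n -> b m -> b' n -> b' m = b n.

(** At an arrow from the support of the source into that of the target, the hypothesis makes both
    ways round the square nonzero or both zero; at other arrows both are zero. *)
Program Definition thin_map : rhom (Thin b) (Thin b') :=
  @RHom k Q (Thin b) (Thin b') (fun x => @tmap k (b (pos x)) (b' (pos x))) _ _.
Next Obligation. by move=> x; exact: linearP. Qed.
Next Obligation.
move=> x y al u /=; rewrite /tmap !coefZ !coef_one; apply: rV_eq; rewrite !coefZ !coef_one.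
case: (orP (orbN (b (pos x)))) => [bx|nbx]; last first.
  by rewrite (coef0 (u : 'rV_(b (pos x))) nbx) coefE0 !mul0r.
case: (orP (orbN (b' (pos y)))) => [b_y|/negPf ->]; last by rewrite !mulr0.
by rewrite (bb' (arrow_edge C al) bx b_y).
Qed.
End ThinMap.

Lemma tmap_tmap (b1 b2 b3 : bool) (u : 'rV[k]_b1) :
  tmap b3 (tmap b2 u) = b2%:R *: tmap b3 u.
Proof. by rewrite /tmap coefZ coef_one mulrC scalerA. Qed.

Section ThinExact.
Variables (b b1 : nat -> bool).
Hypothesis sub : forall n, b1 n -> b n.
Hypothesis cl : forall m n, edge o m n -> b1 m -> b n -> b1 n.

Lemma thin_sub_map m n : edge o m n -> b1 m -> b n -> b m = b1 n.
Proof. by move=> e m1 bn; rewrite sub // (cl e m1). Qed.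

Lemma thin_quo_map m n : edge o m n -> b m -> b n && ~~ b1 n -> b m && ~~ b1 m = b n.
Proof.
move=> e bm /andP[bn nb]; rewrite bm bn /=; apply/negP => m1.
by rewrite (cl e m1) in nb.
Qed.

(** By [cl] the set [b1] is closed under the arrows inside [b], so it supports a submodule and its
    complement the quotient. *)
Lemma thin_exact : rep_short_exact (thin_map thin_sub_map)
  (thin_map (b' := fun n => b n && ~~ b1 n) thin_quo_map).
Proof.
move=> x /=; split.
- move=> u v; case: (orP (orbN (b1 (pos x)))) => [n1|n1]; last by rewrite (coef0 u n1) (coef0 v n1).
  by move=> /(congr1 (@coef k _)); rewrite /tmap !coefZ !coef_one sub // !mulr1 => /rV_eq.
- move=> v; split=> [e|[u <-]]; last first.
    apply: rV_eq; rewrite tmap_tmap coefZ /tmap coefZ coef_one coefE0.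
    case: (orP (orbN (b1 (pos x)))) => [n1|n1]; first by rewrite (natr_false k (b := _ && _)) ?mulr0 // n1 andbF.
    by rewrite (coef0 u n1) coefE0 mul0r mulr0.
  exists (tmap _ v); rewrite tmap_tmap; apply: rV_eq.
  rewrite coefZ /tmap coefZ coef_one.
  case: (orP (orbN (b (pos x)))) => [n|n]; last by rewrite (coef0 v n) coefE0 mul0r mulr0.
  case: (orP (orbN (b1 (pos x)))) => [n1|n1]; first by rewrite (natr_true k n1) (natr_true k n) mul1r mulr1.
  move: e => /(congr1 (@coef k _)); rewrite /tmap coefZ coef_one coefE0 (natr_true k (b := _ && _)) ?n ?n1 // mulr1 => ->.
  by rewrite mul0r mulr0.
- move=> w; exists (tmap _ w); apply: rV_eq; rewrite tmap_tmap coefZ /tmap coefZ coef_one.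
  case: (orP (orbN (b (pos x) && ~~ b1 (pos x)))) => [n|n]; last by rewrite (coef0 w n) coefE0 mul0r mulr0.
  by rewrite (natr_true k n); case/andP: n => h _; rewrite (natr_true k h) mul1r mulr1.
Qed.

Lemma fp_thin_ext :
  finitely_presented (Thin b1) -> finitely_presented (Thin (fun n => b n && ~~ b1 n)) ->
  finitely_presented (Thin b).
Proof. exact: fp_extension lifting_P_sum thin_exact. Qed.

End ThinExact.

Definition thin_proj (b : nat -> bool) : Prop := exists s, exists e : rhom (P_sum k s) (Thin b),
  (forall x, injective (e x)) /\ (forall x v, exists u, e x u = v).

Lemma thin_proj_reach (a : nat) : thin_proj (reach o a).
Proof.
have [f [fi fs]] := riso_map (isom_sym (P_thin (vtx a))); rewrite vtxK in f fi fs.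
exists [:: vtx a], (rcomp f (rfst _ _)); split=> x /=.
  move=> [u u'] [v v'] /= /fi ->; congr pair.
  by apply/rowP => -[].
by move=> v; have [u eu] := fs x v; exists (u, 0).
Qed.

Lemma thin_proj0 (b : nat -> bool) : (forall n, ~~ b n) -> thin_proj b.
Proof.
move=> b0; exists [::], 0; split=> x.
  by move=> u v _; apply/rowP => -[].
by move=> v; exists 0; rewrite [RHS](coef0 _ (b0 _)).
Qed.

Lemma thin_proj_union (b b' : nat -> bool) : (forall n, b n -> ~~ b' n) ->
  (forall m n, edge o m n -> b m -> ~~ b' n) -> (forall m n, edge o m n -> b' m -> ~~ b n) ->
  thin_proj b -> thin_proj b' -> thin_proj (fun n => b n || b' n).
Proof.
move=> dj e1 e2 [s [f [fi fs]]] [t [g [gi gs]]].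
have h1 m n : edge o m n -> b m -> b n || b' n -> b m || b' m = b n.
  by move=> e bm; rewrite (negPf (e1 m n e bm)) orbF bm.
have h2 m n : edge o m n -> b' m -> b n || b' n -> b m || b' m = b' n.
  by move=> e bm; rewrite (negPf (e2 m n e bm)) /= bm orbT.
have [e [ei es]] := P_sum_cat k s t.
exists (s ++ t), (rcomp (rcopair (rcomp (thin_map (b' := fun n => b n || b' n) h1) f)
                    (rcomp (thin_map (b' := fun n => b n || b' n) h2) g)) e).
split=> x.
  move=> u v /= h; apply: ei; rewrite [LHS]surjective_pairing [RHS]surjective_pairing.
  move: h => /(congr1 (@coef k _)); rewrite !coefD /tmap !coefZ !coef_one.
  case: (orP (orbN (b (pos x)))) => [n|n].
    rewrite !(coef0 (g x _) (dj _ n)) coefE0 !mul0r !addr0 (natr_true k (b := _ || _)) ?n // !mulr1.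
    move=> /rV_eq/fi ->; congr pair; apply: gi; rewrite !(coef0 (g x _) (dj _ n)) //.
  rewrite !(coef0 (f x _) n) coefE0 !mul0r !add0r.
  case: (orP (orbN (b' (pos x)))) => [n'|n'].
    rewrite (natr_true k (b := _ || _)) ?n' ?orbT // !mulr1.
    move=> /rV_eq/gi ->; congr pair; apply: fi; rewrite !(coef0 (f x _) n) //.
  by move=> _; congr pair; [apply: fi; rewrite !(coef0 (f x _) n)|apply: gi; rewrite !(coef0 (g x _) n')].
move=> v; have [u eu] := fs x (tmap _ v); have [w ew] := gs x (tmap _ v).
have [z ez] := es x (u, w); exists z; rewrite /= ez /= eu ew; apply: rV_eq.
have E (c d f0 : bool) (w0 : 'rV[k]_f0) :
    coef (c%:R *: tmap f0 w0 + d%:R *: tmap f0 w0) = (c%:R + d%:R) * (coef w0 * f0%:R).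
  by rewrite coefD !coefZ !coef_one -mulrDl.
rewrite !tmap_tmap; apply: (etrans (E _ _ _ _)).
case: (orP (orbN (b (pos x)))) => [n|n].
  rewrite (natr_true k n) (natr_false k (dj _ n)) addr0 mul1r.
  by rewrite (natr_true k (b := _ || _)) ?n ?mulr1.
case: (orP (orbN (b' (pos x)))) => [n'|n'].
  rewrite (natr_false k n) (natr_true k n') add0r mul1r.
  by rewrite (natr_true k (b := _ || _)) ?n' ?orbT ?mulr1.
by rewrite [v]coef0 ?coefE0 ?mul0r ?mulr0 // negb_or n.
Qed.

(** The radical of [Thin (reach n)] has at most two indecomposable summands,
    which are projective and start at the successors of [n]. *)
Lemma fp_simple (n : nat) : finitely_presented (Thin (fun m => m == n)).
Proof.
(* The branches of [reach o n] on either side of [n]: each is empty or is the support of the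
   projective at a neighbour, and no arrow runs between them. *)
pose up m := o n && reach o n.+1 m.
pose dn m := if n is p.+1 then ~~ o p && reach o p m else false.
have upE m : up m = (n < m)%N && reach o n m.
  apply/idP/idP.
    move=> /andP[on /reachP[r1 r2]]; have nm : (n < m)%N.
      by rewrite ltnNge; apply/negP => h; have := r2 n; rewrite on; lia.
    rewrite nm; apply/reachP; split=> i hi; last by lia.
    by have [->//|ne] := eqVneq i n; apply: r1; lia.
  move=> /andP[nm /reachP[r1 r2]]; rewrite /up r1 /=; last by lia.
  by apply/reachP; split=> i hi; [apply: r1|]; lia.
have dnE m : dn m = (m < n)%N && reach o n m.
  rewrite /dn; case: n {up upE dn} => [|p] //; apply/idP/idP.
    move=> /andP[on /reachP[r1 r2]]; have nm : (m < p.+1)%N.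
      by rewrite ltnNge; apply/negP => h; have := r1 p; rewrite (negPf on); lia.
    rewrite nm; apply/reachP; split=> i hi; first by lia.
    by have [->//|ne] := eqVneq i p; apply: r2; lia.
  move=> /andP[nm /reachP[r1 r2]]; rewrite r2 /=; last by lia.
  by apply/reachP; split=> i hi; [|apply: r2]; lia.
have pup : thin_proj up.
  rewrite /up; case: (o n); first exact: thin_proj_reach.
  by apply: thin_proj0.
have pdn : thin_proj dn.
  rewrite /dn; case: (n) => [|p]; first by apply: thin_proj0.
  by case: (o p); [apply: thin_proj0|exact: thin_proj_reach].
have [s [e [ei es]]] : thin_proj (fun m => up m || dn m).
  by apply: thin_proj_union => // m; [|move=> m'; rewrite /edge..]; rewrite upE dnE; lia.
have [t [f [fi fs]]] := thin_proj_reach n.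
have sub m : up m || dn m -> reach o n m by rewrite upE dnE; lia.
have cl m m' : edge o m m' -> up m || dn m -> reach o n m' -> up m' || dn m'.
  rewrite !upE !dnE => E h r'; rewrite r' !andbT; case: (ltngtP n m') => // em.
  case: (reach_no_return (o := o) (a := n) (m := m)); last by rewrite em.
  by move: h; lia.
have -> : (fun m => m == n) = (fun m => reach o n m && ~~ (up m || dn m)).
  apply: funext => m /=; rewrite upE dnE.
  by case: (ltngtP m n) => [_|_|->] /=; [case: (reach o n m)|case: (reach o n m)|rewrite reach_refl].
have [f' [fK f'K]] := bijective_rhom_inv fi fs.
have X := thin_exact sub cl.
exists s, t, (rcomp f' (rcomp (thin_map (thin_sub_map sub cl)) e)), (rcomp (thin_map (thin_quo_map cl)) f).
move=> x; have [Xi Xe Xs] := X x; split=> /=.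
- by move=> u v /(congr1 (f x)); rewrite !f'K => /Xi/ei.
- move=> v; split=> [/Xe[u eu]|[u <-]].
    by have [w ew] := es x u; exists w; rewrite ew; exact: etrans (congr1 (f' x) eu) (fK x v).
  by apply/Xe; rewrite f'K; exists (e x u).
- by move=> w; have [v ev] := Xs w; have [u eu] := fs x v; exists u; rewrite eu.
Qed.

(** Peel off the left end: if the edge after [i] points right, the rest is a submodule with simple
    quotient, otherwise the simple module is the submodule. Finite presentation passes to
    extensions. *)
Lemma fp_interval (i j : nat) : finitely_presented (Thin (fun n => i <= n <= j)%N).
Proof.
have [N] := ubnP (j.+1 - i)%N; elim: N i => // N IH i lt.
have [ij|ji] := leqP i j; last first.
  by apply: fp_rep0 => x v; rewrite [v]coef0 //=; lia.
have e : (fun n => (i.+1 <= n <= j)%N) = (fun n => (i <= n <= j)%N && ~~ (n == i)).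
  by apply: funext => n /=; lia.
have e' : (fun n => n == i) = (fun n => (i <= n <= j)%N && ~~ (i.+1 <= n <= j)%N).
  by apply: funext => n /=; lia.
have f1 : finitely_presented (Thin (fun n => (i.+1 <= n <= j)%N)) by apply: IH; lia.
have f2 := fp_simple i.
case: (boolP (o i)) => oi.
  apply: (@fp_thin_ext _ (fun n => i.+1 <= n <= j)%N) => [n|m n|//|]; first by lia.
    by rewrite /edge; have [->|ne] := eqVneq n i; lia.
  by rewrite -e'.
apply: (@fp_thin_ext _ (fun n => n == i)) => [n /=|m n|//|]; first by lia.
  by rewrite /edge /= => E /eqP em; subst m; rewrite (negPf oi) in E; lia.
by rewrite -e.
Qed.

Lemma fp_ray (N i : nat) : (forall n, (N <= n)%N -> o n) ->
  finitely_presented (Thin (fun n => i <= n)%N).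
Proof.
(* For [N < a] the edge before [a] points right too, so the projective at [a] does not spread to the
   left. *)
move=> hN; have big a : (N < a)%N -> finitely_presented (Thin (fun n => a <= n)%N).
  move=> Na; have -> : (fun n => a <= n)%N = reach o a.
    apply: funext => n; apply/idP/idP => [h|/reachP[_ h]].
      by apply/reachP; split=> m hm; [apply: hN|]; lia.
    by rewrite leqNgt; apply/negP => lt; have := h a.-1; rewrite hN; lia.
  by have := fp_iso (isom_sym (P_thin (vtx a))) (fp_P _); rewrite vtxK.
have [M] := ubnP (N.+1 - i)%N; elim: M i => // M IH i lt.
have [/big//|iN] := leqP N.+1 i.
have e : (fun n => (i.+1 <= n)%N) = (fun n => (i <= n)%N && ~~ (n == i)).
  by apply: funext => n /=; lia.
have e' : (fun n => n == i) = (fun n => (i <= n)%N && ~~ (i.+1 <= n)%N).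
  by apply: funext => n /=; lia.
have f1 : finitely_presented (Thin (fun n => (i.+1 <= n)%N)) by apply: IH; lia.
have f2 := fp_simple i.
case: (boolP (o i)) => oi.
  apply: (@fp_thin_ext _ (fun n => i.+1 <= n)%N) => [n|m n|//|]; first by lia.
    by rewrite /edge; have [->|ne] := eqVneq n i; lia.
  by rewrite -e'.
apply: (@fp_thin_ext _ (fun n => n == i)) => [n /=|m n|//|]; first by lia.
  by rewrite /edge /= => E /eqP em; subst m; rewrite (negPf oi) in E; lia.
by rewrite -e.
Qed.

End FpThin.

(** * Morphisms between interval modules *)

Section IntervalModules.
Variables (k : fieldType) (Q : quiver) (o : nat -> bool) (C : coords Q o) (ev : bool).
Notation pos := (pos C).
Notation vtx := (vtx C).
Notation hom_rel := (hom_rel o ev).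
Notation inI := (inI ev).
Notation below := (below ev).
Notation lle := (lle o).
Notation rle := (rle o).
Notation edge := (edge o).

Definition interval (p : code) : rep k Q := Thin k C (inI p).

Lemma below_leq m n j : (m <= n)%N -> below n j -> below m j.
Proof. by case: j => [j|] //=; exact: leq_trans. Qed.

Lemma below_up n j j' : o n -> below n j -> below n.+1 j' -> rle j j' -> below n.+1 j.
Proof.
case: j j' => [j|] [j'|] //= on nj nj'; rewrite [(n < _)%N]ltn_neqAle nj andbT.
  by move=> /rleP h; apply/eqP => e; move: h; rewrite -e; lia.
by move=> oj; apply/eqP => e; rewrite -e on in oj.
Qed.

Lemma below_down n j j' :
  ~~ o n -> below n.+1 j -> below n j' -> rle j j' -> below n.+1 j'.
Proof.
case: j j' => [j|] [j'|] //= on nj nj'; rewrite [(n < _)%N]ltn_neqAle nj' andbT.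
  by move=> /rleP h; apply/eqP => e; move: h; rewrite -e; lia.
by move=> oj; apply/eqP => e; rewrite e oj in on.
Qed.

Lemma lle_up n i l : o n -> (i <= n)%N -> (l <= n.+1)%N -> lle i l -> (l <= n)%N.
Proof.
by move=> on hi; have [->|ne] := eqVneq l n.+1; [move=> _ /lleP /=; lia | lia].
Qed.

Lemma lle_down n i l : ~~ o n -> (i <= n.+1)%N -> (l <= n)%N -> lle i l -> (i <= n)%N.
Proof.
by move=> on; have [->|ne] := eqVneq i n.+1; [move=> _ hl /lleP /=; lia | lia].
Qed.

Lemma hom_rel_map p q : hom_rel p q ->
  forall m n, edge m n -> inI p m -> inI q n -> inI q m = inI p n.
Proof.
move: p q => [i j] [l j'] /and4P[/= il jj' _ _] m n.
rewrite /inI /= => e /andP[im mj] /andP[ln nj].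
case/orP: e => /andP[/eqP e on]; subst.
  rewrite (lle_up on im ln il) (below_up on mj nj jj') (below_leq _ nj) ?andbT //=.
  by rewrite (leq_trans im).
rewrite (lle_down on im ln il) (below_down on mj nj jj') (below_leq _ mj) //= ?andbT.
by rewrite (leq_trans ln).
Qed.

Definition can_hom (p q : code) : rhom (interval p) (interval q) :=
  if pselect (hom_rel p q) is left h then thin_map k C (hom_rel_map h) else 0.

Definition hcoef p q (f : rhom (interval p) (interval q)) (n : nat) : k :=
  coef (f (vtx n) (one k _)).

Lemma hcoef_eq p q (f g : rhom (interval p) (interval q)) :
  (forall n, hcoef f n = hcoef g n) -> f = g.
Proof.
move=> fg; apply: rhomP => x v; rewrite -(posK C x) in v *.
have -> : v = coef (v : 'rV_(inI p (pos (vtx (pos x))))) *: one k _ by exact: coefK.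
by rewrite !rhomZ; congr (_ *: _); apply: rV_eq; exact: fg.
Qed.

Lemma hcoef_out p q (f : rhom (interval p) (interval q)) n :
  ~~ (inI p n && inI q n) -> hcoef f n = 0.
Proof.
rewrite negb_and /hcoef; case/orP => h.
  by rewrite [one k _]coef0 ?vtxK // rhom0 coefE0.
by rewrite [f _ _](@coef0 k (inI q (pos (vtx n)))) ?coefE0 // vtxK.
Qed.

Lemma hcoef_edge p q (f : rhom (interval p) (interval q)) m n : edge m n ->
  (inI p m)%:R * hcoef f n = (inI q n)%:R * hcoef f m.
Proof.
move=> e; have [al] : inhabited (arrow (vtx m) (vtx n)).
  by apply: (edge_arrow (c := C)); rewrite !vtxK.
have := rapp_natural f al (one k _) => /= /(congr1 (@coef k _)).
rewrite /tmap coef_one rhomZ !coefZ coef_one -/(hcoef f n) -/(hcoef f m) !vtxK.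
by rewrite [X in _ = X -> _]mulrC.
Qed.

Lemma hcoef_can p q n : hom_rel p q -> hcoef (can_hom p q) n = (inI p n && inI q n)%:R.
Proof.
move=> h; rewrite /can_hom; case: pselect => // h'; rewrite /hcoef /=.
by rewrite coefZ !coef_one vtxK -natrM mulnb.
Qed.

Lemma hcoefZ p q a (f : rhom (interval p) (interval q)) n : hcoef (a *: f) n = a * hcoef f n.
Proof. by rewrite /hcoef /= coefZ. Qed.

Lemma hcoef_comp p q r (g : rhom (interval q) (interval r)) (f : rhom (interval p) (interval q)) n :
  hcoef (rcomp g f) n = hcoef f n * hcoef g n.
Proof.
rewrite /hcoef /=; have E := coefK (f (vtx n) (one k _)).
by rewrite [X in g _ X]E rhomZ coefZ.
Qed.

Lemma hcoef_const p q (f : rhom (interval p) (interval q)) m n :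
  inI p m -> inI q m -> inI p n -> inI q n -> hcoef f m = hcoef f n.
Proof.
wlog mn : m n / (m <= n)%N => [H pm qm pn qn|].
  by case: (leqP m n) => h; [exact: H | apply/esym/H => //; exact: ltnW].
elim: n mn => [|n IH] mn; first by have -> : m = 0%N by lia.
move=> pm qm pn qn; have [->//|ne] := eqVneq m n.+1.
have mn' : (m <= n)%N by lia.
have pn' : inI p n by move: pm pn => /andP[a _] /andP[_ b]; rewrite /inI (leq_trans a mn') (below_leq _ b).
have qn' : inI q n by move: qm qn => /andP[a _] /andP[_ b]; rewrite /inI (leq_trans a mn') (below_leq _ b).
rewrite IH //; case on : (o n).
  have := @hcoef_edge _ _ f n n.+1; rewrite /edge eqxx on /= => /(_ isT).
  by rewrite pn' qn !mul1r.
have := @hcoef_edge _ _ f n.+1 n; rewrite /edge eqxx on orbT /= => /(_ isT).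
by rewrite pn qn' !mul1r.
Qed.

(** The coefficient is constant on the overlap, hence nonzero all over it. Naturality at an edge
    where one support stops and the other goes on would make it vanish unless the edge points the
    right way; at the two ends this gives [lle] and [rle]. *)
Lemma hcoef_hom_rel p q (f : rhom (interval p) (interval q)) n : hcoef f n != 0 -> hom_rel p q.
Proof.
move=> fn0; have : inI p n && inI q n by apply: contraNT fn0 => /hcoef_out ->.
move=> /andP[pn qn].
have nz m : inI p m -> inI q m -> hcoef f m <> 0.
  by move=> pm qm; rewrite (hcoef_const f pm qm pn qn); exact/eqP.
have cond m m' : edge m m' -> inI p m -> inI q m' -> inI q m = inI p m'.
  move=> e pm qm'; have := hcoef_edge f e; rewrite pm qm' !mul1r => E.
  apply/idP/idP => h; apply/negPn/negP => nh.
    by apply: (nz m) => //; rewrite -E hcoef_out // (negPf nh).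
  by apply: (nz m') => //; rewrite E hcoef_out // (negPf nh) andbF.
move: p q cond pn qn {f fn0 nz} => [i j] [l j'] cond /andP[/= iN nj] /andP[/= ln nj'].
rewrite hom_relE !(below_leq _ nj) ?(below_leq _ nj') //= !andbT.
have up m : o m -> edge m m.+1 by rewrite /edge eqxx => ->.
have dn m : ~~ o m -> edge m.+1 m by rewrite /edge eqxx orbC => ->.
have jlt (j0 : nat) : j = Some j0 -> below j0.+1 j' -> ~~ o j0.
  move=> e h; apply/negP => /up E; move: nj; rewrite e /= => nj.
  have h1 : (i <= j0)%N && below j0 j by rewrite e /= leqnn (leq_trans iN nj).
  have lj := leq_trans ln nj.
  have h2 : (l <= j0.+1)%N && below j0.+1 j' by rewrite h (leq_trans lj).
  by have := cond _ _ E h1 h2; rewrite /inI /= e /= ltnn andbF lj (below_leq _ h).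
have jgt (j0 : nat) : j' = Some j0 -> below j0.+1 j -> o j0.
  move=> e h; apply/negPn/negP => /dn E; move: nj'; rewrite e /= => nj'.
  have h2 : (l <= j0)%N && below j0 j' by rewrite e /= leqnn (leq_trans ln nj').
  have ij := leq_trans iN nj'.
  have h1 : (i <= j0.+1)%N && below j0.+1 j by rewrite h (leq_trans ij).
  by have := cond _ _ E h1 h2; rewrite /inI /= e /= ltnn andbF ij (below_leq _ h).
have ilt : (i < l)%N -> ~~ o l.-1.
  case: l ln cond {jlt jgt} => //= l ln cond il; apply/negP => /up E.
  have h1 : (i <= l)%N && below l j by rewrite (below_leq (ltnW ln) nj) andbT.
  have h2 : (l < l.+1)%N && below l.+1 j' by rewrite ltnSn (below_leq ln nj').
  by have := cond _ _ E h1 h2; rewrite /inI /= ltnn (below_leq ln nj) (ltnW il).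
have igt : (l < i)%N -> o i.-1.
  case: i iN cond {jlt jgt ilt} => //= i iN cond li; apply/negPn/negP => /dn E.
  have h1 : (i < i.+1)%N && below i.+1 j by rewrite ltnSn (below_leq iN nj).
  have h2 : (l <= i)%N && below i j' by rewrite (below_leq (ltnW iN) nj') andbT.
  by have := cond _ _ E h1 h2; rewrite /inI /= ltnn (below_leq iN nj') (ltnW li).
apply/andP; split.
  by apply/lleP; case: (ltngtP i l) => h; [right; left|right; right|left]; rewrite ?ilt ?igt.
case: j j' nj nj' jlt jgt {cond} => [j|] [j'|] nj nj' jlt jgt //=.
- by apply/rleP; case: (ltngtP j j') => h; [right; left|right; right|left] => //; split => //; [exact: jlt|exact: jgt].
- exact: jlt.
- exact: jgt.
Qed.

Lemma hcoef0 p q n : hcoef (0 : rhom (interval p) (interval q)) n = 0.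
Proof. exact: coefE0. Qed.

Lemma can_span p q (f : rhom (interval p) (interval q)) : exists a, f = a *: can_hom p q.
Proof.
have [[n fn]|f0] := pselect (exists n, hcoef f n != 0); last first.
  exists 0; apply: hcoef_eq => n; rewrite scale0r hcoef0.
  by apply/eqP/negPn/negP => h; apply: f0; exists n.
have h := hcoef_hom_rel fn; exists (hcoef f n); apply: hcoef_eq => m.
rewrite hcoefZ hcoef_can //; case: (boolP (inI p m && inI q m)) => hm; last first.
  by rewrite hcoef_out ?mulr0.
have : inI p n && inI q n by apply: contraNT fn => /hcoef_out ->.
move: hm => /andP[pm qm] /andP[pn qn].
by rewrite mulr1; exact: hcoef_const.
Qed.

Lemma can_eq0 p q : can_hom p q = 0 <-> ~~ hom_rel p q.
Proof.
split=> [c0|/negP nh]; last by rewrite /can_hom; case: pselect.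
apply/negP => h; have := hcoef_can (maxn p.1 q.1) h; rewrite c0 hcoef0.
by have /and4P[_ _ -> ->] := h; move/eqP; rewrite eq_sym oner_eq0.
Qed.

Lemma can_comp p q r : hom_rel p q -> hom_rel q r -> rcomp (can_hom q r) (can_hom p q) = can_hom p r.
Proof.
move=> pq qr; have [a e] := can_span (rcomp (can_hom q r) (can_hom p q)); rewrite e.
case: (boolP (hom_rel p r)) => pr; last by rewrite (iffRL (can_eq0 p r)) // scaler0.
(* Three pairwise meeting intervals share the largest of their left ends, where the scalar can be
   read off. *)
have [n [pn qn rn]] : exists n, [/\ inI p n, inI q n & inI r n].
  move: p q r pq qr pr {e} => [i1 j1] [i2 j2] [i3 j3]; rewrite !hom_relE.
  move=> /and5P[_ _ h11 h21 /andP[h12 h22]] /and5P[_ _ _ h32 /andP[h23 h33]].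
  move=> /and5P[_ _ _ h31 /andP[h13 _]].
  exists (maxn i1 (maxn i2 i3)); rewrite /inI /= !leq_max !leqnn ?orbT /=.
  have bm i l j : below i j -> below l j -> below (maxn i l) j.
    by case: j => [j|] //=; rewrite geq_max => -> ->.
  by rewrite !bm.
have := congr1 (fun f => hcoef f n) e; rewrite /= hcoefZ hcoef_comp !hcoef_can //.
by rewrite pn qn rn !mulr1 => <-; rewrite scale1r.
Qed.

Lemma can_id p : can_hom p p = rid _.
Proof.
apply: hcoef_eq => n; have E : hcoef (rid (interval p)) n = (inI p n)%:R.
  by rewrite /hcoef /= coef_one vtxK.
rewrite E; case: (boolP (hom_rel p p)) => h; first by rewrite hcoef_can // andbb.
rewrite (iffRL (can_eq0 p p)) // hcoef0 (natr_false k) //.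
by apply: contraNN h => /andP[h1 h2]; rewrite hom_rel_refl (below_leq h1).
Qed.

End IntervalModules.

(** * Decomposition into intervals *)

Section Spans.
Variables (k : fieldType) (V : lmodType k).

Fixpoint in_span (s : seq V) (v : V) : Prop :=
  if s is a :: s' then exists c, in_span s' (v - c *: a) else v = 0.

Lemma in_span_lin s a u v : in_span s u -> in_span s v -> in_span s (a *: u + v).
Proof.
elim: s u v => [|b s IH] u v /= => [-> ->|[c hu] [d hv]]; first by rewrite scaler0 addr0.
exists (a * c + d); have := IH _ _ hu hv; congr in_span.
by rewrite scalerBr scalerDl opprD scalerA addrACA.
Qed.

Definition fin_span : Prop := exists s, forall v, in_span s v.

Definition subspace (A : V -> Prop) : Prop :=
  A 0 /\ forall a u v, A u -> A v -> A (a *: u + v).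

Lemma subspaceZ (A : V -> Prop) a u : subspace A -> A u -> A (a *: u).
Proof. by move=> [A0 Al] Au; rewrite -[_ *: _]addr0; exact: Al. Qed.

Lemma subspaceB (A : V -> Prop) u v : subspace A -> A u -> A v -> A (u - v).
Proof. by move=> [A0 Al] Au Av; rewrite addrC -scaleN1r; exact: Al. Qed.

Lemma subspaceD (A : V -> Prop) u v : subspace A -> A u -> A v -> A (u + v).
Proof. by move=> [A0 Al] Au Av; rewrite -[u]scale1r; exact: Al. Qed.

Definition functional (l : V -> k) : Prop := forall a u v, l (a *: u + v) = a * l u + l v.

Lemma functional0 l : functional l -> l 0 = 0.
Proof. by move=> ll; have := ll (-1) 0 0; rewrite scaler0 addr0 mulN1r addNr. Qed.

(** [G] is the graph of a functional on a subspace. *)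
Lemma extend_graph s (G : V -> k -> Prop) :
  G 0 0 -> (forall a u c v d, G u c -> G v d -> G (a *: u + v) (a * c + d)) ->
  (forall c, G 0 c -> c = 0) ->
  (forall v, exists w c, G w c /\ in_span s (v - w)) ->
  exists2 l, functional l & forall v c, G v c -> l v = c.
Proof.
elim: s G => [|b s IH] G G0 Gl Gs Gd.
  have tot v : exists c, G v c.
    by have [w [c [gw /eqP]]] := Gd v; rewrite subr_eq0 => /eqP ->; exists c.
  have uniq v c d : G v c -> G v d -> c = d.
    move=> gc gd; apply/esym/eqP; rewrite -subr_eq0; apply/eqP/Gs.
    by have := Gl (-1) _ _ _ _ gc gd; rewrite scaleN1r addNr mulN1r addrC.
  have [l lP] := choice tot; exists l => [a u v|v c gc]; last exact: uniq (lP v) gc.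
  exact: uniq (lP _) (Gl _ _ _ _ _ (lP u) (lP v)).
have [[cb gb]|nb] := pselect (exists c, G b c).
  apply: IH => // v; have [w [c [gw [d hd]]]] := Gd v.
  exists (d *: b + w), (d * cb + c); split; first exact: Gl.
  by rewrite opprD addrCA addrC.
pose G' v c := exists t, G (v - t *: b) c.
have [||||l ll lG] := IH G'.
- by exists 0; rewrite scale0r subr0.
- move=> a u c v d [t gt] [t' gt']; exists (a * t + t').
  have := Gl a _ _ _ _ gt gt'; congr G.
  by rewrite scalerBr scalerDl opprD scalerA addrACA.
- move=> c [t]; have [->|t0] := eqVneq t 0; first by rewrite scale0r subr0; exact: Gs.
  move=> gt; case: nb; exists (- t^-1 * c + 0).
  have := Gl (- t^-1) _ _ _ _ gt G0; rewrite add0r addr0 scalerN scaleNr opprK scalerA mulVf //.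
  by rewrite scale1r.
- move=> v; have [w [c [gw [d hd]]]] := Gd v.
  exists (w + d *: b), c; split; first by exists d; rewrite addrK.
  by rewrite opprD addrA.
exists l => // v c gc; apply: lG; exists 0; by rewrite scale0r subr0.
Qed.

End Spans.

Lemma in_span_map (k : fieldType) (V W : lmodType k) (f : V -> W) s v :
  linear f -> in_span s v -> in_span (map f s) (f v).
Proof.
move=> fl; elim: s v => [|a s IH] v /= => [->|[c h]].
  by have := fl (-1) 0 0; rewrite scaler0 addr0 scaleN1r addNr.
exists c; have := IH _ h; congr in_span.
by rewrite -scaleNr addrC fl scaleNr addrC.
Qed.

(** This makes the rank drop when an interval summand is split off. *)
Lemma in_span_kill (k : fieldType) (V W : lmodType k) (f : V -> W) s v :
  linear f -> in_span s v -> v <> 0 -> f v = 0 ->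
  exists2 s', (size s' < size s)%N & forall u, in_span s u -> in_span s' (f u).
Proof.
move=> fl; elim: s v => [|a s IH] v /= => [->|[c h] v0 fv] //.
have fD x y : f (x + y) = f x + f y by have := fl 1 x y; rewrite !scale1r.
have f0 : f 0 = 0 by have := fl (-1) 0 0; rewrite scaler0 addr0 scaleN1r addNr.
have fZ d x : f (d *: x) = d *: f x by have := fl d x 0; rewrite f0 !addr0.
have [c0|c0] := eqVneq c 0.
  move: h; rewrite c0 scale0r subr0 => h; have [s' lt hs] := IH _ h v0 fv.
  exists (f a :: s') => // u [d hd]; exists d.
  by have := hs _ hd; congr in_span; rewrite fD -scaleNr fZ scaleNr.
exists (map f s); rewrite ?size_map // => u [d hd].
(* As [f v = 0], subtracting d/c times [v] from [u] leaves the image unchanged and removes [a]. *)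
have <- : (- (d * c^-1)) *: f (v - c *: a) + f (u - d *: a) = f u.
  rewrite !fD fv add0r -!scaleNr !fZ scalerA mulrNN mulfVK // addrCA -scalerDl subrr.
  by rewrite scale0r addr0.
by apply: in_span_lin; apply: in_span_map.
Qed.

(** The functional is prescribed on A + f(W), as 0 on [A] and [m] on the image; this is consistent
    because [m] vanishes wherever [f] lands in [A]. *)
Lemma functional_extension (k : fieldType) (V W : lmodType k) (A : V -> Prop)
    (f : W -> V) (m : W -> k) :
  fin_span V -> subspace A -> linear f -> functional m ->
  (forall w, A (f w) -> m w = 0) ->
  exists l : V -> k, [/\ functional l, forall w, l (f w) = m w & forall a, A a -> l a = 0].
Proof.
move=> [s sV] sA fl ml mA; have [A0 Al] := sA.
have f0 : f 0 = 0 by have := fl (-1) 0 0; rewrite scaler0 addr0 scaleN1r addNr.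
pose G v c := exists a w, [/\ A a, v = a + f w & c = m w].
have [||||l ll lG] := @extend_graph _ _ s G.
- by exists 0, 0; rewrite f0 addr0 functional0.
- move=> a u c v d [x [w [Ax -> ->]]] [y [z [Ay -> ->]]].
  exists (a *: x + y), (a *: w + z); split; rewrite ?fl ?ml //; first exact: Al.
  by rewrite scalerDr addrACA.
- move=> c [a [w [Aa /esym/eqP]]]; rewrite addr_eq0 => /eqP e ->; apply: mA.
  by rewrite -[f w]opprK -e -scaleN1r; exact: subspaceZ.
- by move=> v; exists 0, 0; rewrite subr0; split=> //; exists 0, 0; rewrite f0 addr0 functional0.
exists l; split=> // [w|a Aa]; apply: lG; first by exists 0, w; rewrite add0r.
by exists a, 0; rewrite f0 addr0 functional0.
Qed.

Lemma functional_point (k : fieldType) (V : lmodType k) (A : V -> Prop) (v : V) :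
  fin_span V -> subspace A -> ~ A v ->
  exists l : V -> k, [/\ functional l, l v = 1 & forall a, A a -> l a = 0].
Proof.
move=> fV sA nv.
have [|a u w|c Ac|l [ll lf lA]] := @functional_extension k V k^o A (fun c => c *: v) (fun c => c) fV sA.
- by move=> a u w; rewrite scalerDl scalerA.
- by [].
- apply/eqP; apply: contraPT isT => c0; case: nv.
  by have := subspaceZ c^-1 sA Ac; rewrite scalerA mulVf // scale1r.
by exists l; split=> //; rewrite -[v]scale1r lf.
Qed.

Section Update.
Variables (I : Type) (T : I -> Type) (i : I) (t : T i) (f : forall j, T j).

Definition upd (j : I) : T j :=
  if pselect (i = j) is left e then eq_rect i T t j e else f j.

Lemma upd_same : upd i = t.
Proof. by rewrite /upd; case: pselect => // e; rewrite (Prop_irrelevance e erefl). Qed.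

Lemma upd_other j : i <> j -> upd j = f j.
Proof. by rewrite /upd; case: pselect. Qed.

End Update.

(** * Strands: candidates for interval summands *)

Section Strands.
Variables (k : fieldType) (Q : quiver) (o : nat -> bool) (C : coords Q o) (ev : bool).
Notation pos := (pos C).
Notation vtx := (vtx C).
Notation inI := (inI ev).
Notation below := (below ev).
Notation edge := (edge o).
Variable M : rep k Q.
Hypothesis fdM : forall y, fin_span (M y).

(** A family of vectors [v] and functionals [l] with [l y (v y) = 1] on an interval
    starting at [x], which define maps from and to the interval module except for
    the conditions on the arrows leaving or entering [x] from the left. *)
Definition strand (x : nat) (j : option nat) (v : forall y, M y) (l : forall y, M y -> k) : Prop :=
  [/\ forall y, ~~ inI (x, j) (pos y) -> v y = 0,
      forall y, inI (x, j) (pos y) -> l y (v y) = 1,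
      forall y, functional (l y),
      forall (y z : Q) (al : arrow y z), (x <= pos z)%N -> inI (x, j) (pos y) ->
        rmap M al (v y) = v z &
      forall (y z : Q) (al : arrow y z) u, (x <= pos y)%N -> inI (x, j) (pos z) ->
        l z (rmap M al u) = (inI (x, j) (pos y))%:R * l y u].

(** Quantifying over pairs A in U makes the induction from right to left possible: such a pair
    passes along an edge and records which vectors may be used and which ones the functional must
    kill. In the end A is 0 and U the image of an idempotent. *)
Definition has_strand (x : nat) : Prop :=
  forall A U : M (vtx x) -> Prop, subspace A -> subspace U ->
    (forall u, A u -> U u) -> (exists2 u, U u & ~ A u) ->
  exists j (v : forall y, M y) (l : forall y, M y -> k), [/\ below x j, U (v (vtx x)), forall a, A a -> l (vtx x) a = 0 &
    strand x j v l].

Lemma functional_zero (V : lmodType k) : functional (fun _ : V => 0).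
Proof. by move=> a u v; rewrite mulr0 addr0. Qed.

Lemma vtx_pos x y : pos y = x -> vtx x = y.
Proof. by move=> <-; rewrite posK. Qed.

(** If x -> x+1, either a vector outside [A] dies and the strand stops at x, or
    [A] and [U] are pushed forward; if x <- x+1, either a vector outside [A] is
    not hit and the strand stops at x, or [A] and [U] are pulled back. *)
Lemma has_strand_step x : has_strand x.+1 -> has_strand x.
Proof.
move=> IH A U sA sU AU [u0 Uu nAu].
pose X := vtx x; pose Y := vtx x.+1.
have nXY : X <> Y by move=> /(congr1 pos); rewrite !vtxK; lia.
have inIS j n : below x.+1 j -> inI (x, j) n = (n == x) || inI (x.+1, j) n.
  move=> xj; rewrite /inI /=; have [->|ne] := eqVneq n x.
    by rewrite leqnn (below_leq _ xj).
  by congr (_ && _); lia.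
have inI1 n : inI (x, Some x) n = (n == x) by rewrite /inI /= eq_sym eqn_leq.
have eX y z (al : arrow y z) : pos y = x -> (x <= pos z)%N -> o x /\ pos z = x.+1.
  by move=> e h; have := arrow_edge C al; rewrite /edge e; lia.
have eX' y z (al : arrow y z) : pos z = x -> (x <= pos y)%N -> ~~ o x /\ pos y = x.+1.
  by move=> e h; have := arrow_edge C al; rewrite /edge e; lia.
case: (boolP (o x)) => ox.
- have [al] : inhabited (arrow X Y).
    by apply: (edge_arrow (c := C)); rewrite !vtxK /edge eqxx ox.
  pose f := rmap M al.
  have fl : linear f by move=> a u v; rewrite /f linearP.
  have noin (y z : Q) (be : arrow y z) : (x <= pos y)%N -> pos z = x -> False.
    by move=> h e; have [] := eX' _ _ be e h; rewrite ox.
  have toY (y z : Q) (be : arrow y z) : pos y = x -> (x <= pos z)%N -> z = Y.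
    by move=> e h; have [_ h'] := eX _ _ be e h; rewrite -(vtx_pos h').
  have [[c [Uc fc nAc]]|nc] := pselect (exists c, [/\ U c, f c = 0 & ~ A c]).
    have [l [ll lc lA]] := functional_point (fdM X) sA nAc.
    exists (Some x), (upd (T := fun y => M y) c (fun _ => 0)), (upd (T := fun y => M y -> k) l (fun _ _ => 0)).
    rewrite !upd_same; split=> //; first exact: leqnn.
    split=> [y|y|y|y z be|y z be u]; rewrite ?inI1.
    + by move=> /eqP ne; rewrite upd_other // => e; case: ne; rewrite -e vtxK.
    + by move=> /eqP/vtx_pos e; subst y; rewrite !upd_same.
    + case: (pselect (X = y)) => [e|ne]; first by subst y; rewrite upd_same.
      by rewrite upd_other //; exact: functional_zero.
    + move=> h /eqP e; have ez := toY _ _ be e h; have ey := vtx_pos e; subst y z.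
      by rewrite upd_same upd_other // (arrow_eq C be al).
    + by move=> h /eqP e; case: (noin _ _ be h e).
  pose A' w := exists2 a, A a & w = f a.
  pose U' w := exists2 a, U a & w = f a.
  have sub' (B : M X -> Prop) : subspace B -> subspace (fun w => exists2 a, B a & w = f a).
    move=> [B0 Bl]; split; first by exists 0; rewrite // /f linear0.
    by move=> a _ _ [u Bu ->] [v Bv ->]; exists (a *: u + v); rewrite ?fl //; exact: Bl.
  have [||||j [v [l [xj [c Uc vc] lA [s1 s2 s3 s4 s5]]]]] := IH A' U' _ _ _ _.
  + exact: sub'.
  + exact: sub'.
  + by move=> w [a Aa ->]; exists a => //; exact: AU.
  (* If [f u0] came from [A], a difference would lie in [U], outside [A] and in the kernel of [f],
     which was excluded. *)
  + exists (f u0); first by exists u0.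
    move=> [a Aa e]; apply: nc; exists (u0 - a); split.
    * by apply: subspaceB => //; exact: AU.
    * by rewrite /f linearB /= -!/(f _) e subrr.
    * by move=> h; apply: nAu; rewrite -[u0](subrK a); exact: subspaceD.
  exists j, (upd (T := fun y => M y) c v), (upd (T := fun y => M y -> k) (l Y \o f) l).
  rewrite !upd_same; split=> //; first exact: below_leq xj.
    by move=> a Aa /=; apply: lA; exists a.
  have nx y : pos y <> x -> X <> y by move=> ne e; apply: ne; rewrite -e vtxK.
  have inY : inI (x.+1, j) (pos Y) by rewrite vtxK /inI /= ltnSn.
  split=> [y|y|y|y z be|y z be u]; rewrite ?inIS //.
  + by rewrite negb_or => /andP[/eqP/nx ne h]; rewrite upd_other // s1.
  + have [e _|/eqP ne] /= := eqVneq (pos y) x; last by rewrite !upd_other; [exact: s2|exact: nx|exact: nx].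
    by have ey := vtx_pos e; subst y; rewrite !upd_same /= -vc s2.
  + case: (pselect (X = y)) => [e|ne]; last by rewrite upd_other.
    by subst y; rewrite upd_same => a u w /=; rewrite fl s3.
  + move=> h; have [e _|/eqP ne] /= := eqVneq (pos y) x.
      have ez := toY _ _ be e h; have ey := vtx_pos e; subst y z.
      by rewrite upd_same upd_other // vc (arrow_eq C be al).
    move=> hy; rewrite upd_other; last exact: nx.
    have hz : pos z <> x.
      by move=> e; apply: (noin _ _ be) => //; move/andP: hy => [/= /ltnW].
    by rewrite upd_other ?s4 //; [lia | exact: nx].
  + move=> h; have [e|/eqP nz] /= := eqVneq (pos z) x; first by case: (noin _ _ be h e).
    move=> hz; rewrite upd_other; last exact: nx.
    have [e|/eqP ne] /= := eqVneq (pos y) x.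
      have ez := toY _ _ be e _; have ey := vtx_pos e; subst y.
      have {}ez : z = Y by apply: ez; move/andP: hz => [/= /ltnW].
      by subst z; rewrite upd_same mul1r /= (arrow_eq C be al).
    by rewrite upd_other ?s5 //; [lia | exact: nx].
- have [al] : inhabited (arrow Y X).
    by apply: (edge_arrow (c := C)); rewrite !vtxK /edge eqxx ox orbT.
  pose f := rmap M al.
  have fl : linear f by move=> a u v; rewrite /f linearP.
  have noout (y z : Q) (be : arrow y z) : (x <= pos z)%N -> pos y = x -> False.
    by move=> h e; have [] := eX _ _ be e h; rewrite (negPf ox).
  have fromY (y z : Q) (be : arrow y z) : pos z = x -> (x <= pos y)%N -> y = Y.
    by move=> e h; have [_ h'] := eX' _ _ be e h; rewrite -(vtx_pos h').
  pose A1 u := exists a w, A a /\ u = a + f w.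
  have A10 : A 0 by case: sA.
  have f0 : f 0 = 0 by rewrite /f linear0.
  have [[c Uc nAc]|nc] := pselect (exists2 c, U c & ~ A1 c).
    have sA1 : subspace A1.
      split; first by exists 0, 0; rewrite f0 addr0.
      move=> a _ _ [u [w [Au ->]]] [u' [w' [Au' ->]]].
      exists (a *: u + u'), (a *: w + w'); split; first by have [_] := sA; exact.
      by rewrite fl scalerDr addrACA.
    have [l [ll lc lA]] := functional_point (fdM X) sA1 nAc.
    exists (Some x), (upd (T := fun y => M y) c (fun _ => 0)), (upd (T := fun y => M y -> k) l (fun _ _ => 0)).
    rewrite !upd_same; split=> //; first exact: leqnn.
      by move=> a Aa; apply: lA; exists a, 0; rewrite f0 addr0.
    split=> [y|y|y|y z be|y z be u]; rewrite ?inI1.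
    + by move=> /eqP ne; rewrite upd_other // => e; case: ne; rewrite -e vtxK.
    + by move=> /eqP/vtx_pos e; subst y; rewrite !upd_same.
    + case: (pselect (X = y)) => [e|ne]; first by subst y; rewrite upd_same.
      by rewrite upd_other //; exact: functional_zero.
    + by move=> h /eqP e; case: (noout _ _ be h e).
    + move=> h /eqP e; have ey := fromY _ _ be e h; have ez := vtx_pos e; subst y z.
      rewrite upd_same vtxK eqn_leq ltnn /= mul0r; apply: lA; exists 0, u.
      by rewrite add0r (arrow_eq C be al).
  pose A' w := A (f w).
  pose U' w := U (f w).
  have sub' (B : M X -> Prop) : subspace B -> subspace (fun w => B (f w)).
    by move=> [B0 Bl]; split=> [|a u v Bu Bv]; rewrite ?f0 ?fl //; exact: Bl.
  have [||||j [v [l [xj Uv lA [s1 s2 s3 s4 s5]]]]] := IH A' U' _ _ _ _.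
  + exact: sub'.
  + exact: sub'.
  + by move=> w; exact: AU.
  + have [[a [w [Aa e]]]|n] := pselect (A1 u0); last by case: nc; exists u0.
    exists w.
      rewrite /U'; have -> : f w = u0 - a by rewrite e addrC addKr.
      by apply: subspaceB => //; exact: AU.
    by move=> h; apply: nAu; rewrite e; exact: subspaceD.
  have inY : inI (x.+1, j) (pos Y) by rewrite vtxK /inI /= ltnSn.
  (* The functional at [x] must induce the one at x+1 through [f] and kill [A]; the two demands
     agree because the latter functional kills the preimage of [A]. *)
  have [lX [lXl lXf lXA]] := functional_extension (fdM X) sA fl (s3 Y) lA.
  exists j, (upd (T := fun y => M y) (f (v Y)) v), (upd (T := fun y => M y -> k) lX l).
  rewrite !upd_same; split=> //; first exact: below_leq xj.
  have nx y : pos y <> x -> X <> y by move=> ne e; apply: ne; rewrite -e vtxK.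
  split=> [y|y|y|y z be|y z be u]; rewrite ?inIS //.
  + by rewrite negb_or => /andP[/eqP/nx ne h]; rewrite upd_other // s1.
  + have [e _|/eqP ne] /= := eqVneq (pos y) x; last by rewrite !upd_other; [exact: s2|exact: nx|exact: nx].
    by have ey := vtx_pos e; subst y; rewrite !upd_same /= lXf s2.
  + case: (pselect (X = y)) => [e|ne]; last by rewrite upd_other.
    by subst y; rewrite upd_same.
  + move=> h; have [e _|/eqP ne] /= := eqVneq (pos y) x; first by case: (noout _ _ be h e).
    move=> hy; rewrite upd_other; last exact: nx.
    have [e|/eqP nz] := eqVneq (pos z) x.
      have ez := vtx_pos e; subst z.
      have ey : y = Y by apply: (fromY _ _ be) => //; move/andP: hy => [/= /ltnW].
      by subst y; rewrite upd_same (arrow_eq C be al).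
    by rewrite upd_other ?s4 //; [lia | exact: nx].
  + move=> h; have [e _|/eqP nz] /= := eqVneq (pos z) x.
      have ez := vtx_pos e; have ey := fromY _ _ be e h; subst y z.
      rewrite upd_same upd_other // inY orbT mul1r.
      by rewrite (arrow_eq C be al) -/(f u) lXf.
    move=> hz; rewrite upd_other; last exact: nx.
    have [e|/eqP ne] /= := eqVneq (pos y) x.
      by case: (noout _ _ be) => //; move/andP: hz => [/= /ltnW].
    by rewrite upd_other ?s5 //; [lia | exact: nx].
Qed.

End Strands.

(** * Splitting idempotents of tame representations *)

Section Decomposition.
Variables (k : fieldType) (Q : quiver) (o : nat -> bool) (C : coords Q o) (ev : bool).
Notation pos := (pos C).
Notation vtx := (vtx C).
Notation inI := (inI ev).
Notation below := (below ev).
Notation edge := (edge o).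
Notation interval := (interval k C ev).
Hypothesis evT : ev -> exists N, forall n, (N <= n)%N -> o n.
Hypothesis evF : ~~ ev -> forall N, exists2 n, (N <= n)%N & ~~ o n.

(** From the vertex B on, M is either constant along arrows pointing to the right
    or zero beyond an arrow pointing to the left. *)
Definition stable_from (M : rep k Q) (B : nat) : Prop :=
  (forall (y z : Q) (al : arrow y z), (B <= pos y)%N -> pos z = (pos y).+1 ->
     injective (rmap M al) /\ forall w, exists u, rmap M al u = w) /\
  (forall n, (B <= n)%N -> ~~ o n -> forall y, (n < pos y)%N -> forall u : M y, u = 0).

Definition tame (M : rep k Q) : Prop :=
  (forall y, fin_span (M y)) /\ exists B, stable_from M B.

Section Tame.
Variable M : rep k Q.
Hypothesis tM : tame M.

Lemma path_act_bij (B x : nat) (z : Q) (rho : qpath (vtx x) z) : stable_from M B ->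
  (B <= x)%N -> (forall n, (x <= n)%N -> o n) -> (x <= pos z)%N ->
  injective (@path_act k Q M _ _ rho) /\ forall w, exists u, @path_act k Q M _ _ rho u = w.
Proof.
move=> [st _] Bx ox; elim: rho => [|y z' rho IH al] xz /=.
  by split=> [u v //|w]; exists w.
have e := arrow_edge C al; have := qpath_reach C rho; rewrite vtxK => /reachP[r1 r2].
have xy : (x <= pos y)%N.
  rewrite leqNgt; apply/negP => lt; have := r2 (pos y).
  by move: e; rewrite /edge; case/orP => /andP[/eqP e oy]; [rewrite oy|]; lia.
have pz : pos z' = (pos y).+1.
  by case/orP: e => /andP[/eqP e oz] //; rewrite ox in oz; lia.
have [ai as_] := st _ _ al (leq_trans Bx xy) pz; have [IHi IHs] := IH xy.
split=> [u v /ai /IHi //|w]; have [u <-] := as_ w; have [t <-] := IHs u.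
by exists t.
Qed.

(** Transport along the ray is bijective, so a vector and a functional at [x] propagate to all later
    vertices and the strand never ends. *)
Lemma has_strand_ray (B x : nat) : stable_from M B -> ev ->
  (B <= x)%N -> (forall n, (x <= n)%N -> o n) -> has_strand C ev M x.
Proof.
move=> st hev Bx ox A U sA sU AU [c Uc nAc].
have [fdM _] := tM; have [l0 [l0l l0c l0A]] := functional_point (fdM _) sA nAc.
have rx z : (x <= pos z)%N -> reach o (pos (vtx x)) (pos z).
  by move=> h; rewrite vtxK; apply/reachP; split=> i hi; [apply: ox|]; lia.
have inx n : inI (x, None) n = (x <= n)%N by rewrite /inI /= hev andbT.
have [v [vE v0]] := @path_family k Q o C M (vtx x) (fun z rho => path_act rho c).
have [l lP] : {l : forall z, M z -> k & forall z, functional (l z) /\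
    ((x <= pos z)%N -> forall (rho : qpath (vtx x) z) u, l z (path_act rho u) = l0 u)}.
  apply: (@dep_choice _ _ (fun z (l : M z -> k) => functional l /\
    ((x <= pos z)%N -> forall (rho : qpath (vtx x) z) u, l (path_act rho u) = l0 u))) => z.
  have [xz|xz] := leqP x (pos z); last first.
    by exists (fun _ => 0); split; [exact: functional_zero|].
  have [rho] := reach_qpath (rx _ xz); have [bi bs] := path_act_bij rho st Bx ox xz.
  have [g gK] := choice bs; exists (fun u => l0 (g u)).
  have pl : linear (@path_act k Q M _ _ rho).
    elim: (rho) => [|y z' r IH al] a u w //=; by rewrite IH linearP.
  split=> [a u w|_ s u]; first by rewrite -l0l; congr l0; apply: bi; rewrite pl !gK.
  by congr l0; apply: bi; rewrite gK (qpath_eq C s rho).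
exists None, (fun z => if (x <= pos z)%N then v z else 0), l.
have vx : v (vtx x) = c by rewrite (vE _ pnil).
split=> //.
- by rewrite vtxK leqnn vx.
- by move=> a Aa; rewrite -(l0A _ Aa); have [_ /(_ _ pnil a)] := lP (vtx x); apply; rewrite vtxK.
split=> [y|y|y|y z be h|y z be u h]; rewrite ?inx.
- by move=> /negPf ->.
- move=> h; rewrite h; have [rho] := reach_qpath (rx _ h).
  by have [_ /(_ h rho) E] := lP y; rewrite (vE _ rho) E.
- by have [] := lP y.
- move=> h'; rewrite h' h; have [rho] := reach_qpath (rx _ h').
  by rewrite (vE _ rho) (vE _ (pcons rho be)).
- move=> hz; rewrite h mul1r; have [rho] := reach_qpath (rx _ h).
  have [_ bs] := path_act_bij rho st Bx ox h; have [t <-] := bs u.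
  have [_ /(_ h rho t) ->] := lP y.
  by have [_ /(_ hz (pcons rho be) t)] := lP z.
Qed.

(** If all far arrows point right, the tail of [M] is determined by its first vertex; otherwise the
    tail is zero and strands there exist vacuously. *)
Lemma tame_bound : exists R, (forall x, (R < x)%N -> has_strand C ev M x) /\
  forall e : rhom M M, (forall y, (pos y <= R)%N -> forall u, e y u = 0) -> e = 0.
Proof.
have [fdM [B st]] := tM; case: (orP (orbN ev)) => hev.
  have [N oN] := evT hev; exists (maxn N B); split=> [x h|e e0].
    by refine (has_strand_ray st hev _ _); [|move=> n hn; apply: oN]; lia.
  apply: rhomP => y u; have [/e0 //|lt] := leqP (pos y) (maxn N B).
  have [|rho] := @reach_qpath Q o C (vtx (maxn N B)) y.
    by rewrite vtxK; apply/reachP; split=> i hi; [apply: oN|]; lia.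
  have on n : (maxn N B <= n)%N -> o n by move=> hn; apply: oN; lia.
  have [_ bs] := path_act_bij rho st (leq_maxr N B) on (ltnW lt).
  have [t <-] := bs u; rewrite path_act_rhom e0 ?vtxK //.
  exact: esym (path_act_rhom (0 : rhom M M) rho t).
have [n Bn on] := evF hev B; exists n; split=> [x h|e e0].
  move=> A U [A0 _] _ _ [c _]; case.
  by rewrite (st.2 n Bn on (vtx x) _ c) // vtxK.
apply: rhomP => y u; have [/e0 //|lt] := leqP (pos y) n.
by rewrite (st.2 n Bn on y lt u) !rhom0.
Qed.

Lemma tame_has_strand x : has_strand C ev M x.
Proof.
have [fdM _] := tM; have [R [hR _]] := tame_bound.
have [n] := ubnP (R.+1 - x)%N; elim: n x => // n IH x lt.
have [/hR //|xR] := ltnP R x.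
by apply: has_strand_step => //; apply: IH; lia.
Qed.

(** At the leftmost vertex of the image of [e] a strand has no condition to
    satisfy on its left, so that it splits off. *)
Lemma split_interval (e : rhom M M) : rcomp e e = e -> e <> 0 ->
  exists p (h : rhom (interval p) M) (l : rhom M (interval p)),
    [/\ below p.1 p.2, forall y, (pos y < p.1)%N -> forall u, e y u = 0,
        rcomp l h = rid _, rcomp e h = h & rcomp l e = l].
Proof.
move=> ee ne; have eK y u : e y (e y u) = e y u.
  by have := congr1 (fun f : rhom M M => f y u) ee.
have [a [ea amin]] : exists a, (exists u, e (vtx a) u <> 0) /\
    forall y, (pos y < a)%N -> forall u, e y u = 0.
  pose P n := `[< exists u, e (vtx n) u <> 0 >].
  have exP : exists n, P n.
    apply: contrapT => nP; apply: ne; apply: rhomP => y u; apply: contrapT => eu.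
    by apply: nP; exists (pos y); apply/asboolP; rewrite posK; exists u.
  have [a /asboolP Pa amin] := ex_minnP exP; exists a; split=> // y lt u.
  apply: contrapT => eu; have : P (pos y) by apply/asboolP; rewrite posK; exists u.
  by move=> /amin; lia.
(* With the image of [e] as [U], the starting vector is fixed by [e], so that composing with [e]
   keeps the pairing at [a] equal to 1. *)
pose A (u : M (vtx a)) := u = 0; pose U (u : M (vtx a)) := e (vtx a) u = u.
have [||||j [v [l [aj Uv lA [s1 s2 s3 s4 s5]]]]] := @tame_has_strand a A U _ _ _ _.
- by split=> // b u w -> ->; rewrite /A scaler0 addr0.
- by split=> [|b u w]; rewrite /U ?rhom0 // rhomL => -> ->.
- by move=> u ->; exact: rhom0.
- by have [u eu] := ea; exists (e _ u); [exact: eK | exact: eu].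
have inE n : inI (a, j) n -> (a <= n)%N by case/andP.
have h0 y : ~~ inI (a, j) (pos y) -> e y (v y) = 0 by move=> /s1 ->; exact: rhom0.
have hn (y z : Q) (al : arrow y z) : inI (a, j) (pos y) -> rmap M al (e y (v y)) = e z (v z).
  move=> iy; rewrite -rapp_natural; have [az|za] := leqP a (pos z); first by rewrite s4.
  by rewrite !amin.
have ll y b u w : l y (e y (b *: u + w)) = b * l y (e y u) + l y (e y w).
  by rewrite rhomL s3.
have ln (y z : Q) (al : arrow y z) u : inI (a, j) (pos z) ->
    l z (e z (rmap M al u)) = (inI (a, j) (pos y))%:R * l y (e y u).
  move=> iz; rewrite rapp_natural; have [ay|ya] := leqP a (pos y); first by rewrite s5.
  by rewrite (amin y) // linear0 !(functional0 (s3 _)) mulr0.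
pose h := from_thin h0 hn; pose lam := to_thin (C := C) (l := fun y u => l y (e y u)) ll ln.
have ha : inI (a, j) a by rewrite /inI /= leqnn.
have eh : rcomp e h = h by apply: rhomP => y u /=; rewrite rhomZ eK.
exists (a, j), h, lam; split=> //; last by apply: rhomP => y u /=; rewrite eK.
have [t et] := can_span (rcomp lam h); rewrite et can_id.
have := congr1 (fun f => hcoef f a) et; rewrite hcoefZ hcoef_can ?hom_rel_refl // ha mulr1 => <-.
suff -> : hcoef (rcomp lam h) a = 1 by rewrite scale1r.
rewrite /hcoef /= coef_one rhomZ !eK coefZ coef_one.
have ia : inI (a, j) (pos (vtx a)) by rewrite vtxK.
rewrite (natr_true k ia) scale1r mulr1 Uv; exact: s2.
Qed.

(** Besides the sum over intervals, the image [K] is recorded as finitely presented: the complement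
    of a summand has to stay in [repp]. *)
Definition splits (e : rhom M M) : Prop :=
  exists (K : rep k Q) (i : rhom K M) (p : rhom M K)
    (s : seq {p : code & (rhom (interval p) M * rhom M (interval p))%type}),
  [/\ finitely_presented K, rcomp p i = rid K, rcomp i p = e &
      e = \sum_(x <- s) rcomp (tagged x).1 (tagged x).2].

Lemma fp_interval_code (p : code) : finitely_presented (interval p).
Proof.
case: p => i [j|]; first exact: fp_interval.
have [hev|nev] := orP (orbN ev).
  have [N oN] := evT hev; have := @fp_ray k Q o C N i oN.
  rewrite /interval; congr (finitely_presented (Thin _ _ _)).
  by apply: funext => n; rewrite /inI /= hev andbT.
by apply: fp_rep0 => x v; rewrite [v]coef0 // /inI /= (negPf nev) andbF.
Qed.

Lemma fp_dsum (X Y : rep k Q) :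
  finitely_presented X -> finitely_presented Y -> finitely_presented (dsum X Y).
Proof.
move=> fX fY; apply: (@fp_extension k Q _ _ _ (rpair (rid X) 0) (rsnd X Y)) => //.
  exact: lifting_P_sum C.
move=> x; split=> /=.
- by move=> u v [].
- by move=> [u v] /=; split=> [->|[w [_ <-]]] //; exists u.
- by move=> w; exists (0, w).
Qed.

(** Induction on the total length of lists spanning the image of [e] at the vertices up to [R].
    Removing an interval summand kills a vector at its left end, which is at most [R] because [e]
    would otherwise vanish up to [R]. *)
Lemma tame_splits (e : rhom M M) : rcomp e e = e -> splits e.
Proof.
have [fdM _] := tM; have [R [_ bR]] := tame_bound.
have [s0 s0P] : {s : forall y, seq (M y) & forall y u, in_span (s y) u}.
  by apply: (@dep_choice _ _ (fun y (s : seq (M y)) => forall u, in_span s u)) => y; exact: fdM.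
have : forall y u, in_span (s0 y) (e y u) by move=> y u.
have [N] := ubnP (\sum_(n < R.+1) size (s0 (vtx n))).
elim: N e s0 {s0P} => // N IH e s lt es ee.
have [->|/eqP ne] := eqVneq e 0.
  exists (rep0 k Q), 0, 0, [::]; split.
  - by apply: fp_rep0 => x v; apply/rowP => -[].
  - by apply: rhomP => x v; apply/rowP => -[].
  - by apply: rhomP.
  - by rewrite big_nil.
have [p [h [l [vp amin lh eh le]]]] := split_interval ee ne.
pose e' := e - rcomp h l.
have lhE y u : l y (h y u) = u by have := congr1 (fun f : rhom _ _ => f y u) lh.
have ehE y u : e y (h y u) = h y u by have := congr1 (fun f : rhom _ _ => f y u) eh.
have leE y u : l y (e y u) = l y u by have := congr1 (fun f : rhom _ _ => f y u) le.
have eeE y u : e y (e y u) = e y u by have := congr1 (fun f : rhom _ _ => f y u) ee.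
have e'E y u : e' y u = e y u - h y (l y u) by [].
have ee' : rcomp e' e' = e'.
  apply: rhomP => y u; change (e' y (e' y u) = e' y u).
  by rewrite !e'E !rhomB eeE ehE leE lhE subrr subr0.
have e'e y u : e' y (e y u) = e' y u by rewrite !e'E eeE leE.
have e'h y u : e' y (h y u) = 0 by rewrite e'E ehE lhE subrr.
have le' y u : l y (e' y u) = 0 by rewrite e'E rhomB leE lhE subrr.
pose Y := vtx p.1; pose v := h Y (one k _).
have v0 : v <> 0.
  move=> v0; have := lhE Y (one k _); rewrite -/v v0 rhom0 => /(congr1 (@coef k _)).
  rewrite coefE0 coef_one natr_true; first by move/eqP; rewrite eq_sym oner_eq0.
  by rewrite vtxK /inI leqnn.
have pR : (p.1 <= R)%N.
  by rewrite leqNgt; apply/negP => lt'; apply: ne; apply: bR => y yR u; apply: amin; lia.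
have [s' s'P] : {s' : forall y, seq (M y) & forall y,
    [/\ (size (s' y) <= size (s y))%N, y = Y -> (size (s' y) < size (s y))%N &
        forall u, in_span (s' y) (e' y u)]}.
  apply: (@dep_choice _ _ (fun y (s' : seq (M y)) => [/\ (size s' <= size (s y))%N,
     y = Y -> (size s' < size (s y))%N & forall u, in_span s' (e' y u)])) => y.
  have el : linear (e' y) by move=> b u w; exact: rhomL.
  have [ey|ney] := pselect (y = Y).
    subst y; have vs : in_span (s Y) v by rewrite -[v]ehE; exact: es.
    have [s' lt' hs'] := in_span_kill el vs v0 (e'h _ _).
    by exists s'; split=> // [|u]; [exact: ltnW | rewrite -e'e; apply: hs'; exact: es].
  exists (map (e' y) (s y)); rewrite size_map; split=> // u.
  by rewrite -e'e; apply: in_span_map => //; exact: es.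
have [|||K [i [pr [t [fK pi ip et]]]]] := IH e' s' _ _ _.
- have pR' : (p.1 < R.+1)%N by [].
  have lt' : (\sum_(n < R.+1) size (s' (vtx n)) < \sum_(n < R.+1) size (s (vtx n)))%N.
    rewrite (bigD1 (Ordinal pR')) //= [X in (_ < X)%N](bigD1 (Ordinal pR')) //=.
    rewrite -addSn; apply: leq_add; first by have [_ -> ] := s'P (vtx p.1).
    by apply: leq_sum => n _; have [] := s'P (vtx n).
  by lia.
- by move=> y u; have [_ _] := s'P y.
- exact: ee'.
have piE y u : pr y (i y u) = u by have := congr1 (fun f : rhom _ _ => f y u) pi.
have ipE y u : i y (pr y u) = e' y u by have := congr1 (fun f : rhom _ _ => f y u) ip.
have li y u : l y (i y u) = 0 by rewrite -(piE y u) ipE le'.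
have ph y u : pr y (h y u) = 0 by rewrite -(piE y (pr y _)) ipE e'h rhom0.
exists (dsum (interval p) K), (rcopair h i), (rpair l pr), (Tagged _ (h, l) :: t); split.
- by apply: fp_dsum => //; exact: fp_interval_code.
- by apply: rhomP => y [u w] /=; rewrite !rhomD lhE li ph piE addr0 add0r.
- by apply: rhomP => y u /=; rewrite ipE e'E addrC subrK.
- by rewrite big_cons /= -et /e' addrC subrK.
Qed.

End Tame.
End Decomposition.

Section FinSpan.
Variables (k : fieldType) (V W : lmodType k).

Lemma fin_span_surj (f : V -> W) :
  linear f -> (forall w, exists v, f v = w) -> fin_span V -> fin_span W.
Proof.
move=> fl fs [s sV]; exists (map f s) => w; have [v <-] := fs w.
exact: in_span_map.
Qed.

Lemma fin_span_prod : fin_span V -> fin_span W -> fin_span (V * W)%type.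
Proof.
move=> [s sV] [t tW]; exists (map (fun v => (v, 0)) s ++ map (pair 0) t) => -[v w].
move: (sV v) => {sV}; elim: s v => [|a s IH] v /= => [->|[c h]]; last first.
  by exists c; have := IH _ h; congr in_span; congr pair; rewrite /= ?scaler0 ?subr0.
move: (tW w) => {tW}; elim: t w => [|a t IH] w /= => [->|[c h]] //.
by exists c; have := IH _ h; congr in_span; congr pair; rewrite /= ?scaler0 ?subr0.
Qed.

End FinSpan.

(** * Finitely presented representations are tame *)

Section FpTame.
Variables (k : fieldType) (Q : quiver) (o : nat -> bool) (C : coords Q o).
Notation pos := (pos C).
Notation vtx := (vtx C).
Notation edge := (edge o).
Notation riso := (@isom k (Rep_cat k Q)).
Notation stable_from := (stable_from C).
Implicit Types M N : rep k Q.

Lemma stable_leq M B B' : (B <= B')%N -> stable_from M B -> stable_from M B'.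
Proof.
move=> BB [s1 s2]; split=> [y z al h|n h]; first by apply: s1; exact: leq_trans h.
by apply: s2; exact: leq_trans h.
Qed.

Lemma tame_iso M N : riso M N -> tame C M -> tame C N.
Proof.
move=> /riso_map[f [fi fs]] [fdM [B [s1 s2]]]; split.
  by move=> y; apply: fin_span_surj (fs y) (fdM y) => a u v; rewrite rhomL.
exists B; split=> [y z al h e|n h on y lt u].
  have [ai as_] := s1 _ _ al h e; split.
    move=> u v; have [u' <-] := fs y u; have [v' <-] := fs y v.
    by rewrite -!rapp_natural => /fi/ai ->.
  move=> w; have [w' <-] := fs z w; have [u <-] := as_ w'.
  by exists (f y u); rewrite rapp_natural.
by have [u' <-] := fs y u; rewrite (s2 n h on y lt u') rhom0.
Qed.

Lemma tame_thin_reach (a : nat) : tame C (Thin k C (reach o a)).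
Proof.
split.
  by move=> y; exists [:: one k _] => v; exists (coef v); rewrite /= [X in X - _]coefK subrr.
exists a; split=> [y z al h e|n h on y lt u]; last first.
  apply: coef0; apply/negP => /reachP[r _]; have := r n; rewrite (negPf on); lia.
have oy : o (pos y) by have := arrow_edge C al; rewrite /edge e; lia.
have ryz : reach o a (pos z) = reach o a (pos y).
  apply/idP/idP => [/reachP[r1 r2]|r]; last exact: reach_edge r (arrow_edge C al).
  by apply/reachP; split=> i hi; [apply: r1|]; lia.
split=> /=.
  move=> u v /(congr1 (@coef k _)); rewrite /tmap !coefZ coef_one.
  have [r|nr] := orP (orbN (reach o a (pos y))); last by rewrite (coef0 u nr) (coef0 v nr).
  by rewrite natr_true ?ryz // !mulr1 => /rV_eq.
move=> w; exists (tmap _ w); rewrite tmap_tmap; apply: rV_eq.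
rewrite coefZ /tmap coefZ coef_one.
have [r|nr] := orP (orbN (reach o a (pos z))); last by rewrite (coef0 w nr) coefE0 mul0r mulr0.
by rewrite (natr_true k r) natr_true -?ryz // mul1r mulr1.
Qed.

Lemma tame_dsum M N : tame C M -> tame C N -> tame C (dsum M N).
Proof.
move=> [fM [B sM]] [fN [B' sN]]; split; first by move=> y; exact: fin_span_prod.
exists (maxn B B').
have [s1 s2] := stable_leq (leq_maxl B B') sM.
have [t1 t2] := stable_leq (leq_maxr B B') sN.
split=> [y z al h e|n h on y lt [u v]]; last first.
  by rewrite (s2 n h on y lt u) (t2 n h on y lt v).
have [i1 j1] := s1 _ _ al h e; have [i2 j2] := t1 _ _ al h e; split=> /=.
  by move=> [u u'] [v v'] [/i1 -> /i2 ->].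
move=> [w w']; have [u <-] := j1 w; have [u' <-] := j2 w'.
by exists (u, u').
Qed.

Lemma tame_P_sum (s : seq Q) : tame C (P_sum k s).
Proof.
elim: s => [|a s IH] /=.
  split; first by move=> y; exists [::] => v; apply/rowP => -[].
  exists 0%N; split=> [y z al _ _|n _ _ y _ u]; last by apply/rowP => -[].
  split=> [u v _|w]; first by apply/rowP => -[].
  by exists w.
by apply: tame_dsum => //; exact: tame_iso (P_thin k C a) (tame_thin_reach _).
Qed.

(** A diagram chase as for the four lemma: far out, injectivity on [M] follows from injectivity on
    the middle term of the presentation and surjectivity on the first. *)
Lemma fp_tame M : finitely_presented M -> tame C M.
Proof.
move=> [s1 [s0 [f [g x]]]].
have [fd0 [B0 st0]] := tame_P_sum s0; have [fd1 [B1 st1]] := tame_P_sum s1.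
have gs y w : exists v, g y v = w by have [_ _] := x y; apply.
have ex y v : g y v = 0 <-> exists u, f y u = v by have [_ + _] := x y; apply.
split; first by move=> y; apply: fin_span_surj (gs y) (fd0 y) => a u v; rewrite rhomL.
exists (maxn B0 B1).
have [p1 p2] := stable_leq (leq_maxl B0 B1) st0.
have [q1 q2] := stable_leq (leq_maxr B0 B1) st1.
split=> [y z al h e|n h on y lt u]; last first.
  by have [v <-] := gs y u; rewrite (p2 n h on y lt v) rhom0.
have [i0 j0] := p1 _ _ al h e; have [_ j1] := q1 _ _ al h e; split; last first.
  move=> w; have [v <-] := gs z w; have [u <-] := j0 v.
  by exists (g y u); rewrite rapp_natural.
suff i u : rmap M al u = 0 -> u = 0.
  by move=> u v e'; apply/eqP; rewrite -subr_eq0; apply/eqP/i; rewrite linearB /= e' subrr.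
have [v <-] := gs y u; rewrite -rapp_natural => /ex[w ew].
have [t et] := j1 w; apply/ex; exists t; apply: i0.
by rewrite -ew -et rapp_natural.
Qed.

End FpTame.

Section IntervalBasis.
Variables (k : fieldType) (Q : quiver) (o : nat -> bool) (C : coords Q o) (ev : bool).
Hypothesis evT : ev -> exists N, forall n, (N <= n)%N -> o n.
Hypothesis evF : ~~ ev -> forall N, exists2 n, (N <= n)%N & ~~ o n.
Notation interval := (interval k C ev).
Notation hom_rel := (hom_rel o ev).

Definition interval_obj (p : code) : repp k Q :=
  exist _ (interval p) (fp_interval_code k C evT p).

Lemma thin_basis_intervals :
  @thin_basis k (repp k Q) code interval_obj hom_rel (fun p q => can_hom k C ev p q).
Proof.
split.
- by move=> p q f; exact: (can_span (f : rhom _ _)).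
- exact: can_eq0.
- by move=> p q r; exact: can_comp.
- exact: can_id.
- exact: hom_rel_anti.
- exact: hom_rel_valid.
move=> [M fM]; have tM := fp_tame C fM.
have ee : rcomp (rid M) (rid M) = rid M by apply: rhomP.
have [K [i [p [s [_ _ _ es]]]]] := tame_splits evT evF tM ee.
exists s; exact: es.
Qed.

Lemma repp_biproduct (X Y : repp k Q) : exists Z, is_biproduct Z X Y.
Proof.
case: X Y => [X fX] [Y fY].
exists (exist _ (dsum X Y) (fp_dsum C fX fY)).
exists (rpair (rid X) 0), (rpair 0 (rid Y)), (rfst X Y), (rsnd X Y).
split; apply: rhomP => x // -[u v] /=; congr pair; rewrite /= ?addr0 ?add0r //.
Qed.

Lemma indecomposable_interval (X : repp k Q) : indecomposable X ->
  exists p, hom_rel p p /\ isom (interval_obj p) X.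
Proof.
case: X => M fM [nz ind]; have tM := fp_tame C fM.
have ee : rcomp (rid M) (rid M) = rid M by apply: rhomP.
have [p [h [l [vp _ lh _ _]]]] := split_interval evT evF tM ee nz.
have lhE y u : l y (h y u) = u by have := congr1 (fun f : rhom _ _ => f y u) lh.
exists p; split; first by rewrite hom_rel_refl.
exists h, l; split; first exact: lh.
pose e' := rid M - rcomp h l.
have e'E y u : e' y u = u - h y (l y u) by [].
have ee' : rcomp e' e' = e'.
  apply: rhomP => y u; change (e' y (e' y u) = e' y u).
  by rewrite !e'E !rhomB lhE subrr subr0.
have [K [i [q [_ [fK qi iq _]]]]] := tame_splits evT evF tM ee'.
have qiE y u : q y (i y u) = u by have := congr1 (fun f : rhom _ _ => f y u) qi.
have iqE y u : i y (q y u) = e' y u by have := congr1 (fun f : rhom _ _ => f y u) iq.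
have li : rcomp l i = 0.
  apply: rhomP => y u; change (l y (i y u) = 0).
  by rewrite -(qiE y u) iqE e'E rhomB lhE subrr.
have qh : rcomp q h = 0.
  apply: rhomP => y u; change (q y (h y u) = 0).
  by rewrite -(qiE y (q y _)) iqE e'E lhE subrr rhom0.
have hi : rcomp h l + rcomp i q = rid M by rewrite iq /e' addrC subrK.
have bip : @is_biproduct k (repp k Q) (exist _ M fM) (interval_obj p) (exist _ K fK).
  by exists h, i, l, q.
have vp' : hom_rel p p by rewrite hom_rel_refl.
case: (ind _ _ bip) => [z|z]; first by case: (tb_indecomposable thin_basis_intervals vp').1.
have i0 y u : i y u = 0.
  by have -> : u = 0 := congr1 (fun f : rhom K K => f y u) z; rewrite rhom0.
rewrite -[RHS]hi; apply: rhomP => y u.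
change (h y (l y u) = h y (l y u) + i y (q y u)).
by rewrite i0 addr0.
Qed.

End IntervalBasis.

(** * The Auslander-Reiten quiver *)

Section Orientation.
Variables (Q : quiver) (o : nat -> bool) (C : coords Q o).
Notation pos := (pos C).
Notation vtx := (vtx C).

(** Walking backwards along an infinite path, one can never descend, for the
    descent would have to go on forever. *)
Lemma no_infinite_descent (v : nat -> Q) :
  (forall n, inhabited (arrow (v n.+1) (v n))) -> ~~ o (pos (v 0%N)).
Proof.
have [N] := ubnP (pos (v 0%N)); elim: N v => // N IH v lt path.
apply/negP => ov; have [al] := path 0%N; have := arrow_edge C al.
rewrite /edge ov andbF orbF => /andP[/eqP e o1].
have := IH (fun n => v n.+1) _ (fun n => path n.+1).
by rewrite o1 => /(_ _)/negP h; apply: h => //; lia.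
Qed.

(** Every tail of the path is again infinite, so the edge to the right of each of its vertices
    points left. Hence the path, read backwards, climbs one vertex at a time and meets every n from
    [pos a] on. *)
Lemma ends_left_infinite_pathP (a : Q) :
  ends_left_infinite_path a <-> forall n, (pos a <= n)%N -> ~~ o n.
Proof.
split=> [[v [v0 path]]|oF]; last first.
  exists (fun n => vtx (pos a + n)); split=> [|n]; first by rewrite addn0 posK.
  apply: (edge_arrow (c := C)); rewrite !vtxK /edge oF ?leq_addr //.
  by rewrite addnS eqxx orbT.
have step n : pos (v n.+1) = (pos (v n)).+1.
  have [al] := path n; have := arrow_edge C al; rewrite /edge.
  have := @no_infinite_descent (fun m => v (m + n.+1)%N) (fun m => path (m + n.+1)%N).
  rewrite add0n => /negPf ->.
  by rewrite andbF => /andP[/eqP].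
have pv n : pos (v n) = (pos a + n)%N by elim: n => [|n IH]; [rewrite v0 addn0|rewrite step IH addnS].
move=> n an; have := @no_infinite_descent (fun m => v (m + (n - pos a))%N) (fun m => path (m + (n - pos a))%N).
by rewrite add0n pv subnKC.
Qed.

Lemma no_left_infinite_path_unbounded : ~ has_left_infinite_path Q ->
  forall N, exists2 m, (N <= m)%N & o m.
Proof.
move=> nl N; apply: contrapT => no; apply: nl; exists (vtx N).
apply/ends_left_infinite_pathP => n; rewrite vtxK => Nn.
by apply/negP => on; apply: no; exists n.
Qed.

Lemma left_infinite_path_bounded : has_left_infinite_path Q ->
  exists N, forall m, (N <= m)%N -> ~~ o m.
Proof. by move=> [a /ends_left_infinite_pathP h]; exists (pos a). Qed.

Lemma left_infinite_quiverP : is_left_infinite_path Q <-> forall n, ~~ o n.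
Proof.
split=> [[f [[g fK gK] fa]] n|oF].
  have := iffLR (ends_left_infinite_pathP (vtx n)); apply; last by rewrite vtxK.
  exists (fun m => f (g (vtx n) + m)%N); split=> [|m]; first by rewrite addn0 gK.
  have [h _] := fa (g (vtx n) + m.+1)%N (g (vtx n) + m)%N.
  by constructor; apply: h; rewrite /= addnS eqxx.
exists vtx; split; first by exists pos; [exact: vtxK | exact: posK].
move=> x y; have [e|ne] := boolP (x == y.+1).
  have [al] : inhabited (arrow (vtx x) (vtx y)).
    by apply: (edge_arrow (c := C)); rewrite !vtxK /edge e oF orbT.
  exists (fun _ => al); exists (fun _ => e) => a; last exact: (arrow_eq C).
  exact: (@Prop_irrelevance (x == y.+1)).
exists (fun e : x == y.+1 => False_rect _ (negP ne e)).
have na : arrow (vtx x) (vtx y) -> False.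
  by move=> al; have := arrow_edge C al; rewrite !vtxK /edge (negPf ne) (negPf (oF x)) andbF.
exists (fun a => False_rect _ (na a)) => a; first by case: (negP ne a).
by case: (na a).
Qed.

End Orientation.

(** * Projectives and injectives among the intervals *)

Section ProjectiveInjective.
Variables (k : fieldType) (Q : quiver) (o : nat -> bool) (C : coords Q o) (ev : bool).
Notation pos := (pos C).
Notation vtx := (vtx C).
Notation interval := (interval k C ev).
Notation hom_rel := (hom_rel o ev).
Notation riso := (@isom k (Rep_cat k Q)).

Lemma Thin_iso_sub (b b' : nat -> bool) n :
  riso (Thin k C b) (Thin k C b') -> b n -> b' n.
Proof.
move=> /riso_map[f [fi _]] bn; apply/negPn/negP => nb.
have : f (vtx n) (one k _) = f (vtx n) 0.
  by rewrite [LHS](@coef0 k (b' (pos (vtx n)))) ?vtxK // rhom0.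
move=> /fi/(congr1 (@coef k _)); rewrite coef_one coefE0 natr_true ?vtxK //.
by move/eqP; rewrite oner_eq0.
Qed.

(** If the edge after [j] pointed right, a path reaching [j] would continue beyond the support. *)
Lemma interval_P_part p (a : Q) : hom_rel p p -> riso (interval p) (P_ k a) -> part o p.2 = false.
Proof.
case: p => i [j|] //; rewrite hom_rel_refl /= => ij iso; apply/negP => oj.
have iso' := isom_trans iso (isom_sym (P_thin k C a)).
have rj : reach o (pos a) j by apply: (Thin_iso_sub iso'); rewrite /inI /= ij leqnn.
have rj1 : reach o (pos a) j.+1 by apply: reach_edge rj _; rewrite /edge eqxx oj.
by have := Thin_iso_sub (isom_sym iso') rj1; rewrite /inI /= ltnn andbF.
Qed.

(** One projective is enough to mark a component; that of vertex 0 is supported on the initial run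
    of right-pointing edges. *)
Lemma P_interval : (ev <-> exists N, forall n, (N <= n)%N -> o n) ->
  exists p, hom_rel p p /\ riso (interval p) (P_ k (vtx 0%N)).
Proof.
move=> evP; have iso := P_thin k C (vtx 0%N); rewrite vtxK in iso.
suff [p [vp ep]] : exists p, hom_rel p p /\ inI ev p = reach o 0.
  by exists p; split=> //; rewrite /interval ep.
have rE n : reach o 0 n <-> forall i, (i < n)%N -> o i.
  rewrite reachP; split=> [[h _] i hi|h]; first by apply: h.
  by split=> i hi; [apply: h|]; lia.
have [[r0 nr0]|no] := pselect (exists n, ~~ o n).
  have [r or rmin] := ex_minnP (ex_intro (fun n => ~~ o n) r0 nr0).
  exists (0%N, Some r); split; first by rewrite hom_rel_refl.
  apply: funext => n; apply/idP/idP; rewrite /inI /=.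
    move=> nr; apply/rE => i hi; apply/negPn/negP => oi.
    by have := rmin _ oi; lia.
  by move=> /rE h; rewrite leqNgt; apply/negP => /h; rewrite (negPf or).
have oT n : o n by apply/negPn/negP => h; apply: no; exists n.
have hev : ev by apply/evP; exists 0%N.
exists (0%N, None); split; first by rewrite hom_rel_refl /= hev.
apply: funext => n; apply/idP/idP; rewrite /inI /= hev // => _.
by apply/rE.
Qed.

(** The first vertex with a right-pointing edge after it is a source, so its injective is simple;
    that edge also keeps it from ending a left infinite path. *)
Lemma I_interval (x : nat) : o x -> (forall n, (n < x)%N -> ~~ o n) ->
  in_Qplus (vtx x) /\ riso (interval (x, Some x)) (I_ k (vtx x)).
Proof.
move=> ox xmin; split.
  move=> /(iffLR (@ends_left_infinite_pathP Q o C _))/(_ x).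
  by rewrite vtxK ox leqnn => /(_ isT).
have inx n : inI ev (x, Some x) n = (n == x) by rewrite /inI /= eq_sym eqn_leq.
have src m : reach o m x -> m = x.
  move=> /reachP[r1 r2]; case: (ltngtP m x) => // h.
    by have := r1 m; rewrite (negPf (xmin m h)); lia.
  by have := r2 x; rewrite ox; lia.
have emp z : pos z <> x -> qpath z (vtx x) -> False.
  by move=> ne rho; apply/ne/src; have := qpath_reach C rho; rewrite vtxK.
have [v vP] : {v : forall z, I_ k (vtx x) z & forall z,
    (forall rho, v z = << rho >>) /\ (pos z <> x -> v z = 0)}.
  apply: (@dep_choice _ _ (fun z (v : I_ k (vtx x) z) =>
    (forall rho, v = << rho >>) /\ (pos z <> x -> v = 0))) => z.
  have [e|ne] := eqVneq (pos z) x.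
    have [rho] : inhabited (qpath z (vtx x)).
      by constructor; rewrite -e posK; exact: pnil.
    exists << rho >>; split=> // sigma; by rewrite (qpath_eq C sigma rho).
  by exists 0; split=> // rho; case: (emp z _ rho); exact/eqP.
have I0 z (g : I_ k (vtx x) z) : pos z <> x -> g = 0.
  by move=> ne; apply/malgP => rho; case: (emp z ne rho).
have v0 z : ~~ inI ev (x, Some x) (pos z) -> v z = 0.
  by rewrite inx => /eqP ne; exact: I0.
have vn (y z : Q) (al : arrow y z) : inI ev (x, Some x) (pos y) ->
    rmap (I_ k (vtx x)) al (v y) = v z.
  rewrite inx => /eqP e; have ne : pos z <> x.
    by move=> e'; have := arrow_edge C al; rewrite /edge e e'; lia.
  exact: eq_trans (I0 z _ ne) (esym (I0 z _ ne)).
apply: (bijective_rhom_iso (f := from_thin v0 vn)) => z.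
  move=> u w /= e; apply: rV_eq.
  have [iz|nz] := orP (orbN (inI ev (x, Some x) (pos z))); last by rewrite (coef0 u nz) (coef0 w nz).
  have zx : z = vtx x by move: iz; rewrite inx => /eqP <-; rewrite posK.
  have rho : qpath z (vtx x) by rewrite zx; exact: pnil.
  move: e; rewrite ((vP z).1 rho) => /(congr1 (mcoeff rho)).
  by rewrite !mcoeffZ mcoeffUU !mulr1.
move=> g /=; have [iz|nz] := orP (orbN (inI ev (x, Some x) (pos z))).
  have zx : z = vtx x by move: iz; rewrite inx => /eqP <-; rewrite posK.
  have rho : qpath z (vtx x) by rewrite zx; exact: pnil.
  exists (g@_rho *: one k _).
  rewrite coefZ coef_one (natr_true k iz) mulr1 ((vP z).1 rho).
  by apply/esym/malg_subsingleton => s; exact: (qpath_eq C).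
exists 0; rewrite coefE0 scale0r; apply/esym/I0.
by move: nz; rewrite inx => /eqP.
Qed.

End ProjectiveInjective.

Section RankNeighbours.
Variable o : nat -> bool.

(** A vertex is extremal among the left ends up to it, so its neighbour towards rank 0 has a smaller
    number. *)
Lemma lcov_smaller (i : nat) : (0 < i)%N ->
  exists2 i', (i' < i)%N & lcov o i i' \/ lcov o i' i.
Proof.
case: i => // i _; have := cnt_leq o.
case oi : (o i) => cl.
  have [m em] : exists m, rk o m = rk o i.+1 + 1.
    by apply: (@rk_convex o i.+1 0); rewrite /= oi; lia.
  exists m; last by left; apply/lcov_rk.
  case: m em => [|m] //=; rewrite oi /=; case om : (o m) => /= em; last by lia.
  by rewrite ltnNge; apply/negP => h; have := cl true _ _ h; rewrite /= om oi; lia.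
have [m em] : exists m, rk o m = rk o i.+1 - 1.
  by apply: (@rk_convex o 0 i.+1); rewrite /= oi; lia.
exists m; last by right; apply/lcov_rk; rewrite em subrK.
case: m em => [|m] //=; rewrite oi /=; case om : (o m) => /= em; first by lia.
by rewrite ltnNge; apply/negP => h; have := cl false _ _ h; rewrite /= om oi; lia.
Qed.

Lemma rcov_smaller (ev b : bool) (j j' : nat) : o j = b -> o j' = b -> (j < j')%N ->
  exists m, [/\ o m = b, (m < j')%N &
    rcov o ev (Some m) (Some j') \/ rcov o ev (Some j') (Some m)].
Proof.
move=> oj oj' lt; have h := cnt_lt lt oj.
have [m [mj om em]] : exists m, [/\ (m < j')%N, o m = b & cnt o b m = (cnt o b j').-1].
  by apply: cnt_nth; lia.
exists m; split=> //; case: b oj oj' h om em => oj oj' h om em.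
  by right; apply/(rcov_cnt ev oj' om) => /=; lia.
by left; apply/(rcov_cnt ev om oj') => /=; lia.
Qed.

Lemma rcov_infinity (ev : bool) (j : nat) : (ev -> exists N, forall n, (N <= n)%N -> o n) ->
  ev -> ~~ o j -> exists2 m, ~~ o m & rcov o ev (Some m) None.
Proof.
move=> evT hev oj; have [N oN] := evT hev.
have bound n : ~~ o n -> (n <= N)%N.
  by move=> /negP on; rewrite leqNgt; apply/negP => h; apply/on/oN/ltnW.
have [m om mmax] := ex_maxnP (ex_intro (fun n => ~~ o n) j oj) bound.
exists m => //; split=> // -[y|] _ //; last by right.
move=> /rleP[->|[[my _]|[ym oy]]] /= oy'; [by left| |by rewrite oy in oy'].
by have := mmax _ oy'; lia.
Qed.

End RankNeighbours.

Lemma subsingleton_bij (A B : Type) : (forall a a' : A, a = a') ->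
  (forall b b' : B, b = b') -> (inhabited A <-> inhabited B) ->
  exists h : A -> B, bijective h.
Proof.
move=> uA uB [AB BA]; have [[b]|nB] := pselect (inhabited B).
  have [a] := BA (inhabits b).
  by exists (fun _ => b), (fun _ => a).
exists (fun a => False_rect B (nB (AB (inhabits a)))).
exists (fun b => False_rect A (nB (inhabits b))) => x; last by case: (nB (inhabits x)).
exact: uA.
Qed.

Lemma not_eventually (o : nat -> bool) (ev : bool) :
  (ev <-> exists N, forall n, (N <= n)%N -> o n) ->
  ~~ ev -> forall N, exists2 n, (N <= n)%N & ~~ o n.
Proof.
move=> evP nev N; apply: contrapT => no; move/negP: nev; apply; apply/evP.
by exists N => n Nn; apply/negPn/negP => on; apply: no; exists n.
Qed.

(** * The Auslander-Reiten quiver in terms of codes *)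

Section AuslanderReitenQuiver.
Variables (k : fieldType) (Q : quiver) (o : nat -> bool) (C : coords Q o) (ev : bool).
Hypothesis evP : ev <-> exists N, forall n, (N <= n)%N -> o n.
Variable S : ind_reps (repp k Q).
Notation hom_rel := (hom_rel o ev).
Notation G := (AR_quiver S).

Let evT := iffLR evP.
Let evF := not_eventually evP.

Notation J0 := (interval_obj k C evT).

Lemma codes_exist : exists cd : S -> code,
  [/\ forall X, hom_rel (cd X) (cd X), forall X, isom (J0 (cd X)) (S X),
      injective cd & forall p, hom_rel p p -> exists X, cd X = p].
Proof.
have [cd cdP] : {cd : S -> code & forall X, hom_rel (cd X) (cd X) /\ isom (J0 (cd X)) (S X)}.
  apply: (@choice _ _ (fun (X : S) p => hom_rel p p /\ isom (J0 p) (S X))) => X.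
  exact: (indecomposable_interval C evT evF (ind_indec X)).
exists cd; split=> [X|X|X Y e|p vp].
- by have [] := cdP X.
- by have [] := cdP X.
- apply: ind_inj; have [_ iX] := cdP X; have [_ iY] := cdP Y.
  by rewrite -e in iY; exact: isom_trans (isom_sym iX) iY.
- have [X iX] := ind_full S (tb_indecomposable (thin_basis_intervals k C evT evF) vp).
  exists X; have [vX iX'] := cdP X.
  apply: (tb_isom (thin_basis_intervals k C evT evF)) => //.
  exact: isom_trans iX' (isom_sym iX).
Qed.

Variable cd : S -> code.
Hypothesis cdV : forall X, hom_rel (cd X) (cd X).
Hypothesis cdI : forall X, isom (J0 (cd X)) (S X).
Hypothesis cd_inj : injective cd.
Hypothesis cd_surj : forall p, hom_rel p p -> exists X, cd X = p.

(** The family must contain the objects [S X] themselves, as [irr_dim] and [tau] speak of these and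
    not of isomorphic copies. The codes left over are the empty intervals. *)
Lemma ind_basis : exists (J : code -> repp k Q) (c : forall p q, hom (J p) (J q)),
  (forall X, J (cd X) = S X) /\ thin_basis hom_rel c.
Proof.
have [J JP] : {J : code -> repp k Q & forall p, isom (J0 p) (J p) /\
    forall X, cd X = p -> J p = S X}.
  apply: (@choice _ _ (fun p (Y : repp k Q) => isom (J0 p) Y /\
    forall X, cd X = p -> Y = S X)) => p.
  have [[X eX]|no] := pselect (exists X, cd X = p).
    by exists (S X); rewrite -eX; split=> // Y /cd_inj ->.
  by exists (J0 p); split=> [|X e]; [exact: isom_refl | case: no; exists X].
have [c tb] := thin_basis_transport (thin_basis_intervals k C evT evF) (fun p => (JP p).1).
by exists J, c; split=> // X; apply: (JP _).2.
Qed.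

Lemma AR_irr_dim X Y d : irr_dim (S X) (S Y) d <->
  d = `[< irreducible_rel hom_rel (cd X) (cd Y) >].
Proof.
have [J [c [JE tb]]] := ind_basis; rewrite -!JE.
by rewrite (irr_dim_scalar tb) // (irr_scalarE tb).
Qed.

Lemma AR_irr_dim' X Y d : irr_dim' (S X) (S Y) d <->
  d = `[< irreducible_rel hom_rel (cd X) (cd Y) >].
Proof.
have [J [c [JE tb]]] := ind_basis; rewrite -!JE.
by rewrite (irr_dim'_scalar tb) // (irr_scalarE tb).
Qed.

Lemma AR_arrow_inhabited (X Y : G) :
  inhabited (tarrow X Y) <-> irreducible_rel hom_rel (cd X) (cd Y).
Proof.
split=> [[[d h h' i|d d' h h' d0 ne]]|irr].
- move/AR_irr_dim: h => h; move: i; rewrite h; case: (asboolP _) => // _ [] //.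
- move/AR_irr_dim: h => h; move/AR_irr_dim': h' => h'.
  by move: ne; rewrite h h' eqxx.
have h : irr_dim (S X) (S Y) 1 by apply/AR_irr_dim; rewrite asboolT.
have h' : irr_dim' (S X) (S Y) 1 by apply/AR_irr_dim'; rewrite asboolT.
by constructor; exact: (AR_unvalued h h' ord0).
Qed.

Lemma AR_arrow_eq (X Y : G) (a b : tarrow X Y) : a = b.
Proof.
have nval d d' : irr_dim (S X) (S Y) d -> irr_dim' (S X) (S Y) d' -> d != d' -> False.
  by move=> /AR_irr_dim -> /AR_irr_dim' ->; rewrite eqxx.
case: a => [d h h' i|d d' h h' d0 ne]; last by case: (nval _ _ h h' ne).
case: b => [e g g' j|d2 d2' g g' d0 ne]; last by case: (nval _ _ g g' ne).
have de : d = e by move/AR_irr_dim: (h) => ->; move/AR_irr_dim: (g) => ->.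
subst e; rewrite (Prop_irrelevance g h) (Prop_irrelevance g' h'); congr AR_unvalued.
have d1 : (d <= 1)%N by move/AR_irr_dim: (h) => ->; case: (asboolP _).
by apply: ord_inj; have := ltn_ord i; have := ltn_ord j; lia.
Qed.

Lemma AR_val_none (X Y : G) (a : tarrow X Y) : tval a = None.
Proof.
case: a => [//|d d' h h' d0 ne] /=.
by move/AR_irr_dim: h ne => ->; move/AR_irr_dim': h' => ->; rewrite eqxx.
Qed.

Lemma AR_tau (X Z : G) i l j m : cd X = (i, Some j) -> cd Z = (l, Some m) ->
  lcov o i l -> rcov o ev (Some j) (Some m) -> tau Z X.
Proof.
move=> eX eZ ci cj; have [J [c [JE tb]]] := ind_basis.
have vX := cdV X; have vZ := cdV Z; rewrite eX hom_rel_refl /= in vX; rewrite eZ hom_rel_refl /= in vZ.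
have [Y bY] := repp_biproduct C (J (l, Some j)) (J (i, Some m)).
have [f [g fg]] := square_almost_split tb bY (square_half ci cj vX vZ) (square_half_op ci cj vX vZ).
by rewrite /= -(JE X) -(JE Z) eX eZ; exists Y, f, g.
Qed.

Definition joined (p q : code) : Prop :=
  exists X Y : G, [/\ cd X = p, cd Y = q & connected X Y].

Lemma joined_refl p : hom_rel p p -> joined p p.
Proof. by move=> /cd_surj[X eX]; exists X, X; split=> //; exact: rst_refl. Qed.

Lemma joined_sym p q : joined p q -> joined q p.
Proof. by move=> [X [Y [eX eY c]]]; exists Y, X; split=> //; exact: rst_sym. Qed.

Lemma joined_trans p q r : joined p q -> joined q r -> joined p r.
Proof.
move=> [X [Y [eX eY c]]] [Y' [Z [eY' eZ c']]]; exists X, Z; split=> //.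
have e : Y = Y' by apply: cd_inj; rewrite eY eY'.
by subst Y'; exact: rst_trans c c'.
Qed.

Lemma joined_irr p q : irreducible_rel hom_rel p q -> joined p q.
Proof.
move=> irr; have [pq _ _] := irr; have [vp vq] := hom_rel_valid pq.
have [X eX] := cd_surj vp; have [Y eY] := cd_surj vq.
exists X, Y; split=> //; apply: rst_step.
by apply/AR_arrow_inhabited; rewrite eX eY.
Qed.

(** The left end descends to 0 through smaller numbers, so every interval on the way is nonempty. *)
Lemma joined_origin i j : below ev i j -> joined (i, j) (0%N, j).
Proof.
have [n] := ubnP i; elim: n i => // n IH i lt ij.
have [i0|i0] := posnP i.
  by rewrite i0; apply: joined_refl; rewrite hom_rel_refl; exact: below0 ij.
have [i' i'i cov] := @lcov_smaller o i i0.
have i'j := below_leq (ltnW i'i) ij.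
have i'n : (i' < n)%N by lia.
apply: (joined_trans _ (IH i' i'n i'j)).
case: cov => cov; [|apply: joined_sym]; apply: joined_irr; apply/irr_hom_rel; split;
  by [left | rewrite hom_relE rle_refl ij i'j /= ?andbT; case: cov].
Qed.

Lemma joined_rcov j j' : below ev 0 j -> below ev 0 j' -> rcov o ev j j' ->
  joined (0%N, j) (0%N, j').
Proof.
move=> vj vj' cov; apply: joined_irr; apply/irr_hom_rel; split; last by right.
by rewrite hom_relE lle_refl vj vj' /= ?andbT; case: cov => ->.
Qed.

Lemma joined_finite j j' : o j = o j' -> joined (0%N, Some j) (0%N, Some j').
Proof.
have [n] := ubnP (j + j')%N; elim: n j j' => // n IH j j' lt e.
wlog jj : j j' lt e / (j < j')%N => [H|].
  case: (ltngtP j j') => [h|h|->]; first exact: H.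
    by apply/joined_sym/H => //; rewrite addnC.
  by apply: joined_refl; rewrite hom_rel_refl.
have [m [om mj cov]] := rcov_smaller ev e (erefl (o j')) jj.
have IHm : joined (0%N, Some j) (0%N, Some m) by apply: IH; [lia|rewrite om].
apply: (joined_trans IHm).
by case: cov => cov; [|apply: joined_sym]; apply: joined_rcov.
Qed.

Lemma joined_part j j' : below ev 0 j -> below ev 0 j' -> part o j = part o j' ->
  joined (0%N, j) (0%N, j').
Proof.
have inf (i : nat) : ev -> o i = false -> joined (0%N, Some i) (0%N, None).
  move=> hev /negbT oi; have [m om cov] := rcov_infinity evT hev oi.
  apply: (joined_trans (joined_finite (_ : o i = o m))).
    by rewrite (negPf oi) (negPf om).
  exact: joined_rcov.
case: j j' => [j|] [j'|] //= vj vj' e.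
- exact: joined_finite.
- exact: inf.
- by apply/joined_sym/inf.
- by apply: joined_refl; rewrite hom_rel_refl.
Qed.

(** Arrows preserve the part by [rcov_part]. Conversely, each code is joined to one with left end 0,
    and covers link all right ends of a part. *)
Lemma AR_connected (X Y : G) : connected X Y <-> part o (cd X).2 = part o (cd Y).2.
Proof.
split.
  elim=> [{}X {}Y /AR_arrow_inhabited||//|_ ? _ _ -> //] //.
  case: (cd X) (cd Y) => [i j] [l m] /irr_hom_rel[].
  rewrite hom_relE => /and5P[_ _ ij lj /andP[im lm]] [[_ ->]|[_ cov]] //=.
  by apply: (rcov_part evT evF) cov; [exact: below0 ij | exact: below0 lm].
move=> e; have vX := cdV X; have vY := cdV Y.
have [X' [Y' [eX eY c]]] : joined (cd X) (cd Y).
  case: (cd X) (cd Y) vX vY e => [i j] [l m]; rewrite !hom_rel_refl /= => ij lm e.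
  apply: (joined_trans (joined_origin ij)); apply/joined_sym.
  apply: (joined_trans (joined_origin lm)); apply/joined_sym.
  by apply: joined_part => //; [exact: below0 ij | exact: below0 lm].
by rewrite -(cd_inj eX) -(cd_inj eY).
Qed.

Lemma AR_component X0 b : part o (cd X0).2 = b ->
  @is_component G (fun X => part o (cd X).2 = b).
Proof.
by move=> e; exists X0 => Y; rewrite AR_connected e; split=> ->.
Qed.

Lemma AR_preprojective : the_preprojective (fun X : G => part o (cd X).2 = false).
Proof.
have isoI i : @isom k (Rep_cat k Q) (interval k C ev (cd i)) (sval (S i)) := cdI i.
have low i (y : Q) : vertex_iso i (P_ k y) -> part o (cd i).2 = false.
  move=> iso; apply: (interval_P_part (cdV i)); exact: isom_trans (isoI i) iso.
have [p [vp iso]] := P_interval k C evP; have [X eX] := cd_surj vp.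
have isoX : vertex_iso X (P_ k (vtx C 0)).
  by apply: isom_trans iso; have := isoI X; rewrite eX; exact: isom_sym.
split.
  split; first by apply: (AR_component (X0 := X)); exact: low isoX.
  by exists X, (vtx C 0); split=> //; exact: low isoX.
move=> C' [[x xC] [i [y [C'i iso']]]] z; rewrite xC AR_connected -(low _ _ iso').
by move: C'i; rewrite xC AR_connected => ->; split=> ->.
Qed.

Lemma AR_preinjective n : o n -> is_preinjective (fun X : G => part o (cd X).2 = true).
Proof.
move=> on; have [x ox xmin] := ex_minnP (ex_intro o n on).
have xmin' m : (m < x)%N -> ~~ o m.
  by move=> mx; apply/negP => /xmin; rewrite leqNgt mx.
have [xQ iso] := I_interval k C ev ox xmin'.
have [X eX] : exists X, cd X = (x, Some x) by apply: cd_surj; rewrite hom_rel_refl /= leqnn.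
split; first by apply: (AR_component (X0 := X)); rewrite eX.
exists X, (vtx C x); split=> //; first by rewrite eX.
have isoX : @isom k (Rep_cat k Q) (interval k C ev (cd X)) (sval (S X)) := cdI X.
by apply: isom_trans iso; move: isoX; rewrite eX; exact: isom_sym.
Qed.

Lemma AR_finite_part N : (forall m, (N <= m)%N -> ~~ o m) ->
  finitely_many (fun X : G => part o (cd X).2 = true).
Proof.
move=> oN; have fin (l : seq code) : exists s : seq G, forall X, cd X \in l -> List.In X s.
  elim: l => [|p l [s sl]]; first by exists [::] => X; rewrite in_nil.
  have [[Y eY]|no] := pselect (exists Y, cd Y = p).
    exists (Y :: s) => X; rewrite in_cons => /orP[/eqP e|/sl h]; last by right.
    by left; apply: cd_inj; rewrite eY e.
  exists s => X; rewrite in_cons => /orP[/eqP e|/sl //].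
  by case: no; exists X.
have [s sP] := fin [seq (i, Some j) | i <- iota 0 N, j <- iota 0 N].
exists s => X hX; apply: sP; have := cdV X; move: hX.
case: (cd X) => i [j|] //= oj; rewrite hom_rel_refl /= => ij.
have jN : (j < N)%N by rewrite ltnNge; apply/negP => /oN; rewrite oj.
by apply: (allpairs_f (fun i j => (i, Some j))); rewrite mem_iota ?add0n //=; exact: leq_ltn_trans jN.
Qed.

(** * Identification of an infinite part with N D or N^- D *)

Section Shape.
Variables (b : bool) (P : int -> Prop).
Hypothesis PE : forall n, P n <-> 0 <= sgb b * n.
Hypothesis inf : forall N, exists2 m, (N <= m)%N & o m = b.

Let D := Ainf_quiver (fun n => ~~ o n).
Let CX (X : G) : Prop := part o (cd X).2 = b.

(** [None] lies in the lower part and needs [ev], which leaves only finitely many [m] with [o m]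
    false, against [inf]. *)
Lemma finite_end X : CX X -> exists i j, [/\ cd X = (i, Some j), o j = b & (i <= j)%N].
Proof.
rewrite /CX; have := cdV X; case: (cd X) => i [j|] /=; rewrite hom_rel_refl /=.
  by move=> ij oj; exists i, j.
move=> hev eb; have [N oN] := evT hev; have [m Nm om] := inf N.
by move: (oN m Nm); rewrite om -eb.
Qed.

Lemma AR_coordinates : exists f : {X | CX X} -> {u : ZZ D | P u.1},
  bijective f /\ forall X i j, cd (sval X) = (i, Some j) ->
    sval (f X) = (ncoord o b i j, absz (dcoord o b i j)).
Proof.
have [f fE] : {f : {X | CX X} -> {u : ZZ D | P u.1} & forall X i j,
    cd (sval X) = (i, Some j) -> sval (f X) = (ncoord o b i j, absz (dcoord o b i j))}.
  apply: (@choice _ _ (fun (X : {X | CX X}) (u : {u : ZZ D | P u.1}) => forall i j,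
    cd (sval X) = (i, Some j) -> sval u = (ncoord o b i j, absz (dcoord o b i j)))).
  move=> [X cX]; have [i [j [eX oj ij]]] := finite_end cX.
  have Pu : P (ncoord o b i j, absz (dcoord o b i j)).1 by apply/PE/ncoord_ge0.
  exists (exist _ ((ncoord o b i j, absz (dcoord o b i j)) : ZZ D) Pu) => i' j' /=.
  by rewrite eX => -[-> ->].
exists f; split=> //.
have finj : injective f.
  move=> [X cX] [Y cY] e; have [i [j [eX oj ij]]] := finite_end cX.
  have [l [m [eY om lm]]] := finite_end cY.
  apply: eq_exist; apply: cd_inj; rewrite eX eY.
  have := fE (exist _ X cX) i j eX; rewrite e (fE (exist _ Y cY) l m eY) => -[en ed].
  have {}ed : dcoord o b i j = dcoord o b l m.
    by rewrite -(dcoordK oj ij) -(dcoordK om lm) ed.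
  by have [-> ->] := coord_inj oj om ed (esym en).
have [g gK] : {g : {u : ZZ D | P u.1} -> {X | CX X} & cancel g f}.
  apply: (@choice _ _ (fun u X => f X = u)) => -[[n d] Pn].
  have [i [j [ij oj ed en]]] := coord_surj d inf (iffLR (PE n) Pn).
  have [X eX] : exists X, cd X = (i, Some j) by apply: cd_surj; rewrite hom_rel_refl.
  have cX : CX X by rewrite /CX eX.
  exists (exist _ X cX); have := fE (exist _ X cX) i j eX.
  by case: (f _) => u Pu /= eu; apply: eq_exist; rewrite eu en ed.
exists g => // X; apply: finj; exact: gK.
Qed.

Lemma ZZ_arrow_eq (u v : ZZ D) (a a' : tarrow u v) : a = a'.
Proof.
have ne : v.1 == u.1 -> v.1 == u.1 + 1 -> False by move=> /eqP ->; lia.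
case: a a' => [[e a]|[e a]] [[e' a']|[e' a']]; try by case: (ne _ _).
  by rewrite (Prop_irrelevance e e'); congr (inl (_, _)); exact: (@Prop_irrelevance (is_true _)).
by rewrite (Prop_irrelevance e e'); congr (inr (_, _)); exact: (@Prop_irrelevance (is_true _)).
Qed.

Lemma AR_shape : vtquiver_iso (full_subvtquiver CX) (full_subvtquiver (fun u : ZZ D => P u.1)).
Proof.
have [f [bf fE]] := AR_coordinates; exists f; split=> // -[X cX] [Y cY].
  have [i [j [eX oj ij]]] := finite_end cX; have [l [m [eY om lm]]] := finite_end cY.
  have [|||h bh] := @subsingleton_bij (tarrow X Y) (tarrow (sval (f (exist _ X cX))) (sval (f (exist _ Y cY)))).
  - exact: AR_arrow_eq.
  - exact: ZZ_arrow_eq.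
  - rewrite AR_arrow_inhabited eX eY (fE (exist _ X cX) i j eX) (fE (exist _ Y cY) l m eY).
    exact: coord_arrow.
  - by exists h; split=> // a; apply/esym; exact: AR_val_none.
have [i [j [eX oj ij]]] := finite_end cX; have [l [m [eY om lm]]] := finite_end cY.
rewrite [X in _ <-> X](_ : _ <-> ncoord o b l m = ncoord o b i j - 1 /\
  absz (dcoord o b l m) = absz (dcoord o b i j)); last first.
  by rewrite /= (fE (exist _ X cX) i j eX) (fE (exist _ Y cY) l m eY) /=; split=> [[-> ->]|[-> ->]].
split=> [t|[en ed]]; last first.
  by have [h1 h2] := coord_tau ev oj om ij lm ed en; exact: AR_tau eY eX h1 h2.
have ex n d : 0 <= sgb b * n -> exists X' i' j', [/\ cd X' = (i', Some j'),
    o j' = b, (i' <= j')%N, ncoord o b i' j' = n & absz (dcoord o b i' j') = d].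
  move=> Pn; have [i' [j' [ij' oj' ed' en']]] := coord_surj d inf Pn.
  have [X' eX'] : exists X', cd X' = (i', Some j') by apply: cd_surj; rewrite hom_rel_refl.
  by exists X', i', j'; rewrite ed'.
(* The given translate is compared with one computed from coordinates. For n <= 0 the vertex [X] has
   a translate and tau is single-valued; for n >= 0 the vertex [Y] has an inverse translate and tau
   is injective. In particular no translate exists on the boundary n = 0 of the latter. *)
case: t => [E [f0 [g0 as0]]].
have nX := ncoord_ge0 oj ij; have nY := ncoord_ge0 om lm.
case: (orP (orbN b)) => hb.
  have [|Y' [l' [m' [eY' om' lm' en ed]]]] := ex (ncoord o b i j - 1) (absz (dcoord o b i j)).
    by move: nX; rewrite hb /=; lia.
  have [h1 h2] := coord_tau ev oj om' ij lm' ed en.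
  have [E' [f1 [g1 as1]]] := AR_tau eY' eX h1 h2.
  have e : Y = Y' by apply: ind_inj; exact: tau_functional as0 as1.
  by move: eY; rewrite e eY' => -[<- <-]; split.
have [|X' [i' [j' [eX' oj' ij' en ed]]]] := ex (ncoord o b l m + 1) (absz (dcoord o b l m)).
  by move: nY; rewrite (negPf hb) /=; lia.
have en' : ncoord o b l m = ncoord o b i' j' - 1 by rewrite en addrK.
have [h1 h2] := coord_tau ev oj' om ij' lm (esym ed) en'.
have [E' [f1 [g1 as1]]] := AR_tau eY eX' h1 h2.
have e : X = X' by apply: ind_inj; exact: tau_inj as0 as1.
by move: eX; rewrite e eX' => -[<- <-]; split.
Qed.

End Shape.

End AuslanderReitenQuiver.

Lemma type_Ainf_quiver (o : nat -> bool) : type_Ainf (Ainf_quiver o).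
Proof.
by exists o, id; split=> [|x y]; exists id => //; exists id.
Qed.

Theorem theorem5p16 (k : fieldType) (Q : quiver) (hQ : type_Ainf Q)
    (S : ind_reps (repp k Q)) :
  [/\ ~ has_left_infinite_path Q ->
      exists C D : AR_quiver S -> Prop,
        [/\ consists_of2 C D, the_preprojective C, is_preinjective D &
            shape_NminusAinf (full_subvtquiver D)],
      is_left_infinite_path Q ->
      exists C : AR_quiver S -> Prop,
        [/\ forall X, C X, the_preprojective C &
            shape_NAinf (full_subvtquiver C)] &
      ~ is_left_infinite_path Q -> has_left_infinite_path Q ->
      exists C D : AR_quiver S -> Prop,
        [/\ consists_of2 C D,
            the_preprojective C /\ shape_NAinf (full_subvtquiver C) &
            is_preinjective D /\ finitely_many D]].
Proof.
have [o /type_Ainf_coords[C]] := hQ.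
pose ev := `[< exists N, forall n, (N <= n)%N -> o n >].
have evP : ev <-> exists N, forall n, (N <= n)%N -> o n by split=> /asboolP.
have [cd [cdV cdI cd_inj cd_surj]] := codes_exist C evP S.
pose low (X : AR_quiver S) := part o (cd X).2 = false; pose high (X : AR_quiver S) := part o (cd X).2 = true.
have two : @consists_of2 (AR_quiver S) low high.
  by rewrite /low /high; split=> X; case: (part _ _); [right|left| case|case].
have pre : the_preprojective low by exact: AR_preprojective cdV cdI cd_inj cd_surj.
(* Shared by the cases with left infinite paths: far edges pointing left make the lower part
   infinite. *)
have shape_low : (exists N, forall m, (N <= m)%N -> ~~ o m) ->
    @shape_NAinf (full_subvtquiver low).
  move=> [N oN]; exists (Ainf_quiver (fun n => ~~ o n)); split; first exact: type_Ainf_quiver.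
  apply: (AR_shape cdV cdI cd_inj cd_surj (b := false) (P := fun n => 0 <= n)).
    by move=> n; rewrite mul1r.
  by move=> M; exists (maxn M N); [exact: leq_maxl | exact: (negbTE (oN _ (leq_maxr M N)))].
split.
- move=> /(no_left_infinite_path_unbounded C) inf; exists low, high; split=> //.
    have [n _ on] := inf 0%N; exact: (AR_preinjective cdV cdI cd_inj cd_surj on).
  exists (Ainf_quiver (fun n => ~~ o n)); split; first exact: type_Ainf_quiver.
  apply: (AR_shape cdV cdI cd_inj cd_surj (b := true) (P := fun n => n <= 0)) => // n.
  by rewrite mulN1r Num.Theory.oppr_ge0.
- move=> /(left_infinite_quiverP C) oF; exists low; split=> //.
    by move=> X; rewrite /low; case: (cd X).2 => [j|] //=; exact: negbTE.
  by apply: shape_low; exists 0%N.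
- move=> nl /(left_infinite_path_bounded C) bd; exists low, high; split=> //.
    by split=> //; exact: shape_low.
  have [N oN] := bd; split; last exact: (AR_finite_part cdV cd_inj oN).
  (* As [Q] is not itself a left infinite path, some edge points right and the upper part is
     nonempty. *)
  have [n on] : exists n, o n.
    apply: contrapT => no; apply/nl/(left_infinite_quiverP C) => n.
    by apply/negP => on; apply: no; exists n.
  exact: (AR_preinjective cdV cdI cd_inj cd_surj on).
Qed.
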